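(* For $\mathcal{ALCO}$ weighted knowledge bases, $\mathsf{C}^{p}_{opt}$ (optimal-cost possible BCQ entailment) is in $\Delta^p_2$ in data complexity.
   Context: Fix pairwise disjoint countably infinite sets $\mathsf{N_C}$, $\mathsf{N_R}$, $\mathsf{N_I}$ of concept, role and individual names. $\mathcal{ALCO}$ concepts: $C ::= A \mid \{a\} \mid \top \mid \bot \mid C\sqcap C \mid C\sqcup C \mid \neg C \mid \exists R.C \mid \forall R.C$. A TBox is a finite set of concept inclusions $C\sqsubseteq D$; an ABox is a finite set of assertions $A(a)$, $R(a,b)$. Interpretations $\mathcal I=(\Delta^{\mathcal I},\cdot^{\mathcal I})$ have the usual semantics under a weak standard names assumption: individual names occurring in the input are interpreted as themselves, $a^{\mathcal I}=a\in\Delta^{\mathcal I}$, while $\Delta^{\mathcal I}$ need not contain all of $\mathsf{N_I}$. A weighted knowledge base (WKB) is $\mathcal K_\omega=(\langle\mathcal T,\mathcal A\rangle,\omega)$ with $\omega:\mathcal T\cup\mathcal A\to\mathbb N_{>0}\cup\{\infty\}$ (finite weights may be encoded in binary). For $\tau=B\sqsubseteq C$ let $\mathrm{vio}_\tau(\mathcal I)=(B\sqcap\neg C)^{\mathcal I}$ and $\mathrm{vio}_{\mathcal A}(\mathcal I)=\{\alpha\in\mathcal A\mid\mathcal I\not\models\alpha\}$. $\mathrm{cost}_{\mathcal K_\omega}(\mathcal I)=\sum_{\tau\in\mathcal T}\omega(\tau)|\mathrm{vio}_\tau(\mathcal I)|+\sum_{\alpha\in\mathrm{vio}_{\mathcal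 A}(\mathcal I)}\omega(\alpha)$ (summands with empty violation set are $0$; cost $\infty$ if an infinite-weight element is violated or some violation set is infinite). $\mathrm{optc}(\mathcal K_\omega)=\min_{\mathcal I}\mathrm{cost}_{\mathcal K_\omega}(\mathcal I)$. A BCQ is $q=\exists\vec y\,\psi$ with $\psi$ a conjunction of atoms $A(t)$, $R(t,t')$; $\mathcal I\models q$ iff some map from terms to $\Delta^{\mathcal I}$, identity on individuals, makes all atoms true. $\mathcal K_\omega\models^p_{opt} q$ iff some $\mathcal I$ with cost $=\mathrm{optc}(\mathcal K_\omega)$ satisfies $q$. $\mathsf C^p_{opt}$: given $\mathcal K_\omega$ and BCQ $q$, decide $\mathcal K_\omega\models^p_{opt} q$. Data complexity measures complexity only in the size of the weighted ABox $\{(\alpha,\omega(\alpha))\mid\alpha\in\mathcal A\}$, with the TBox, its weights and the query fixed. $\Delta^p_2$ is the class of problems decidable in polynomial time with an NP oracle. *)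

(* Defs.v *)
From HB Require Import structures.
From Stdlib Require Import PArith.
From Stdlib Require List.
From mathcomp Require Import all_boot all_order all_algebra finmap.
From mathcomp Require Import boolp classical_sets functions cardinality.
From mathcomp Require Import constructive_ereal.

Set Implicit Arguments.
Unset Strict Implicit.
Unset Printing Implicit Defensive.

Import Order.TTheory GRing.Theory Num.Theory.

Local Open Scope classical_set_scope.

(* Names are bit strings.  The three sorts of names are kept apart by the
   syntax, which is what their disjointness amounts to. *)
Definition NC : Type := seq bool.
Definition NR : Type := seq bool.
Definition NI : Type := seq bool.

Inductive concept : Type :=
| CName of NC
| CNom of NI
| CTop
| CBot
| CAnd of concept & concept
| COr of concept & concept
| CNot of concept
| CEx of NR & concept
| CAll of NR & concept.

Record inclusion : Type := Incl { lhs : concept; rhs : concept }.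

Inductive assertion : Type :=
| CAssert of NC & NI
| RAssert of NR & NI & NI.

Inductive weight : Type :=
| Fin of positive
| Inf.

Inductive term : Type :=
| TVar of nat
| TInd of NI.

Inductive atom : Type :=
| CAtom of NC & term
| RAtom of NR & term & term.

(* The atoms of the conjunction; every variable is existentially quantified. *)
Definition bcq : Type := seq atom.

Fixpoint concept_code (C : concept) : GenTree.tree (seq bool) :=
  match C with
  | CName A => GenTree.Node 0 [:: GenTree.Leaf A]
  | CNom a => GenTree.Node 1 [:: GenTree.Leaf a]
  | CTop => GenTree.Node 2 [::]
  | CBot => GenTree.Node 3 [::]
  | CAnd C D => GenTree.Node 4 [:: concept_code C; concept_code D]
  | COr C D => GenTree.Node 5 [:: concept_code C; concept_code D]
  | CNot C => GenTree.Node 6 [:: concept_code C]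
  | CEx r C => GenTree.Node 7 [:: GenTree.Leaf r; concept_code C]
  | CAll r C => GenTree.Node 8 [:: GenTree.Leaf r; concept_code C]
  end.

Fixpoint concept_decode (t : GenTree.tree (seq bool)) : concept :=
  match t with
  | GenTree.Node 0 [:: GenTree.Leaf A] => CName A
  | GenTree.Node 1 [:: GenTree.Leaf a] => CNom a
  | GenTree.Node 3 [::] => CBot
  | GenTree.Node 4 [:: t; u] => CAnd (concept_decode t) (concept_decode u)
  | GenTree.Node 5 [:: t; u] => COr (concept_decode t) (concept_decode u)
  | GenTree.Node 6 [:: t] => CNot (concept_decode t)
  | GenTree.Node 7 [:: GenTree.Leaf r; t] => CEx r (concept_decode t)
  | GenTree.Node 8 [:: GenTree.Leaf r; t] => CAll r (concept_decode t)
  | _ => CTop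
  end.

Lemma concept_codeK : cancel concept_code concept_decode.
Proof. by elim=> //= [C -> D -> | C -> D -> | C -> | r C -> | r C ->]. Qed.

HB.instance Definition _ := Countable.copy concept (can_type concept_codeK).

Lemma inclusionK :
  cancel (fun t => (lhs t, rhs t)) (fun u : concept * concept => Incl u.1 u.2).
Proof. by case. Qed.

HB.instance Definition _ := Countable.copy inclusion (can_type inclusionK).

Definition assertion_code (al : assertion) : (NC * NI) + (NR * NI * NI) :=
  match al with CAssert A a => inl (A, a) | RAssert r a b => inr (r, a, b) end.

Definition assertion_decode (u : (NC * NI) + (NR * NI * NI)) : assertion :=
  match u with inl (A, a) => CAssert A a | inr (r, a, b) => RAssert r a b end.

Lemma assertion_codeK : cancel assertion_code assertion_decode.
Proof. by case. Qed.

HB.instance Definition _ := Countable.copy assertion (can_type assertion_codeK).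

(* A finite set with a weight function on it, presented as a list of weighted
   elements; [wf_weighted] says that no element is listed twice. *)
Definition wtbox : Type := seq (inclusion * weight).
Definition wabox : Type := seq (assertion * weight).

Definition wf_weighted (T : eqType) (s : seq (T * weight)) : bool :=
  uniq (unzip1 s).

Record wkb : Type := WKB { tbox : wtbox; abox : wabox }.

Fixpoint concept_inds (C : concept) : seq NI :=
  match C with
  | CName _ | CTop | CBot => [::]
  | CNom a => [:: a]
  | CAnd C D | COr C D => concept_inds C ++ concept_inds D
  | CNot C | CEx _ C | CAll _ C => concept_inds C
  end.

Definition inclusion_inds (t : inclusion) : seq NI :=
  concept_inds (lhs t) ++ concept_inds (rhs t).

Definition assertion_inds (al : assertion) : seq NI :=
  match al with CAssert _ a => [:: a] | RAssert _ a b => [:: a; b] end.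

Definition term_inds (t : term) : seq NI :=
  match t with TVar _ => [::] | TInd a => [:: a] end.

Definition atom_inds (at_ : atom) : seq NI :=
  match at_ with
  | CAtom _ t => term_inds t
  | RAtom _ t u => term_inds t ++ term_inds u
  end.

Definition input_inds (K : wkb) (q : bcq) : seq NI :=
  flatten [seq inclusion_inds tw.1 | tw <- tbox K] ++
  flatten [seq assertion_inds aw.1 | aw <- abox K] ++
  flatten [seq atom_inds at_ | at_ <- q].

(* A domain consists of some of the individual names (left summand), which
   denote themselves, and of other elements taken from an arbitrary type; it
   need not contain all individual names. *)
Record interp : Type := Interp {
  anon : choiceType;
  dom : set (NI + anon);
  cint : NC -> set (NI + anon);
  rint : NR -> set ((NI + anon) * (NI + anon));
  dom_nonempty : dom !=set0;
  cint_sub : forall A, cint A `<=` dom;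
  rint_sub : forall r, rint r `<=` dom `*` dom
}.
Arguments dom {i} _.

Definition elt (I : interp) : choiceType := (NI + anon I)%type.
Definition ind (I : interp) (a : NI) : elt I := inl a.

(* The weak standard names assumption for the names listed in N. *)
Definition wsna (N : seq NI) (I : interp) : Prop :=
  forall a, a \in N -> dom (ind I a).

Fixpoint cext {I : interp} (C : concept) : set (elt I) :=
  match C with
  | CName A => cint A
  | CNom a => [set ind I a]
  | CTop => dom
  | CBot => set0
  | CAnd C D => cext C `&` cext D
  | COr C D => cext C `|` cext D
  | CNot C => dom `\` cext C
  | CEx r C =>
      [set d | dom d /\ exists e : elt I, rint r (d, e) /\ cext C e]
  | CAll r C =>
      [set d | dom d /\ forall e : elt I, rint r (d, e) -> cext C e]
  end.

Definition sat_assertion (I : interp) (al : assertion) : Prop :=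
  match al with
  | CAssert A a => cint A (ind I a)
  | RAssert r a b => rint r (ind I a, ind I b)
  end.

Definition vio (I : interp) (t : inclusion) : set (elt I) :=
  cext (CAnd (lhs t) (CNot (rhs t))).
Arguments vio : clear implicits.

Definition weight_val (w : weight) : \bar int :=
  match w with Fin p => (Posz (Pos.to_nat p))%:E | Inf => +oo%E end.

Definition ecard (T : choiceType) (X : set T) : \bar int :=
  if `[< finite_set X >] then (Posz #|` fset_set X|)%:E else +oo%E.

(* In extended numbers +oo * 0 = 0, so inclusions without violations do not
   contribute, whatever their weight. *)
Definition cost (K : wkb) (I : interp) : \bar int :=
  ((\sum_(tw <- tbox K) weight_val tw.2 * ecard (vio I tw.1)) +
   (\sum_(aw <- abox K | ~~ `[< sat_assertion I aw.1 >]) weight_val aw.2))%E.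

(* c is the minimal cost among the interpretations satisfying the weak standard
   names assumption for N. *)
Definition is_optc (N : seq NI) (K : wkb) (c : \bar int) : Prop :=
  (exists I, wsna N I /\ cost K I = c) /\
  (forall I, wsna N I -> (c <= cost K I)%E).

Definition term_val (I : interp) (v : nat -> elt I) (t : term) : elt I :=
  match t with TVar x => v x | TInd a => ind I a end.

Definition sat_atom (I : interp) (v : nat -> elt I) (at_ : atom) : Prop :=
  match at_ with
  | CAtom A t => cint A (term_val v t)
  | RAtom r t u => rint r (term_val v t, term_val v u)
  end.

Definition sat_bcq (I : interp) (q : bcq) : Prop :=
  exists v : nat -> elt I, (forall x, dom (v x)) /\ List.Forall (sat_atom v) q.

(* The input of the entailment problem consists of both K and q, hence the
   names of q also fall under the weak standard names assumption. *)
Definition opt_possible (K : wkb) (q : bcq) : Prop :=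
  exists I : interp, [/\ wsna (input_inds K q) I,
    is_optc (input_inds K q) K (cost K I) & sat_bcq I q].

Definition bitstring : Type := seq bool.
Definition language : Type := set bitstring.

Inductive move : Type := MLeft | MStay | MRight.

(* Tape symbols: None is the blank, Some (inl b) a bit, Some (inr g) an
   auxiliary symbol. *)
Definition symbol (G : finType) : finType := option (bool + G)%type.

(* Deterministic multitape oracle Turing machines.  [halt s] is the verdict if
   the machine stops in state s; [query s = Some (y, n)] means that s is a query
   state, in which the oracle answer selects the next state y (yes) or n (no). *)
Record machine : Type := Machine {
  ntapes : nat;
  aux : finType;
  state : finType;
  start : state;
  halt : state -> option bool;
  query : state -> option (state * state);
  qtape : 'I_ntapes;
  trans : state -> {ffun 'I_ntapes -> symbol aux} ->
          state * {ffun 'I_ntapes -> symbol aux * move}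
}.

(* A two-way infinite tape that is blank almost everywhere: the symbols to the
   left of the head, nearest first, and those from the head rightwards. *)
Definition tape (G : finType) : Type := (seq (symbol G) * seq (symbol G))%type.

Definition tape_read (G : finType) (t : tape G) : symbol G := head None t.2.

Definition tape_act (G : finType) (a : symbol G * move) (t : tape G) : tape G :=
  let: (s, m) := a in
  let l := t.1 in
  let r := behead t.2 in
  match m with
  | MLeft => (behead l, [:: head None l, s & r])
  | MStay => (l, s :: r)
  | MRight => (s :: l, r)
  end.

Definition tape_input (G : finType) (x : bitstring) : tape G :=
  ([::], [seq Some (inl b) | b <- x]).

Fixpoint leading_bits (G : finType) (r : seq (symbol G)) : bitstring :=
  match r with Some (inl b) :: r' => b :: leading_bits r' | _ => [::] end.

Definition config (M : machine) : Type :=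
  (state M * {ffun 'I_(ntapes M) -> tape (aux M)})%type.

(* The i-th input is written on the i-th tape; the other tapes are blank. *)
Definition init (M : machine) (xs : seq bitstring) : config M :=
  (start M, [ffun i : 'I_(ntapes M) => tape_input (aux M) (nth [::] xs i)]).

(* The oracle is asked about the maximal block of bits that starts at the head
   of the query tape. *)
Definition step (M : machine) (O : language) (c : config M) : config M :=
  let: (s, ts) := c in
  if halt s is Some _ then c else
  if query s is Some (y, n) then
    (if `[< O (leading_bits (ts (qtape M)).2) >] then y else n, ts)
  else
    let: (s', acts) := trans s [ffun i => tape_read (ts i)] in
    (s', [ffun i => tape_act (acts i) (ts i)]).

(* The verdict reached on inputs xs within t steps, if any. *)
Definition verdict (M : machine) (O : language) (xs : seq bitstring) (t : nat) :
    option bool :=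
  halt (iter t (step O) (init M xs)).1.

(* An empty oracle is of no use, so this is ordinary polynomial time. *)
Definition ptime_relation (V : bitstring -> bitstring -> Prop) : Prop :=
  exists (M : machine) (p : {poly nat}), forall x w,
    verdict M set0 [:: x; w] p.[size x + size w]%R = Some `[< V x w >].

Definition in_NP (L : language) : Prop :=
  exists (V : bitstring -> bitstring -> Prop) (p : {poly nat}),
    ptime_relation V /\
    forall x, L x <-> exists w, (size w <= p.[size x]%R)%N /\ V x w.

Definition in_Delta2p (L : language) : Prop :=
  exists O : language, in_NP O /\
  exists (M : machine) (p : {poly nat}), forall x,
    verdict M O [:: x] p.[size x]%R = Some `[< L x >].

(* Self-delimiting code of a string: every bit is preceded by true, and false
   marks the end. *)
Definition enc_string (s : seq bool) : bitstring :=
  flatten [seq [:: true; b] | b <- s] ++ [:: false].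

(* Binary numeral, least significant bit first. *)
Fixpoint pos_bits (p : positive) : seq bool :=
  match p with
  | xH => [:: true]
  | xO p' => false :: pos_bits p'
  | xI p' => true :: pos_bits p'
  end.

Definition enc_weight (w : weight) : bitstring :=
  match w with Inf => [:: false] | Fin p => true :: enc_string (pos_bits p) end.

Definition enc_assertion (al : assertion) : bitstring :=
  match al with
  | CAssert A a => false :: enc_string A ++ enc_string a
  | RAssert r a b => true :: enc_string r ++ enc_string a ++ enc_string b
  end.

Definition enc_wabox (A : wabox) : bitstring :=
  flatten [seq enc_assertion aw.1 ++ enc_weight aw.2 | aw <- A].

(* Optimal-cost possible entailment with the weighted TBox T and the query q
   fixed: the instances are (codes of) weighted ABoxes. *)
Definition Cpopt_data (T : wtbox) (q : bcq) : language :=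
  [set x | exists A : wabox,
    [/\ wf_weighted A, x = enc_wabox A & opt_possible (WKB T A) q]].

(* Main.v *)
(* Merging the elements with the same type over the subconcepts of the TBox, but
   keeping the individuals of the input apart, makes an interpretation no more
   expensive and preserves the query.  As the number of types depends on the TBox
   only, interpretations can be taken to be tables whose size is polynomial in
   the ABox, and "some table has a cost with the given leading bits" is an NP
   question.  Binary search finds the optimal cost with linearly many such
   questions, and a last one asks for a table of optimal cost that satisfies the
   query.

   On the machine side, the table of a candidate is verified by a function of
   bounded unary numbers: these are computed by nested loops on machines whose
   tapes are unary counters, and binary costs are added column by column with
   unary carries. *)

From HB Require Import structures.
From Stdlib Require Import PArith.
From mathcomp Require Import all_boot all_order all_algebra finmap zify.
From mathcomp Require Import boolp classical_sets cardinality.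
From mathcomp Require Import constructive_ereal.
Require Import Defs.

Set Implicit Arguments.
Unset Strict Implicit.
Unset Printing Implicit Defensive.

(** * Structured commands and their machines *)

(** The oracle tests equality with a given prefix of cost bits, not a threshold. This suffices
    because the bits found so far are those of the optimum: a table whose cost continues them with a
    zero, where the optimum continues with a one, would be cheaper than the optimum. If no
    interpretation has finite cost, every answer is no and the search returns only ones. The number
    of bits is chosen so that no finite cost has this form, and the final answer is then yes: all
    interpretations are optimal, and one in which every name is full satisfies the query. The
    searching machine never parses its input, since the oracle rejects strings that are not codes of
    ABoxes. An ABox may use any number of names, so concept and role names outside the TBox and the
    query get no entry in a table but count as full, which satisfies all their assertions. TBox
    weights are constants, hence the TBox cost is linear in the number of elements and fits a unary
    counter; only the ABox weights, given in binary, call for column addition. *)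

Definition sym : Type := symbol unit.

(* A tape without its (irrelevant) number of explicit trailing blanks: the
   cells to the left of the head, and those from the head rightwards. *)
Definition atape : Type := ((nat -> sym) * (nat -> sym))%type.

Definition abs_tape (t : tape unit) : atape := (nth None t.1, nth None t.2).

Definition scons (T : Type) (a : T) (f : nat -> T) (i : nat) : T :=
  if i is j.+1 then f j else a.

Definition stail (T : Type) (f : nat -> T) (i : nat) : T := f i.+1.

Lemma scons_tail (T : Type) (f : nat -> T) : scons (f 0) (stail f) = f.
Proof. by apply: funext => -[]. Qed.

Definition aread (t : atape) : sym := t.2 0.

Definition aact (a : sym * move) (t : atape) : atape :=
  match a.2 with
  | MLeft => (stail t.1, scons (t.1 0) (scons a.1 (stail t.2)))
  | MStay => (t.1, scons a.1 (stail t.2))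
  | MRight => (scons a.1 t.1, stail t.2)
  end.

Lemma abs_act (a : sym * move) (t : tape unit) :
  abs_tape (tape_act a t) = aact a (abs_tape t).
Proof.
case: a t => s m [l r].
have tl (u : seq sym) : nth None (behead u) = stail (nth None u).
  by apply: funext => i; rewrite nth_behead.
case: m; rewrite /abs_tape /aact /= ?tl; congr pair.
- by apply: funext => -[|[|i]] /=; [case: l | | rewrite nth_behead].
- by apply: funext => -[|i] //=; rewrite nth_behead.
- by apply: funext => -[|i].
Qed.

Lemma abs_read (t : tape unit) : tape_read t = aread (abs_tape t).
Proof. by case: t => l []. Qed.

Lemma aact_stay (t : atape) : aact (aread t, MStay) t = t.
Proof. by case: t => l r; rewrite /aact /aread /= scons_tail. Qed.

Definition tapes : Type := nat -> atape.

Definition upd (ts : tapes) (i : nat) (t : atape) : tapes :=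
  fun j => if j == i then t else ts j.

Lemma upd_same ts i t : upd ts i t i = t.
Proof. by rewrite /upd eqxx. Qed.

Lemma upd_other ts i t j : j != i -> upd ts i t j = ts j.
Proof. by rewrite /upd => /negPf->. Qed.

Lemma upd_id ts i : upd ts i (ts i) = ts.
Proof. by apply: funext => j; rewrite /upd; case: eqP => // ->. Qed.

Lemma upd_upd ts i t u : upd (upd ts i t) i u = upd ts i u.
Proof. by apply: funext => j; rewrite /upd; case: eqP. Qed.

Lemma updC ts i j t u : i != j -> upd (upd ts i t) j u = upd (upd ts j u) i t.
Proof.
move=> ij; apply: funext => l; rewrite /upd.
by have [->|//] := eqVneq l j; rewrite eq_sym (negPf ij).
Qed.

Inductive cmd : Type :=
| Act of nat & (sym -> sym * move)
| Seq of cmd & cmd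
| If of nat & pred sym & cmd & cmd
| While of nat & pred sym & cmd
| Ask of cmd & cmd.

Definition str_cells (s : bitstring) : nat -> sym :=
  nth None [seq Some (inl b) | b <- s].

Lemma leading_bits_cells (r : seq sym) (s : bitstring) :
  nth None r = str_cells s -> leading_bits r = s.
Proof.
elim: s r => [|b s IH] [|a r] //= E.
- by have := congr1 (@^~ 0) E => /= ->.
- by have := congr1 (@^~ 0) E.
have /= -> := congr1 (@^~ 0) E; congr cons; apply: IH.
by apply: funext => i; have := congr1 (@^~ i.+1) E.
Qed.

(* exec c ts ts' n: from ts, c takes exactly n machine steps to reach ts'; the
   query tape is the tape 1. *)
Inductive exec (O : language) : cmd -> tapes -> tapes -> nat -> Prop :=
| ExAct i f ts : exec O (Act i f) ts (upd ts i (aact (f (aread (ts i))) (ts i))) 1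
| ExSeq c1 c2 ts1 ts2 ts3 m n :
    exec O c1 ts1 ts2 m -> exec O c2 ts2 ts3 n -> exec O (Seq c1 c2) ts1 ts3 (m + n)
| ExIf i (p : pred sym) c1 c2 ts ts' n :
    exec O (if p (aread (ts i)) then c1 else c2) ts ts' n ->
    exec O (If i p c1 c2) ts ts' n.+1
| ExWhileF i (p : pred sym) c ts : ~~ p (aread (ts i)) -> exec O (While i p c) ts ts 1
| ExWhileT i (p : pred sym) c ts1 ts2 ts3 m n : p (aread (ts1 i)) ->
    exec O c ts1 ts2 m -> exec O (While i p c) ts2 ts3 n ->
    exec O (While i p c) ts1 ts3 (m + n).+1
| ExAsk c1 c2 s ts ts' n : (ts 1).2 = str_cells s ->
    exec O (if `[< O s >] then c1 else c2) ts ts' n ->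
    exec O (Ask c1 c2) ts ts' n.+1.

(** A state is a program counter in the syntax tree of [c]: tests, loops and queries have an extra
    state [None] in which they are decided, at the cost of one step, whereas [Seq] has no state of
    its own. This matches the step counts in [exec]. *)
Fixpoint cmd_state (c : cmd) : finType :=
  match c with
  | Act _ _ => unit
  | Seq c1 c2 => (cmd_state c1 + cmd_state c2)%type
  | If _ _ c1 c2 => option (cmd_state c1 + cmd_state c2)%type
  | While _ _ c1 => option (cmd_state c1)
  | Ask c1 c2 => option (cmd_state c1 + cmd_state c2)%type
  end.

Fixpoint cmd_entry (c : cmd) : cmd_state c :=
  match c with
  | Act _ _ => tt
  | Seq c1 c2 => inl (cmd_entry c1)
  | If _ _ c1 c2 => None
  | While _ _ c1 => None
  | Ask c1 c2 => None
  end.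

Definition action : Type := option (nat * (sym -> sym * move)).

(* The successor state, None being the exit of the command. *)
Fixpoint cmd_next (c : cmd) (rd : nat -> sym) : cmd_state c -> option (cmd_state c) *
  action :=
  match c return cmd_state c -> option (cmd_state c) * action with
  | Act i f => fun=> (None, Some (i, f))
  | Seq c1 c2 => fun s =>
      match s with
      | inl s => let: (s', a) := cmd_next rd s in
                 (Some (if s' is Some s' then inl s' else inr (cmd_entry c2)), a)
      | inr s => let: (s', a) := cmd_next rd s in (omap inr s', a)
      end
  | If i p c1 c2 => fun s =>
      match s with
      | None =>
          (Some (Some (if p (rd i) then inl (cmd_entry c1) else inr (cmd_entry c2))), None)
      | Some (inl s) => let: (s', a) := cmd_next rd s in (omap (Some \o inl) s', a)
      | Some (inr s) => let: (s', a) := cmd_next rd s in (omap (Some \o inr) s', a)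
      end
  | While i p c1 => fun s =>
      match s with
      | None => (if p (rd i) then Some (Some (cmd_entry c1)) else None, None)
      | Some s => let: (s', a) := cmd_next rd s in (Some s', a)
      end
  | Ask c1 c2 => fun s =>
      match s with
      | None => (None, None)
      | Some (inl s) => let: (s', a) := cmd_next rd s in (omap (Some \o inl) s', a)
      | Some (inr s) => let: (s', a) := cmd_next rd s in (omap (Some \o inr) s', a)
      end
  end.

Fixpoint cmd_asks (c : cmd) : cmd_state c -> option (cmd_state c * cmd_state c) :=
  match c return cmd_state c -> option (cmd_state c * cmd_state c) with
  | Act i f => fun=> None
  | Seq c1 c2 => fun s =>
      match s with
      | inl s => omap (fun u => (inl u.1, inl u.2)) (cmd_asks s)
      | inr s => omap (fun u => (inr u.1, inr u.2)) (cmd_asks s)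
      end
  | If i p c1 c2 => fun s =>
      match s with
      | None => None
      | Some (inl s) => omap (fun u => (Some (inl u.1), Some (inl u.2))) (cmd_asks s)
      | Some (inr s) => omap (fun u => (Some (inr u.1), Some (inr u.2))) (cmd_asks s)
      end
  | While i p c1 => fun s =>
      match s with
      | None => None
      | Some s => omap (fun u => (Some u.1, Some u.2)) (cmd_asks s)
      end
  | Ask c1 c2 => fun s =>
      match s with
      | None => Some (Some (inl (cmd_entry c1)), Some (inr (cmd_entry c2)))
      | Some (inl s) => omap (fun u => (Some (inl u.1), Some (inl u.2))) (cmd_asks s)
      | Some (inr s) => omap (fun u => (Some (inr u.1), Some (inr u.2))) (cmd_asks s)
      end
  end.

Fixpoint cmd_tapes (c : cmd) : nat :=
  match c with
  | Act i _ => i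
  | Seq c1 c2 => maxn (cmd_tapes c1) (cmd_tapes c2)
  | If i _ c1 c2 => maxn i (maxn (cmd_tapes c1) (cmd_tapes c2))
  | While i _ c1 => maxn i (cmd_tapes c1)
  | Ask c1 c2 => maxn (cmd_tapes c1) (cmd_tapes c2)
  end.

Definition mark : sym := Some (inl true).

Section Compile.
Variables (k : nat) (c0 : cmd).

(** When [c0] exits, the machine is in [inl None], which does not halt; one further step reads tape
    2 and moves to a halting state [inl (Some _)]. *)
Definition mstate : finType := (option bool + cmd_state c0)%type.

Definition mact (a : action) (rd : {ffun 'I_k.+3 -> sym}) :
    {ffun 'I_k.+3 -> sym * move} :=
  [ffun i : 'I_k.+3 => if a is Some (j, f) then
    if i == j :> nat then f (rd i) else (rd i, MStay) else (rd i, MStay)].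

(* When c0 is over, the machine accepts if the tape 2 then shows [mark]. *)
Definition compile : machine := @Machine k.+3 unit mstate (inr (cmd_entry c0))
  (fun s => if s is inl h then h else None)
  (fun s => if s is inr s then omap (fun u => (inr u.1, inr u.2)) (cmd_asks s) else None)
  (inord 1)
  (fun s rd => match s with
    | inl _ => (inl (Some (rd (inord 2) == mark)), mact None rd)
    | inr s => let: (s', a) := cmd_next (fun i => rd (inord i)) s in
               (if s' is Some s' then inr s' else inl None, mact a rd)
    end).

(** [c] sits inside [c0]: its states are placed by [h], and leaving it leads to [x]. The machine is
    always that of [c0], so an induction over subcommands has to carry [h] and [x] along. *)
Definition embeds (c : cmd) (h : cmd_state c -> cmd_state c0) (x : mstate) : Prop :=
  forall s, cmd_asks (h s) = omap (fun u => (h u.1, h u.2)) (cmd_asks s) /\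
    forall rd, (let: (s', a) := cmd_next rd (h s) in
                ((if s' is Some s' then inr s' else inl None) : mstate, a)) =
               (let: (s', a) := cmd_next rd s in
                (if s' is Some s' then inr (h s') else x, a)).

Definition same (T : {ffun 'I_k.+3 -> tape unit}) (ts : tapes) : Prop :=
  forall i : 'I_k.+3, abs_tape (T i) = ts i.

Variable O : language.

Definition reaches (s s' : mstate) (ts ts' : tapes) (n : nat) : Prop :=
  forall T, same T ts -> exists2 T', same T' ts' &
    iter n (step (M := compile) O) (s, T) = (s', T').

Lemma reaches_trans s1 s2 s3 ts1 ts2 ts3 m n :
  reaches s1 s2 ts1 ts2 m -> reaches s2 s3 ts2 ts3 n -> reaches s1 s3 ts1 ts3 (m + n).
Proof.
move=> H1 H2 T /H1[T' /H2[T'' sT'' E2] E1]; exists T'' => //.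
by rewrite addnC iterD E1.
Qed.

Lemma mact_same (T : {ffun 'I_k.+3 -> tape unit}) ts a :
  same T ts ->
  same [ffun i => tape_act (mact a [ffun j => tape_read (T j)] i) (T i)]
    (if a is Some (i, f) then upd ts i (aact (f (aread (ts i))) (ts i)) else ts).
Proof.
move=> sT i; rewrite !ffunE abs_act.
case: a => [[j f]|]; last by rewrite abs_read aact_stay.
rewrite /upd; have [<-|_] := eqP; first by rewrite abs_read sT.
by rewrite abs_read aact_stay.
Qed.

Lemma reaches_step c h x (s : cmd_state c) (ts : tapes) : embeds h x -> cmd_asks s = None ->
  cmd_tapes c <= k.+2 ->
  let: (s', a) := cmd_next (fun i => aread (ts (inord i : 'I_k.+3))) s in
  reaches (inr (h s)) (if s' is Some s' then inr (h s') else x) ts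
    (if a is Some (i, f) then upd ts i (aact (f (aread (ts i))) (ts i)) else ts) 1.
Proof.
move=> emb qs ck; have [qh nx] := emb s.
case E: cmd_next => [s' a] T sT.
exists [ffun i => tape_act (mact a [ffun j => tape_read (T j)] i) (T i)].
  exact: mact_same.
rewrite /= qh qs /=.
have -> : (fun i => [ffun i => tape_read (T i)] (inord i)) =
          (fun i => aread (ts (inord i : 'I_k.+3))).
  by apply: funext => i; rewrite ffunE abs_read sT.
have := nx (fun i => aread (ts (inord i : 'I_k.+3))); rewrite E.
by case: cmd_next => s'' a'' [-> ->].
Qed.

Lemma read_inord (ts : tapes) i : i <= k.+2 -> ts (inord i : 'I_k.+3) = ts i.
Proof. by move=> ik; rewrite inordK. Qed.

(** Induction on the execution, for all [h] and [x], because the exit changes: the first half of a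
    [Seq] leaves to the entry of the second, and the body of a loop leaves to the loop test, from
    which the remaining iterations start. *)
Lemma exec_reaches c h x ts ts' n : cmd_tapes c <= k.+2 -> embeds h x ->
  exec O c ts ts' n -> reaches (inr (h (cmd_entry c))) x ts ts' n.
Proof.
move=> ck emb ex; elim: ex h x ck emb => {c ts ts' n}.
- move=> i f ts h x ck emb.
  exact: (reaches_step (s := tt : cmd_state (Act i f)) ts emb).
- move=> c1 c2 ts1 ts2 ts3 m n _ IH1 _ IH2 h x /=; rewrite geq_max => /andP[k1 k2] emb.
  apply: reaches_trans (IH1 (h \o inl) (inr (h (inr (cmd_entry c2)))) k1 _)
    (IH2 (h \o inr) x k2 _) => s.
    have [e1 e2] := emb (inl s); split; first by rewrite /= e1 /=; case: cmd_asks.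
    by move=> rd; rewrite /= e2 /=; case: cmd_next => -[].
  have [e1 e2] := emb (inr s); split; first by rewrite /= e1 /=; case: cmd_asks.
  by move=> rd; rewrite /= e2 /=; case: cmd_next => -[].
- move=> i p c1 c2 ts ts' n _ IH h x /= ck emb.
  have := ck; rewrite !geq_max => /and3P[ki k1 k2].
  have := @reaches_step (If i p c1 c2) h x None ts emb erefl ck.
  rewrite /= read_inord // -[n.+1]add1n => H; apply: reaches_trans H _.
  case: ifP IH => _ IH.
    apply: (IH (h \o Some \o inl)) => // s.
    have [e1 e2] := emb (Some (inl s)); split; first by rewrite /= e1 /=; case: cmd_asks.
    by move=> rd; rewrite /= e2 /=; case: cmd_next => -[].
  apply: (IH (h \o Some \o inr)) => // s.
  have [e1 e2] := emb (Some (inr s)); split; first by rewrite /= e1 /=; case: cmd_asks.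
  by move=> rd; rewrite /= e2 /=; case: cmd_next => -[].
- move=> i p c ts pF h x /= ck emb.
  have := ck; rewrite geq_max => /andP[ki k1].
  have := @reaches_step (While i p c) h x None ts emb erefl ck.
  by rewrite /= read_inord // (negPf pF).
- move=> i p c ts1 ts2 ts3 m n pT _ IH1 _ IH2 h x /= ck emb.
  have := ck; rewrite geq_max => /andP[ki k1].
  have := @reaches_step (While i p c) h x None ts1 emb erefl ck.
  rewrite /= read_inord // pT -addSn -add1n => H.
  apply: reaches_trans (IH2 _ _ ck emb); apply: reaches_trans H _.
  apply: (IH1 (h \o Some)) => // s.
  have [e1 e2] := emb (Some s); split; first by rewrite /= e1 /=; case: cmd_asks.
  by move=> rd; rewrite /= e2 /=; case: cmd_next => -[].
- move=> c1 c2 s ts ts' n Es _ IH h x /= ck emb.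
  have := ck; rewrite geq_max => /andP[k1 k2].
  have H : reaches (inr (h None)) (inr (h (Some (if `[< O s >] then inl (cmd_entry c1)
      else inr (cmd_entry c2))))) ts ts 1.
    move=> T sT; exists T => //=.
    rewrite (emb None).1 /= (@leading_bits_cells _ s).
      by case: ifP.
    by rewrite -Es; have := sT (inord 1); rewrite inordK // => <-.
  rewrite -add1n; apply: reaches_trans H _.
  case: ifP IH => _ IH.
    apply: (IH (h \o Some \o inl)) => // u.
    have [e1 e2] := emb (Some (inl u)); split; first by rewrite /= e1 /=; case: cmd_asks.
    by move=> rd; rewrite /= e2 /=; case: cmd_next => -[].
  apply: (IH (h \o Some \o inr)) => // u.
  have [e1 e2] := emb (Some (inr u)); split; first by rewrite /= e1 /=; case: cmd_asks.
  by move=> rd; rewrite /= e2 /=; case: cmd_next => -[].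
Qed.

End Compile.

Definition blank : atape := (fun=> None, fun=> None).

Definition str_tape (s : bitstring) : atape := (fun=> None, str_cells s).

Definition init_tapes (xs : seq bitstring) : tapes := fun i => str_tape (nth [::] xs i).

Lemma compile_verdict (c : cmd) (O : language) xs ts' n t :
  exec O c (init_tapes xs) ts' n -> n < t ->
  verdict (compile (cmd_tapes c) c) O xs t = Some (aread (ts' 2) == mark).
Proof.
move=> ex nt.
have emb : @embeds c c id (inl None) by move=> s; split=> [|//]; case: (cmd_asks s) =>
  [[]|].
have ck : cmd_tapes c <= (cmd_tapes c).+2 by lia.
have := exec_reaches ck emb ex => /(_ (init (compile (cmd_tapes c) c) xs).2) [].
  by move=> i; rewrite ffunE /abs_tape /=; congr pair; apply: funext => -[].
move=> T sT E; rewrite /verdict -(subnK nt) iterD iterS.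
have -> : init (compile (cmd_tapes c) c) xs = (inr (cmd_entry c), (init (compile
  (cmd_tapes c) c) xs).2).
  by [].
rewrite E /=; set cfg := (_, _).
(* A halted configuration is a fixed point of [step], so every time bound beyond [n] gives the same
   verdict; a polynomial can therefore stand in for the exact running time. *)
have -> : iter (t - n.+1) (step (M := compile (cmd_tapes c) c) O) cfg = cfg.
  by elim: (t - n.+1) => //= m ->.
by rewrite /cfg /= ffunE abs_read sT inordK.
Qed.

(** * Unary counters *)

(** Only an upper bound on the time is kept, so that it can be rounded up at each composition. *)
Definition runs (O : language) (c : cmd) (ts ts' : tapes) (b : nat) : Prop :=
  exists2 n, n <= b & exec O c ts ts' n.

Section Runs.
Variable O : language.

Lemma runs_eq c ts ts1 ts2 b b' :
  runs O c ts ts1 b -> ts1 = ts2 -> b <= b' -> runs O c ts ts2 b'.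
Proof. by move=> [n nb ex] <- bb'; exists n => //; apply: leq_trans bb'. Qed.

Lemma runs_act i f ts : runs O (Act i f) ts (upd ts i (aact (f (aread (ts i))) (ts i))) 1.
Proof. by exists 1 => //; apply: ExAct. Qed.

Lemma runs_seq c1 c2 ts1 ts2 ts3 b1 b2 :
  runs O c1 ts1 ts2 b1 -> runs O c2 ts2 ts3 b2 -> runs O (Seq c1 c2) ts1 ts3 (b1 + b2).
Proof.
by move=> [m mb1 E1] [n nb2 E2]; exists (m + n); [apply: leq_add | apply: ExSeq E1 E2].
Qed.

Lemma runs_if i p c1 c2 ts ts' b :
  runs O (if p (aread (ts i)) then c1 else c2) ts ts' b ->
  runs O (If i p c1 c2) ts ts' b.+1.
Proof. by move=> [n nb ex]; exists n.+1 => //; apply: ExIf. Qed.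

(* F j is the state in which j iterations remain. *)
Lemma runs_while i (p : pred sym) c (F : nat -> tapes) k b :
  (forall j, j < k -> p (aread (F j.+1 i))) -> ~~ p (aread (F 0 i)) ->
  (forall j, j < k -> runs O c (F j.+1) (F j) b) ->
  runs O (While i p c) (F k) (F 0) (k * b.+1 + 1).
Proof.
elim: k => [|k IH] pT pF cR; first by exists 1 => //; apply: ExWhileF.
have [m mb Ec] := cR k (ltnSn k).
have [|//||n nb Ew] := IH; [by move=> j jk; apply: pT; lia | by move=> j jk; apply: cR;
  lia |].
exists (m + n).+1; first by nia.
by apply: ExWhileT Ew => //; apply: pT.
Qed.

End Runs.

Definition ctr_cells (k i : nat) : sym := if (i < k)%N then mark else None.

Definition ctr (k : nat) : atape := (fun=> None, ctr_cells k).

Definition is_mark : pred sym := fun s => s == mark.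

Lemma ctr_read k : is_mark (aread (ctr k)) = (0 < k).
Proof. by rewrite /aread /=; case: k. Qed.

Definition skip (i : nat) : cmd := Act i (fun s => (s, MStay)).
Definition go (m : move) (i : nat) : cmd := Act i (fun s => (s, m)).
Definition put (s : sym) (m : move) (i : nat) : cmd := Act i (fun=> (s, m)).

(** A counter grows to the left, with its top mark under the head, so [inc] and [dec] are local. On
    zero, [dec] merely moves over blanks and the tape still reads as zero; this makes [subtract] a
    truncated subtraction. *)
Definition inc (i : nat) : cmd := Seq (go MLeft i) (put mark MStay i).
Definition dec (i : nat) : cmd := put None MRight i.
Definition clear (s : nat) : cmd := While s is_mark (dec s).
Definition move1 (s d : nat) : cmd := While s is_mark (Seq (dec s) (inc d)).
Definition move2 (s d e : nat) : cmd :=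
  While s is_mark (Seq (dec s) (Seq (inc d) (inc e))).
Definition copy (s d t : nat) : cmd := Seq (move2 s d t) (move1 t s).
Definition subtract (s d : nat) : cmd := While s is_mark (Seq (dec s) (dec d)).

Section Counters.
Variable O : language.

Lemma runs_skip i ts : runs O (skip i) ts ts 1.
Proof. by apply: runs_eq (runs_act _ _ _ _) _ _; rewrite // aact_stay upd_id. Qed.

Lemma runs_inc i ts k : ts i = ctr k -> runs O (inc i) ts (upd ts i (ctr k.+1)) 2.
Proof.
move=> E; apply: runs_eq (runs_seq (runs_act _ _ _ _) (runs_act _ _ _ _)) _ _ => //.
by rewrite upd_upd upd_same E /aact /=; congr upd; congr pair; apply: funext => -[|[]].
Qed.

Lemma runs_dec i ts k : ts i = ctr k -> runs O (dec i) ts (upd ts i (ctr k.-1)) 1.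
Proof.
move=> E; apply: runs_eq (runs_act _ _ _ _) _ _ => //.
rewrite E /aact /=; congr upd; congr pair; apply: funext; first by case.
by case: k E => [|k] E i0 /=.
Qed.

End Counters.

Ltac updsimp := rewrite /upd ?eqxx; repeat (case: eqP => ?; try lia); subst; try done.

Ltac use_tapes :=
  repeat match goal with
    E : ?ts ?s = _ |- context [?ts ?s] =>
      lazymatch type of (ts s) with atape => rewrite E end end.

Ltac tapes_eq :=
  apply: funext => ?; rewrite /upd;
  repeat (case: eqP => ?); subst; try done; try lia; use_tapes; try done;
  try (congr ctr; lia).

Section CounterMoves.
Variable O : language.

Lemma runs_clear s ts a : ts s = ctr a -> runs O (clear s) ts (upd ts s (ctr 0)) (2 * a
  + 1).
Proof.
move=> Es; pose F j := upd ts s (ctr j).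
have -> : ts = F a by rewrite /F -Es upd_id.
rewrite {2}/F upd_upd; apply: runs_eq (@runs_while O s is_mark (dec s) F a 1 _ _ _) _ _.
- by move=> j _; rewrite /F upd_same ctr_read.
- by rewrite /F upd_same ctr_read.
- move=> j _; apply: runs_eq (runs_dec _ (k := j.+1) _) _ _ => //; rewrite /F ?upd_same //.
  by rewrite upd_upd.
- by [].
- by lia.
Qed.

Lemma runs_move1 s d ts a b : s != d -> ts s = ctr a -> ts d = ctr b ->
  runs O (move1 s d) ts (upd (upd ts s (ctr 0)) d (ctr (a + b))) (4 * a + 1).
Proof.
move=> sd Es Ed; pose F j := upd (upd ts s (ctr j)) d (ctr (b + (a - j))).
have E0 : ts = F a by rewrite /F; tapes_eq.
rewrite {1}E0 {E0}; apply: runs_eq (@runs_while O s is_mark _ F a 3 _ _ _) _ _.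
- by move=> j _; rewrite /F updC // upd_same ctr_read.
- by rewrite /F updC // upd_same ctr_read.
- move=> j ja; apply: runs_eq (runs_seq (runs_dec _ (k := j.+1) _)
    (runs_inc _ (k := b + (a - j.+1)) _)) _ _ => //; rewrite /F.
  + by updsimp.
  + by move/eqP: sd => sd; updsimp.
  + by move/eqP: sd => sd; tapes_eq.
- by rewrite /F; tapes_eq.
- by lia.
Qed.

Lemma runs_move2 s d e ts a b c : s != d -> s != e -> d != e ->
  ts s = ctr a -> ts d = ctr b -> ts e = ctr c ->
  runs O (move2 s d e) ts
    (upd (upd (upd ts s (ctr 0)) d (ctr (a + b))) e (ctr (a + c))) (6 * a + 1).
Proof.
move=> /eqP sd /eqP se /eqP de Es Ed Ee.
pose F j := upd (upd (upd ts s (ctr j)) d (ctr (b + (a - j)))) e (ctr (c + (a - j))).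
have Fs j : F j s = ctr j by rewrite /F; updsimp.
have E0 : ts = F a by rewrite /F; tapes_eq.
rewrite {1}E0 {E0}; apply: runs_eq (@runs_while O s is_mark _ F a 5 _ _ _) _ _.
- by move=> j _; rewrite Fs ctr_read.
- by rewrite Fs ctr_read.
- move=> j ja; apply: runs_eq (runs_seq (runs_dec _ (k := j.+1) _)
    (runs_seq (runs_inc _ (k := b + (a - j.+1)) _) (runs_inc _ (k := c + (a - j.+1))
      _))) _ _;
  rewrite /F //.
  + by updsimp.
  + by updsimp.
  + by updsimp.
  + by tapes_eq.
- by rewrite /F; tapes_eq.
- by lia.
Qed.

Lemma runs_copy s d t ts a b : s != d -> s != t -> d != t ->
  ts s = ctr a -> ts d = ctr b -> ts t = ctr 0 ->
  runs O (copy s d t) ts (upd ts d (ctr (a + b))) (10 * a + 2).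
Proof.
move=> sd st dt Es Ed Et.
apply: runs_eq (runs_seq (runs_move2 sd st dt Es Ed Et) (runs_move1 (a := a) (b := 0) _
  _ _)) _ _.
- by rewrite eq_sym.
- by rewrite upd_same addn0.
- by move/eqP: sd; move/eqP: st; updsimp.
- by move/eqP: sd; move/eqP: st; move/eqP: dt => *; tapes_eq.
- by lia.
Qed.

Lemma runs_subtract s d ts a b : s != d -> ts s = ctr a -> ts d = ctr b ->
  runs O (subtract s d) ts (upd (upd ts s (ctr 0)) d (ctr (b - a))) (3 * a + 1).
Proof.
move=> /eqP sd Es Ed; pose F j := upd (upd ts s (ctr j)) d (ctr (b - (a - j))).
have Fs j : F j s = ctr j by rewrite /F; updsimp.
have E0 : ts = F a by rewrite /F; tapes_eq.
rewrite {1}E0 {E0}; apply: runs_eq (@runs_while O s is_mark _ F a 2 _ _ _) _ _.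
- by move=> j _; rewrite Fs ctr_read.
- by rewrite Fs ctr_read.
- move=> j ja; apply: runs_eq (runs_seq (runs_dec _ (k := j.+1) _)
    (runs_dec _ (k := b - (a - j.+1)) _)) _ _; rewrite /F //.
  + by updsimp.
  + by updsimp.
  + by tapes_eq.
- by rewrite /F; tapes_eq.
- by lia.
Qed.

End CounterMoves.

(** * Reading strings: head positions, bits and lengths *)

Definition head_at (x : bitstring) (i : nat) : atape :=
  (fun j => if j < i then str_cells x (i.-1 - j) else None, fun j => str_cells x (i + j)).

Lemma head_at0 x : head_at x 0 = str_tape x.
Proof. by []. Qed.

Lemma head_right x i : aact (aread (head_at x i), MRight) (head_at x i) = head_at x i.+1.
Proof.
rewrite /aact /aread /=; congr pair; apply: funext.
  by move=> [|j] /=; rewrite ?addn0 ?subn0 // ltnS; case: ltnP => // ji; congr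
    str_cells; lia.
by move=> j; rewrite /stail; congr str_cells; lia.
Qed.

Lemma head_left x i : aact (aread (head_at x i.+1), MLeft) (head_at x i.+1) = head_at x i.
Proof.
rewrite /aact /aread /=; congr pair; apply: funext.
  by move=> j; rewrite /stail /= ltnS; case: ltnP => // ji; congr str_cells; lia.
by move=> [|[|j]] /=; rewrite /stail; congr str_cells; lia.
Qed.

Lemma head_read x i : aread (head_at x i) = str_cells x i.
Proof. by rewrite /aread /= addn0. Qed.

Lemma is_mark_cells x i : is_mark (str_cells x i) = nth false x i.
Proof.
rewrite /is_mark /str_cells; have [ix|xi] := ltnP i (size x).
  by rewrite (nth_map false) // /mark; case: nth.
by rewrite !nth_default // size_map.
Qed.

Lemma isSome_cells x i : isSome (str_cells x i) = (i < size x).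
Proof.
rewrite /str_cells; have [ix|xi] := ltnP i (size x); first by rewrite (nth_map false).
by rewrite !nth_default // size_map.
Qed.

Lemma runs_right O x i ts t : ts t = head_at x i ->
  runs O (go MRight t) ts (upd ts t (head_at x i.+1)) 1.
Proof. by move=> E; apply: runs_eq (runs_act _ _ _ _) _ _; rewrite // E head_right. Qed.

Lemma runs_left O x i ts t : ts t = head_at x i.+1 ->
  runs O (go MLeft t) ts (upd ts t (head_at x i)) 1.
Proof. by move=> E; apply: runs_eq (runs_act _ _ _ _) _ _; rewrite // E head_left. Qed.

Definition rewind (t s : nat) : cmd := While s is_mark (Seq (dec s) (go MLeft t)).

(** The head walks right while the index moves from [d] to [d.+1], which then counts the way back.
    For an index past the end the head reads a blank, which is treated as [false], in agreement with
    the default of [nth]. *)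
Definition read_bit (t d : nat) : cmd :=
  Seq (While d is_mark (Seq (dec d) (Seq (inc d.+1) (go MRight t))))
      (Seq (If t is_mark (inc d) (skip d)) (rewind t d.+1)).

Definition length_of (t d : nat) : cmd :=
  Seq (While t isSome (Seq (inc d) (Seq (inc d.+1) (go MRight t)))) (rewind t d.+1).

Section Strings.
Variable O : language.

Lemma runs_rewind t s ts x i : t != s -> ts t = head_at x i -> ts s = ctr i ->
  runs O (rewind t s) ts (upd (upd ts t (str_tape x)) s (ctr 0)) (3 * i + 1).
Proof.
move=> /eqP sd Es Ed; pose F j := upd (upd ts t (head_at x j)) s (ctr j).
have Fs j : F j s = ctr j by rewrite /F; updsimp.
have E0 : ts = F i by rewrite /F; tapes_eq.
rewrite {1}E0 {E0}; apply: runs_eq (@runs_while O s is_mark _ F i 2 _ _ _) _ _.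
- by move=> j _; rewrite Fs ctr_read.
- by rewrite Fs ctr_read.
- move=> j ja; apply: runs_eq (runs_seq (runs_dec _ (k := j.+1) _)
    (runs_left _ (x := x) (i := j) _)) _ _; rewrite /F //.
  + by updsimp.
  + by updsimp.
  + by tapes_eq.
- by rewrite /F; tapes_eq.
- by lia.
Qed.

Lemma runs_read_bit t d ts x i : t < d -> ts t = str_tape x -> ts d = ctr i ->
  ts d.+1 = ctr 0 ->
  runs O (read_bit t d) ts (upd ts d (ctr (nth false x i))) (8 * i + 10).
Proof.
move=> td Et Ed Ed'.
pose F j := upd (upd (upd ts d (ctr j)) d.+1 (ctr (i - j))) t (head_at x (i - j)).
have Fd j : F j d = ctr j by rewrite /F; updsimp.
have E0 : ts = F i by rewrite /F subnn; tapes_eq.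
pose G := upd (upd (upd ts d (ctr (nth false x i))) d.+1 (ctr i)) t (head_at x i).
rewrite {1}E0 {E0}; apply: runs_eq
  (runs_seq (@runs_while O d is_mark _ F i 4 _ _ _)
     (runs_seq (ts2 := G) (runs_if (b := 2) _) (runs_rewind (x := x) (i := i) _ _ _))) _ _.
- by move=> j _; rewrite Fd ctr_read.
- by rewrite Fd ctr_read.
- move=> j ji; apply: runs_eq (runs_seq (runs_dec _ (k := j.+1) _)
    (runs_seq (runs_inc _ (k := i - j.+1) _) (runs_right _ (x := x) (i := i - j.+1)
      _))) _ _;
  rewrite /F //.
  + by updsimp.
  + by updsimp.
  + by updsimp.
  + by rewrite -subSn // subSS; tapes_eq.
- have -> : aread (F 0 t) = str_cells x i.
    by rewrite /F upd_same subn0 head_read.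
  rewrite is_mark_cells; case: ifP => xi.
    apply: runs_eq (runs_inc _ (Fd 0)) _ _ => //.
    by rewrite /F /G subn0 xi; tapes_eq.
  apply: runs_eq (runs_skip _ _ _) _ _ => //.
  by rewrite /F /G subn0 xi; tapes_eq.
- by apply/eqP; lia.
- by rewrite /G; updsimp.
- by rewrite /G; updsimp.
- by rewrite /G; tapes_eq.
- by lia.
Qed.

Lemma runs_length_of t d ts x : t < d -> ts t = str_tape x -> ts d = ctr 0 ->
  ts d.+1 = ctr 0 ->
  runs O (length_of t d) ts (upd ts d (ctr (size x))) (9 * size x + 10).
Proof.
move=> td Et Ed Ed'; set n := size x.
pose F j := upd (upd (upd ts d (ctr (n - j))) d.+1 (ctr (n - j))) t (head_at x (n - j)).
have Ft j : F j t = head_at x (n - j) by rewrite /F upd_same.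
have E0 : ts = F n by rewrite /F subnn; tapes_eq.
rewrite {1}E0 {E0}; apply: runs_eq
  (runs_seq (@runs_while O t isSome _ F n 5 _ _ _)
     (runs_rewind (x := x) (i := n) _ _ _)) _ _.
- by move=> j jn; rewrite Ft head_read isSome_cells -/n; lia.
- by rewrite Ft head_read isSome_cells subn0 ltnn.
- move=> j ji; apply: runs_eq (runs_seq (runs_inc _ (k := n - j.+1) _)
    (runs_seq (runs_inc _ (k := n - j.+1) _) (runs_right _ (x := x) (i := n - j.+1)
      _))) _ _;
  rewrite /F //.
  + by updsimp.
  + by updsimp.
  + by updsimp.
  + by rewrite -subSn // subSS; tapes_eq.
- by apply/eqP; lia.
- by rewrite Ft subn0.
- by rewrite /F subn0; updsimp.
- by rewrite /F subn0; tapes_eq.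
- by lia.
Qed.

End Strings.

(** * Expressions over bounded unary numbers *)

(** The base is at least 2 even for [m = 0], so constants, sums and products are absorbed by a
    larger exponent and no coefficients have to be tracked. *)
Definition poly_bounded (f : nat -> nat) : Prop := exists k, forall m, f m <= (m + 2) ^ k.

Lemma poly_bounded_cst c : poly_bounded (fun=> c).
Proof.
exists c => m; case: c => // c; apply: leq_trans (ltnW (ltn_expl _ (ltnSn 1))) _.
by rewrite leq_exp2r // leq_addl.
Qed.

Lemma poly_bounded_id : poly_bounded id.
Proof. by exists 1 => m; rewrite expn1; lia. Qed.

Lemma poly_boundedM f g : poly_bounded f -> poly_bounded g ->
  poly_bounded (fun m => f m * g m).
Proof. by move=> [a fa] [b gb]; exists (a + b) => m; rewrite expnD leq_mul. Qed.

Lemma poly_boundedD f g : poly_bounded f -> poly_bounded g ->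
  poly_bounded (fun m => f m + g m).
Proof.
move=> [a fa] [b gb]; exists (a + b).+1 => m; rewrite expnS.
have := fa m; have := gb m; rewrite expnD.
have : 0 < (m + 2) ^ a by rewrite expn_gt0 addn2.
have : 0 < (m + 2) ^ b by rewrite expn_gt0 addn2.
by nia.
Qed.

Lemma poly_boundedX f k : poly_bounded f -> poly_bounded (fun m => f m ^ k).
Proof.
by move=> [a fa]; exists (a * k) => m; rewrite expnM; case: k => // k; rewrite leq_exp2r.
Qed.

Ltac poly_tac :=
  repeat first [apply: poly_boundedD | apply: poly_boundedM | apply: poly_boundedX
               | exact: poly_bounded_id | exact: poly_bounded_cst].

(* Every value of an expression is bounded by a polynomial in the lengths of the
   two strings and the values of the variables: the only loop construct, ERec,
   truncates the accumulator to the value of its second argument. *)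
Inductive expr : Type :=
| EVar of nat
| ECst of nat
| EBit of bool & expr
| ELen of bool
| EAdd of expr & expr
| ESub of expr & expr
| EMul of expr & expr
| ECond of expr & expr & expr
| ERec of expr & expr & expr & expr.

(** Limited recursion: without the cap, iterated multiplication would produce values that no unary
    counter holds in polynomial time. The start value [a] is not truncated, hence the bound
    [cap + a] in [brec_le]. *)
Fixpoint brec (n cap a : nat) (g : nat -> nat -> nat) : nat :=
  if n is n'.+1 then minn cap (g n' (brec n' cap a g)) else a.

Section Eval.
Variables y w : bitstring.

Fixpoint eval (e : expr) (env : nat -> nat) : nat :=
  match e with
  | EVar i => env i
  | ECst n => n
  | EBit b e => nth false (if b then w else y) (eval e env)
  | ELen b => size (if b then w else y)
  | EAdd e1 e2 => eval e1 env + eval e2 env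
  | ESub e1 e2 => eval e1 env - eval e2 env
  | EMul e1 e2 => eval e1 env * eval e2 env
  | ECond e1 e2 e3 => if eval e1 env is 0 then eval e3 env else eval e2 env
  | ERec e1 e2 e3 e4 =>
      brec (eval e1 env) (eval e2 env) (eval e3 env)
        (fun i s => eval e4 (scons i (scons s env)))
  end.
End Eval.

Fixpoint put_cst (n d : nat) : cmd :=
  if n is n'.+1 then Seq (inc d) (put_cst n' d) else skip d.

(* The tape v i holds the i-th variable in unary; the tapes from d on are zero,
   and the value is put on the tape d. *)
Fixpoint code (e : expr) (v : nat -> nat) (d : nat) : cmd :=
  match e with
  | EVar i => copy (v i) d d.+1
  | ECst n => put_cst n d
  | EBit b e => Seq (code e v d) (read_bit b d)
  | ELen b => length_of b d
  | EAdd e1 e2 => Seq (code e1 v d) (Seq (code e2 v d.+1) (move1 d.+1 d))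
  | ESub e1 e2 => Seq (code e1 v d) (Seq (code e2 v d.+1) (subtract d.+1 d))
  | EMul e1 e2 =>
      Seq (code e1 v d.+1) (Seq (code e2 v d.+2)
        (Seq (While d.+1 is_mark (Seq (dec d.+1) (copy d.+2 d d.+3))) (clear d.+2)))
  | ECond e1 e2 e3 =>
      Seq (code e1 v d) (If d is_mark (Seq (clear d) (code e2 v d)) (code e3 v d))
  | ERec e1 e2 e3 e4 =>
      Seq (code e3 v d) (Seq (code e1 v d.+1) (Seq (code e2 v d.+3)
        (Seq (While d.+1 is_mark
          (Seq (code e4 (scons d.+2 (scons d v)) d.+4)
          (Seq (copy d.+3 (d + 5) (d + 6))
          (Seq (subtract d.+4 (d + 5))
          (Seq (copy d.+3 d.+4 (d + 6))
          (Seq (subtract (d + 5) d.+4)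
          (Seq (clear d)
          (Seq (move1 d.+4 d)
          (Seq (dec d.+1) (inc d.+2))))))))))
        (Seq (clear d.+2) (clear d.+3)))))
  end.

Section Code.
Variables (O : language) (y w : bitstring).

Definition ready (ts : tapes) (env v : nat -> nat) (d : nat) : Prop :=
  [/\ ts 0 = str_tape y, ts 1 = str_tape w,
      forall i, [/\ 1 < v i, v i < d & ts (v i) = ctr (env i)],
      forall j, d <= j -> ts j = ctr 0 & 1 < d].

Lemma ready_upd ts env v d t : ready ts env v d -> ready (upd ts d t) env v d.+1.
Proof.
move=> [t0 t1 tv td d1]; split; try by rewrite upd_other //; apply/eqP; lia.
- move=> i; have [v1 vd E] := tv i; split=> //; first by lia.
  by rewrite upd_other //; apply/eqP; lia.
- by move=> j jd; rewrite upd_other ?td //; [lia | apply/eqP; lia].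
- by lia.
Qed.

Lemma ready_skip ts env v d : ready ts env v d -> ready ts env v d.+1.
Proof.
move=> [t0 t1 tv td d1]; split=> //; last by lia.
  by move=> i; have [] := tv i; split=> //; lia.
by move=> j jd; apply: td; lia.
Qed.

Lemma runs_put_cst n d ts k : ts d = ctr k ->
  runs O (put_cst n d) ts (upd ts d (ctr (n + k))) (2 * n + 1).
Proof.
elim: n ts k => [|n IH] ts k Ed; first by rewrite -Ed upd_id; apply: runs_skip.
apply: runs_eq (runs_seq (runs_inc _ Ed) (IH _ k.+1 _)) _ _; last by lia.
  by rewrite upd_same.
by rewrite upd_upd addnS.
Qed.

End Code.

(** [B] bounds value and running time at once, for every [m] above the lengths and the variables.
    Since [m] is free, the body of a loop can be charged at the larger bound that its accumulator
    reaches. *)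
Definition computed (e : expr) (B : nat -> nat) : Prop :=
  forall (O : language) y w m env v d ts,
    size y <= m -> size w <= m -> (forall i, env i <= m) ->
    ready y w ts env v d ->
    eval y w e env <= B m /\
    runs O (code e v d) ts (upd ts d (ctr (eval y w e env))) (B m).

Lemma computed_poly e B : computed e B -> poly_bounded B ->
  exists k, computed e (fun m => (m + 2) ^ k).
Proof.
move=> eB [k Bk]; exists k => O y w m env v d ts ym wm em rd.
have [vB rB] := eB O y w m env v d ts ym wm em rd; split; first exact: leq_trans (Bk m).
exact: runs_eq rB erefl (Bk m).
Qed.

Lemma if0 (T : Type) n (a b : T) : (if n is 0 then b else a) = if 0 < n then a else b.
Proof. by case: n. Qed.

Lemma brec_le n cap a g : brec n cap a g <= cap + a.
Proof. by case: n => [|n] /=; [exact: leq_addl | lia]. Qed.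

Lemma computed_rec e1 e2 e3 e4 k1 k2 k3 k4 :
  computed e1 (fun m => (m + 2) ^ k1) -> computed e2 (fun m => (m + 2) ^ k2) ->
  computed e3 (fun m => (m + 2) ^ k3) -> computed e4 (fun m => (m + 2) ^ k4) ->
  exists k, computed (ERec e1 e2 e3 e4) (fun m => (m + 2) ^ k).
Proof.
move=> H1 H2 H3 H4.
(* [M m] bounds all variables seen by the body: [m] the old ones, the powers the index, the cap and
   the start value. [L m] then bounds one evaluation of the body, and [B m] the whole loop. *)
pose M m := m + (m + 2) ^ k1 + (m + 2) ^ k2 + (m + 2) ^ k3.
pose L m := (M m + 2) ^ k4.
pose B m := (M m).+1 * (100 + 100 * L m + 100 * M m).
apply: (@computed_poly _ B); last first.
  rewrite /B /L /M.
  apply: poly_boundedM; last by poly_tac.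
  have -> : (fun m => (m + (m + 2) ^ k1 + (m + 2) ^ k2 + (m + 2) ^ k3).+1) =
    (fun m => m + (m + 2) ^ k1 + (m + 2) ^ k2 + (m + 2) ^ k3 + 1).
    by apply: funext => m; rewrite addn1.
  by poly_tac.
move=> O y w m env v d ts ym wm em rd.
have [b3 r3] := H3 O y w m env v d ts ym wm em rd.
have rd1 := ready_upd (ctr (eval y w e3 env)) rd.
have [b1 r1] := H1 O y w m env v d.+1 _ ym wm em rd1.
have rd2 := ready_upd (ctr (eval y w e1 env)) rd1.
have [b2 r2] := H2 O y w m env v d.+3 _ ym wm em (ready_skip rd2).
have rd3 := ready_upd (ctr (eval y w e2 env)) (ready_skip rd2).
have Zd := rd.
case: Zd => t0 t1 tv td d1.
rewrite /= in r1 r2 r3 *.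
set n1 := eval y w e1 env in b1 r1 rd2 rd3 r2 *.
set n2 := eval y w e2 env in b2 r2 rd3 *.
set n3 := eval y w e3 env in b3 r3 rd1 rd2 rd3 r1 r2 *.
pose g i s := eval y w e4 (scons i (scons s env)).
pose A i := brec i n2 n3 g.
have AM i : A i <= M m by have := brec_le i n2 n3 g; rewrite /M /A; lia.
(* The tapes when [j] iterations remain: the accumulator on [d], the countdown on [d.+1], the index
   passed to [e4] on [d.+2], the cap on [d.+3]. *)
pose F j := upd (upd (upd (upd ts d (ctr (A (n1 - j)))) d.+1 (ctr j)) d.+2 (ctr (n1 - j)))
              d.+3 (ctr n2).
rewrite -/g -/(A n1).
split; first by have := AM n1; rewrite /B; nia.
have Fd j : F j d = ctr (A (n1 - j)) by rewrite /F; updsimp.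
have F1 j : F j d.+1 = ctr j by rewrite /F; updsimp.
have F2 j : F j d.+2 = ctr (n1 - j) by rewrite /F; updsimp.
have F3 j : F j d.+3 = ctr n2 by rewrite /F; updsimp.
have Fz j l : d.+4 <= l -> F j l = ctr 0.
  by move=> dl; rewrite /F !upd_other ?td //; try (apply/eqP); lia.
have rF j : j < n1 ->
    ready y w (F j.+1) (scons (n1 - j.+1) (scons (A (n1 - j.+1)) env))
      (scons d.+2 (scons d v)) d.+4.
  move=> jn; split.
  - by rewrite /F !upd_other //; apply/eqP; lia.
  - by rewrite /F !upd_other //; apply/eqP; lia.
  - move=> [|[|i]] /=; first by split=> //; lia.
      by split=> //; lia.
    have [v1 vd E] := tv i; split=> //; first by lia.
    by rewrite /F !upd_other //; apply/eqP; lia.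
  - by move=> l dl; apply: Fz.
  - by lia.
have body j : j < n1 -> runs O
    (Seq (code e4 (scons d.+2 (scons d v)) d.+4)
          (Seq (copy d.+3 (d + 5) (d + 6))
          (Seq (subtract d.+4 (d + 5))
          (Seq (copy d.+3 d.+4 (d + 6))
          (Seq (subtract (d + 5) d.+4)
          (Seq (clear d)
          (Seq (move1 d.+4 d)
          (Seq (dec d.+1) (inc d.+2)))))))))
    (F j.+1) (F j) (50 + 50 * L m + 50 * M m).
  move=> jn.
  have em' i : scons (n1 - j.+1) (scons (A (n1 - j.+1)) env) i <= M m.
    by case: i => [|[|i]] /=; [rewrite /M; lia | exact: AM | have := em i; rewrite /M; lia].
  have Mm : m <= M m by rewrite /M; lia.
  have [] := H4 O y w (M m) _ _ _ _ (leq_trans ym Mm) (leq_trans wm Mm) em' (rF j jn).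
  rewrite -/(g _ _) -/(L m); set gv := g _ _; move=> gL r4.
  (* The minimum comes from two truncated subtractions, as [n2 - (n2 - gv)], which is why the cap is
     copied twice per iteration. *)
  have Ad : A (n1 - j) = minn n2 gv.
    by rewrite /A /gv (_ : n1 - j = (n1 - j.+1).+1) //; lia.
  have := AM (n1 - j.+1) => AM'.
  have n2M : n2 <= M m by rewrite /M; lia.
  apply: runs_eq (runs_seq r4
    (runs_seq (runs_copy _ (a := n2) (b := 0) _ _ _ _ _ _)
    (runs_seq (runs_subtract _ (a := gv) (b := n2) _ _ _)
    (runs_seq (runs_copy _ (a := n2) (b := 0) _ _ _ _ _ _)
    (runs_seq (runs_subtract _ (a := n2 - gv) (b := n2) _ _ _)
    (runs_seq (runs_clear _ (a := A (n1 - j.+1)) _)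
    (runs_seq (runs_move1 _ (a := minn n2 gv) (b := 0) _ _ _)
    (runs_seq (runs_dec _ (k := j.+1) _) (runs_inc _ (k := n1 - j.+1) _)))))))))
    _ _; try (by apply/eqP; lia);
    try (by rewrite /upd; repeat (case: eqP => ?; try lia); rewrite ?Fd ?F1 ?F2 ?F3 ?Fz //;
          try (congr ctr); lia).
  apply: funext => l; rewrite /F /upd; repeat (case: eqP => ?; try lia); subst => //;
    by [congr ctr; lia | rewrite td //; lia].
have F0 : upd (upd (upd ts d (ctr n3)) d.+1 (ctr n1)) d.+3 (ctr n2) = F n1.
  apply: funext => l; rewrite /F subnn /upd; repeat (case: eqP => ?; try lia); subst => //.
  by rewrite td //; lia.
rewrite F0 in r2.
apply: runs_eq (runs_seq r3 (runs_seq r1 (runs_seq r2 (runs_seq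
  (@runs_while O d.+1 is_mark _ F n1 (50 + 50 * L m + 50 * M m) _ _ body)
  (runs_seq (runs_clear _ (a := n1) _) (runs_clear _ (a := n2) _)))))) _ _.
- by move=> j _; rewrite F1 ctr_read.
- by rewrite F1 ctr_read.
- by rewrite F2 subn0.
- by rewrite upd_other ?F3 //; apply/eqP; lia.
- apply: funext => l; rewrite /F subn0 /upd; repeat (case: eqP => ?; try lia); subst => //.
  all: try by rewrite td //; lia.
- rewrite /B.
  have -> : (m + 2) ^ k3 + ((m + 2) ^ k1 + ((m + 2) ^ k2 +
     (n1 * (50 + 50 * L m + 50 * M m).+1 + 1 + (2 * n1 + 1 + (2 * n2 + 1))))) =
     n1 * (50 + 50 * L m + 50 * M m).+1 +
     ((m + 2) ^ k1 + (m + 2) ^ k2 + (m + 2) ^ k3 + 2 * n1 + 2 * n2 + 3) by lia.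
  have n1M : n1 <= M m by rewrite /M; lia.
  have : (m + 2) ^ k1 + (m + 2) ^ k2 + (m + 2) ^ k3 + 2 * n1 + 2 * n2 + 3 <=
    10 * (M m).+1 by rewrite /M; lia.
  by nia.
Qed.

Lemma exprs_computed e : exists k, computed e (fun m => (m + 2) ^ k).
Proof.
elim: e => [i|n|b e [k H]|b|e1 [k1 H1] e2 [k2 H2]|e1 [k1 H1] e2 [k2 H2]
           |e1 [k1 H1] e2 [k2 H2]|e1 [k1 H1] e2 [k2 H2] e3 [k3 H3]
           |e1 [k1 H1] e2 [k2 H2] e3 [k3 H3] e4 [k4 H4]].
- apply: (@computed_poly _ (fun m => 10 * m + 2)); last by poly_tac.
  move=> O y w m env v d ts ym wm em [t0 t1 tv td d1] /=.
  have [v1 vd Ev] := tv i; have ei := em i; split; first by lia.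
  apply: runs_eq (runs_copy _ _ _ _ Ev (td d _) (td d.+1 _)) _ _;
    rewrite ?addn0 //; try (apply/eqP); lia.
- apply: (@computed_poly _ (fun m => 2 * n + 1)); last by poly_tac.
  move=> O y w m env v d ts ym wm em [t0 t1 tv td d1] /=; split; first by lia.
  by apply: runs_eq (runs_put_cst _ _ (td d _)) _ _; rewrite ?addn0.
- apply: (@computed_poly _ (fun m => 9 * (m + 2) ^ k + 20)); last by poly_tac.
  move=> O y w m env v d ts ym wm em rd /=.
  have [vB rB] := H O y w m env v d ts ym wm em rd.
  have [t0 t1 tv td _] := ready_upd (ctr (eval y w e env)) rd.
  have [_ _ _ _ d1] := rd.
  split; first by case: nth => /=; lia.
  apply: runs_eq (runs_seq rB (runs_read_bit _ (x := if b then w else y) _ _ _ _)) _ _.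
  + by case: (b); lia.
  + by case: (b).
  + by rewrite upd_same.
  + by rewrite td.
  + by rewrite upd_upd.
  + by lia.
- apply: (@computed_poly _ (fun m => 9 * m + 10)); last by poly_tac.
  move=> O y w m env v d ts ym wm em [t0 t1 tv td d1] /=; split; first by case: (b); lia.
  apply: runs_eq (runs_length_of _ (x := if b then w else y) _ _ _ _) _ _ => //.
  + by case: (b); lia.
  + by case: (b).
  + by rewrite td.
  + by rewrite td.
  + by case: (b); lia.
- apply: (@computed_poly _ (fun m => 10 * (m + 2) ^ k1 + 10 * (m + 2) ^ k2 + 20)); last
  by poly_tac.
  move=> O y w m env v d ts ym wm em rd /=.
  have [b1 r1] := H1 O y w m env v d ts ym wm em rd.
  have rd1 := ready_upd (ctr (eval y w e1 env)) rd.
  have [b2 r2] := H2 O y w m env v d.+1 _ ym wm em rd1.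
  have [t0 t1 tv td d1] := rd; split; first by lia.
  apply: runs_eq (runs_seq r1 (runs_seq r2 (runs_move1 _ _ (upd_same _ _ _)
     (b := eval y w e1 env) _))) _ _.
  + by apply/eqP; lia.
  + by updsimp.
  + by tapes_eq; rewrite td.
  + by lia.
- apply: (@computed_poly _ (fun m => 10 * (m + 2) ^ k1 + 10 * (m + 2) ^ k2 + 20)); last
  by poly_tac.
  move=> O y w m env v d ts ym wm em rd /=.
  have [b1 r1] := H1 O y w m env v d ts ym wm em rd.
  have rd1 := ready_upd (ctr (eval y w e1 env)) rd.
  have [b2 r2] := H2 O y w m env v d.+1 _ ym wm em rd1.
  have [t0 t1 tv td d1] := rd; split; first by lia.
  apply: runs_eq (runs_seq r1 (runs_seq r2 (runs_subtract _ _ (upd_same _ _ _)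
     (b := eval y w e1 env) _))) _ _.
  + by apply/eqP; lia.
  + by updsimp.
  + by tapes_eq; rewrite td.
  + by lia.
- apply: (@computed_poly _ (fun m => 20 * ((m + 2) ^ k1 + 1) * ((m + 2) ^ k2 + 1)));
    last by poly_tac.
  move=> O y w m env v d ts ym wm em rd /=.
  have [b1 r1] := H1 O y w m env v d.+1 ts ym wm em (ready_skip rd).
  have rd1 := ready_upd (ctr (eval y w e1 env)) (ready_skip rd).
  have [b2 r2] := H2 O y w m env v d.+2 _ ym wm em rd1.
  have [t0 t1 tv td d1] := rd.
  set n1 := eval y w e1 env in b1 r1 r2 *.
  set n2 := eval y w e2 env in b2 r2 *.
  split; first by nia.
  pose F j := upd (upd (upd ts d (ctr ((n1 - j) * n2))) d.+1 (ctr j)) d.+2 (ctr n2).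
  have F0 : upd (upd ts d.+1 (ctr n1)) d.+2 (ctr n2) = F n1.
    by rewrite /F subnn; tapes_eq; rewrite td.
  rewrite F0 in r2.
  apply: runs_eq (runs_seq r1 (runs_seq r2 (runs_seq
    (@runs_while O d.+1 is_mark _ F n1 (3 + 10 * n2) _ _ _)
    (runs_clear _ (a := n2) _)))) _ _.
  + by move=> j _; rewrite (_ : F _ _ = ctr j.+1) ?ctr_read // /F; updsimp.
  + by rewrite (_ : F _ _ = ctr 0) ?ctr_read // /F; updsimp.
  + move=> j jn; apply: runs_eq (runs_seq (runs_dec _ (k := j.+1) _)
      (runs_copy _ (a := n2) (b := (n1 - j.+1) * n2) _ _ _ _ _ _)) _ _;
      try (by apply/eqP; lia); rewrite /F.
    * by updsimp.
    * by updsimp.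
    * by updsimp.
    * by rewrite !upd_other ?td //; try (apply/eqP); lia.
    * by tapes_eq; congr ctr; nia.
  + by rewrite /F; updsimp.
  + by rewrite /F subn0; tapes_eq; rewrite td //; lia.
  + by nia.
- apply: (@computed_poly _ (fun m => 10 * (m + 2) ^ k1 + 10 * (m + 2) ^ k2 +
    10 * (m + 2) ^ k3 + 20)); last by poly_tac.
  move=> O y w m env v d ts ym wm em rd /=.
  have [b1 r1] := H1 O y w m env v d ts ym wm em rd.
  have [b2 r2] := H2 O y w m env v d ts ym wm em rd.
  have [b3 r3] := H3 O y w m env v d ts ym wm em rd.
  have [t0 t1 tv td d1] := rd.
  rewrite if0; set n1 := eval y w e1 env in b1 r1 *.
  split; first by case: ifP => _; lia.
  have E : runs O (if is_mark (aread (upd ts d (ctr n1) d)) then Seq (clear d) (code e2 v d)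
      else code e3 v d) (upd ts d (ctr n1))
      (upd ts d (ctr (if 0 < n1 then eval y w e2 env else eval y w e3 env)))
      (2 * n1 + 1 + (m + 2) ^ k2 + (m + 2) ^ k3).
    rewrite upd_same ctr_read; case: ltnP => n10.
      have := runs_clear O (upd_same ts d (ctr n1)); rewrite upd_upd -(td d) // upd_id
        => r0.
      by apply: runs_eq (runs_seq r0 r2) erefl _; lia.
    rewrite (_ : upd ts d (ctr n1) = ts).
      by apply: runs_eq r3 erefl _; lia.
    by rewrite (_ : n1 = 0) -?(td d) ?upd_id //; lia.
  by apply: runs_eq (runs_seq r1 (runs_if E)) erefl _; lia.
- exact: computed_rec H1 H2 H3 H4.
Qed.

(** * Computable functions *)

Lemma poly_bounded_horner f : poly_bounded f ->
  exists p : {poly nat}, forall m, f m <= p.[m]%R.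
Proof.
move=> [k fk]; exists (('X + 2%:P) ^+ k)%R => m.
rewrite horner_exp hornerD hornerX hornerC.
by have := fk m; rewrite -natrXE.
Qed.

Lemma eval_ptime (e : expr) (V : bitstring -> bitstring -> Prop) :
  (forall x w, V x w <-> 0 < eval x w e (fun=> 0)) -> ptime_relation V.
Proof.
move=> VE; have [k ek] := exprs_computed e.
(* At the start all variables are zero, so all are sent to the blank tape 2. The value, computed on
   tape 3, is then moved to tape 2, where a positive number shows as [mark]. *)
pose c := Seq (code e (fun=> 2) 3) (move1 3 2).
have [|p pE] := @poly_bounded_horner (fun m => 5 * (m + 2) ^ k + 2); first by poly_tac.
exists (compile (cmd_tapes c) c), p => x w; set m := size x + size w.
have rd : ready x w (init_tapes [:: x; w]) (fun=> 0) (fun=> 2) 3.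
  have b0 : str_tape [::] = ctr 0.
    by rewrite /str_tape /ctr; congr pair; apply: funext => -[].
  split=> //.
  by move=> [|[|j]] // _; rewrite -b0 /init_tapes nth_default.
have [] := ek set0 x w m _ _ _ _ (leq_addr _ _) (leq_addl _ _) (fun=> leq0n _) rd => vB rB.
have [_ _ tv td _] := rd; have [_ _ t2] := tv 0.
have ts3 := upd_same (init_tapes [:: x; w]) 3 (ctr (eval x w e (fun=> 0))).
have [|n nb ex] := runs_seq rB (runs_move1 set0 (isT : 3 != 2) ts3 (b := 0) _); first
  exact: t2.
rewrite (compile_verdict ex); last first.
  by apply: leq_trans (pE m); move: nb vB => /=; lia.
congr Some; rewrite upd_same -[_ == mark]/(is_mark _) ctr_read addn0.
by apply/idP/idP => [v0|/asboolP/VE //]; apply/asboolP/VE.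
Qed.

Definition ctx : Type := (bitstring * bitstring * (nat -> nat))%type.

Definition computable (f : ctx -> nat) : Prop :=
  exists e, forall c, f c = eval c.1.1 c.1.2 e c.2.

Notation computable_pred P := (computable (fun c => nat_of_bool (P c))).

(** A loop binds two variables, index and accumulator, so what is defined outside is seen from the
    body through a shift by two. *)
Definition pop2 (c : ctx) : ctx := (c.1, fun i => c.2 i.+2).

Fixpoint rename (r : nat -> nat) (e : expr) : expr :=
  match e with
  | EVar i => EVar (r i)
  | ECst n => ECst n
  | EBit b e => EBit b (rename r e)
  | ELen b => ELen b
  | EAdd e1 e2 => EAdd (rename r e1) (rename r e2)
  | ESub e1 e2 => ESub (rename r e1) (rename r e2)
  | EMul e1 e2 => EMul (rename r e1) (rename r e2)
  | ECond e1 e2 e3 => ECond (rename r e1) (rename r e2) (rename r e3)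
  | ERec e1 e2 e3 e4 =>
      ERec (rename r e1) (rename r e2) (rename r e3)
        (rename (fun i => if i is j.+2 then (r j).+2 else i) e4)
  end.

Lemma eq_brec n cap a g g' : (forall i s, g i s = g' i s) -> brec n cap a g = brec n
  cap a g'.
Proof. by move=> E; elim: n => //= n ->; rewrite E. Qed.

Lemma eval_rename y w r e env : eval y w (rename r e) env = eval y w e (env \o r).
Proof.
elim: e r env => [i|n|b e IH|b|e1 IH1 e2 IH2|e1 IH1 e2 IH2|e1 IH1 e2 IH2
  |e1 IH1 e2 IH2 e3 IH3|e1 IH1 e2 IH2 e3 IH3 e4 IH4] r env //=;
  rewrite ?IH ?IH1 ?IH2 ?IH3 //.
apply: eq_brec => i s; rewrite IH4; congr eval; apply: funext => -[|[|j]] //.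
Qed.

Lemma iota_rcons k : iota 0 k.+1 = rcons (iota 0 k) k.
Proof. by rewrite -addn1 iotaD cats1 add0n. Qed.

Section Closure.
Implicit Types f a b : ctx -> nat.
Implicit Types P Q : ctx -> bool.

Lemma computable_pop2 f : computable f -> computable (fun c => f (pop2 c)).
Proof.
by move=> [e E]; exists (rename (fun i => i.+2) e) => c; rewrite E eval_rename.
Qed.

Lemma computable_var i : computable (fun c => c.2 i).
Proof. by exists (EVar i). Qed.

Lemma computable_cst n : computable (fun=> n).
Proof. by exists (ECst n). Qed.

Lemma computable_size1 : computable (fun c => size c.1.1).
Proof. by exists (ELen false). Qed.

Lemma computable_bit1 a : computable a -> computable_pred (fun c => nth false c.1.1 (a c)).
Proof. by move=> [e E]; exists (EBit false e) => c /=; rewrite E. Qed.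

Lemma computable_bit2 a : computable a -> computable_pred (fun c => nth false c.1.2 (a c)).
Proof. by move=> [e E]; exists (EBit true e) => c /=; rewrite E. Qed.

Lemma computableD a b : computable a -> computable b -> computable (fun c => a c + b c).
Proof. by move=> [e E] [e' E']; exists (EAdd e e') => c /=; rewrite E E'. Qed.

Lemma computableB a b : computable a -> computable b -> computable (fun c => a c - b c).
Proof. by move=> [e E] [e' E']; exists (ESub e e') => c /=; rewrite E E'. Qed.

Lemma computableM a b : computable a -> computable b -> computable (fun c => a c * b c).
Proof. by move=> [e E] [e' E']; exists (EMul e e') => c /=; rewrite E E'. Qed.

Lemma computableS a : computable a -> computable (fun c => (a c).+1).
Proof. by move=> [e E]; exists (EAdd (ECst 1) e) => c /=; rewrite E. Qed.

Lemma computable_if P a b : computable_pred P -> computable a -> computable b ->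
  computable (fun c => if P c then a c else b c).
Proof.
by move=> [e E] [e' E'] [e'' E'']; exists (ECond e e' e'') => c /=; rewrite -E E' E'';
  case: (P c).
Qed.

Lemma computable_leq a b : computable a -> computable b ->
  computable_pred (fun c => a c <= b c).
Proof.
move=> ca cb; have [e E] := computableB (computable_cst 1) (computableB ca cb).
by exists e => c; rewrite -E; case: leqP => /=; lia.
Qed.

Lemma computable_andb P Q : computable_pred P -> computable_pred Q ->
  computable_pred (fun c => P c && Q c).
Proof.
by move=> cP cQ; have [e E] := computableM cP cQ; exists e => c; rewrite -E mulnb.
Qed.

Lemma computable_negb P : computable_pred P -> computable_pred (fun c => ~~ P c).
Proof.
move=> cP; have [e E] := computableB (computable_cst 1) cP.
by exists e => c; rewrite -E; case: (P c).
Qed.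

Lemma computable_ext f a : (forall c, f c = a c) -> computable f -> computable a.
Proof. by move=> E [e Ee]; exists e => c; rewrite -E. Qed.

Lemma computable_orb P Q : computable_pred P -> computable_pred Q ->
  computable_pred (fun c => P c || Q c).
Proof.
move=> cP cQ.
apply: computable_ext (computable_negb (computable_andb (computable_negb cP)
  (computable_negb cQ))).
by move=> c; rewrite negb_and !negbK.
Qed.

Lemma computable_implb P Q : computable_pred P -> computable_pred Q ->
  computable_pred (fun c => P c ==> Q c).
Proof.
move=> cP cQ; apply: computable_ext (computable_orb (computable_negb cP) cQ).
by move=> c; rewrite implybE.
Qed.

Lemma computable_eqn a b : computable a -> computable b ->
  computable_pred (fun c => a c == b c).
Proof.
move=> ca cb; apply: computable_ext (computable_andb (computable_leq ca cb)
  (computable_leq cb ca)).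
by move=> c; rewrite eqn_leq.
Qed.

Lemma computable_eqb P Q : computable_pred P -> computable_pred Q ->
  computable_pred (fun c => P c == Q c).
Proof.
move=> cP cQ; apply: computable_ext (computable_eqn cP cQ) => c.
by case: (P c); case: (Q c).
Qed.

Lemma computable_ifb P Q R : computable_pred P -> computable_pred Q -> computable_pred R ->
  computable_pred (fun c => if P c then Q c else R c).
Proof.
move=> cP cQ cR; apply: computable_ext (computable_if cP cQ cR) => c.
by case: (P c).
Qed.

Lemma computable_brec n cap a (g : ctx -> nat -> nat -> nat) :
  computable n -> computable cap -> computable a ->
  computable (fun c => g (pop2 c) (c.2 0) (c.2 1)) ->
  computable (fun c => brec (n c) (cap c) (a c) (g c)).
Proof.
move=> [e1 E1] [e2 E2] [e3 E3] [e4 E4]; exists (ERec e1 e2 e3 e4) => c /=.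
rewrite -E1 -E2 -E3; apply: eq_brec => i s.
by have := E4 (c.1, scons i (scons s c.2)) => <-; case: c.
Qed.

(** A search without early exit: the accumulator keeps up with the index as long as all tests fail
    and stays at the first success, where it falls behind the index for good. It never exceeds [n],
    so the cap does not act. *)
Lemma computable_find n (P : ctx -> pred nat) :
  computable n -> computable_pred (fun c => P (pop2 c) (c.2 0)) ->
  computable (fun c => find (P c) (iota 0 (n c))).
Proof.
move=> cn cP.
apply: computable_ext (@computable_brec n n (fun=> 0)
  (fun c i s => if (s == i) && ~~ P c i then i.+1 else s) cn cn (computable_cst 0) _).
  move=> c; have: n c <= n c by [].
  move: {1 3 5}(n c) => k; elim: k => [//|k IH] kn; rewrite [LHS]/=.
  rewrite IH ?(ltnW kn) // iota_rcons -cats1 find_cat /= has_find size_iota.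
  have := find_size (P c) (iota 0 k); rewrite size_iota => fk.
  rewrite -[find _ _ == k]negbK neq_ltn [k < _]ltnNge fk orbF.
  by case: ltnP => fk' /=; [|case: (P c k) => /=]; lia.
apply: computable_if; last exact: computable_var.
  by apply: computable_andb (computable_negb cP); apply: computable_eqn; apply:
    computable_var.
by apply: computableS; apply: computable_var.
Qed.

Lemma computable_all n (P : ctx -> pred nat) :
  computable n -> computable_pred (fun c => P (pop2 c) (c.2 0)) ->
  computable_pred (fun c => all (P c) (iota 0 (n c))).
Proof.
move=> cn cP; have cf := computable_find (P := fun c => predC (P c)) cn
  (computable_negb cP).
apply: computable_ext (computable_leq cn cf) => c.
by rewrite -{1}(size_iota 0 (n c)) leqNgt -has_find has_predC negbK.
Qed.

Lemma computable_has n (P : ctx -> pred nat) :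
  computable n -> computable_pred (fun c => P (pop2 c) (c.2 0)) ->
  computable_pred (fun c => has (P c) (iota 0 (n c))).
Proof.
move=> cn cP; apply: computable_ext (computable_leq (computableS (computable_find cn
  cP)) cn) => c.
by rewrite has_find size_iota.
Qed.

Lemma computable_count n (P : ctx -> pred nat) :
  computable n -> computable_pred (fun c => P (pop2 c) (c.2 0)) ->
  computable (fun c => count (P c) (iota 0 (n c))).
Proof.
move=> cn cP.
apply: computable_ext (@computable_brec n n (fun=> 0) (fun c i s => s + P c i)
  cn cn (computable_cst 0) _); last by apply: computableD cP; apply: computable_var.
move=> c; have: n c <= n c by [].
move: {1 3 5}(n c) => k; elim: k => [//|k IH] kn; rewrite [LHS]/=.
rewrite IH ?(ltnW kn) // iota_rcons -cats1 count_cat /= addn0.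
by have := count_size (P c) (iota 0 k); rewrite size_iota; case: (P c k) => /=; lia.
Qed.

Lemma halfE n : n./2 = find (fun h => n < h.*2.+2) (iota 0 n.+1).
Proof.
have h : has (fun h => n < h.*2.+2) (iota 0 n.+1).
  by apply/hasP; exists n./2; rewrite ?mem_iota; lia.
have := nth_find 0 h; have := before_find 0 (s := iota 0 n.+1) (a := fun h => n < h.*2.+2).
move: h; rewrite has_find size_iota; set f := find _ _ => fn bf.
rewrite nth_iota // add0n => H; case: (leqP f n./2) => fh; first lia.
by have := bf n./2 fh; rewrite nth_iota; lia.
Qed.

Lemma computable_half a : computable a -> computable (fun c => (a c)./2).
Proof.
move=> ca; have H : computable (fun c => find (fun h => a c < 2 * h + 2) (iota 0 (a c).+1)).
  apply: computable_find; first exact: computableS.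
  apply: computable_leq; first by apply: computableS; apply: computable_pop2.
  apply: computableD; last exact: computable_cst.
  by apply: computableM; [apply: computable_cst | apply: computable_var].
apply: computable_ext H => c; rewrite halfE; apply: eq_find => h; lia.
Qed.

Lemma computable_odd a : computable a -> computable_pred (fun c => odd (a c)).
Proof.
move=> ca; apply: computable_ext (computableB ca
  (computableM (computable_cst 2) (computable_half ca))) => c; lia.
Qed.

End Closure.

(** * Reading the code of an ABox *)

Section Strings.
Variable y : bitstring.

Definition bit (i : nat) : bool := nth false y i.

(* Length of, name in, and position after the code of a string at i. *)
Definition name_size (i : nat) : nat :=
  find (fun k => ~~ bit (i + 2 * k)) (iota 0 (size y).+1).
Definition name_bit (i k : nat) : bool := bit (i + 2 * k + 1).
Definition name_at (i : nat) : seq bool := mkseq (name_bit i) (name_size i).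
Definition after (i : nat) : nat := i + 2 * name_size i + 1.

Definition occurs (i : nat) (z : bitstring) : bool := prefix z (drop i y).

Lemma occurs_cat i z1 z2 : occurs i (z1 ++ z2) = occurs i z1 && occurs (i + size z1) z2.
Proof.
rewrite /occurs addnC -drop_drop; elim: z1 (drop i y) => [|b z1 IH] s /=.
  by rewrite drop0 prefix0s.
by case: s => [|c s] //=; rewrite IH andbA.
Qed.

Lemma occurs_bit i z k : occurs i z -> k < size z -> bit (i + k) = nth false z k.
Proof.
by move=> /prefixP[v E] kz; rewrite /bit -nth_drop E nth_cat kz.
Qed.

Lemma occurs_size i z : occurs i z -> 0 < size z -> i + size z <= size y.
Proof.
move=> o z0; have : size z <= size y - i by have := size_prefix o; rewrite size_drop.
by lia.
Qed.

Lemma occursP i z : i + size z <= size y ->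
  (forall k, k < size z -> bit (i + k) = nth false z k) -> occurs i z.
Proof.
move=> zy E; have sz : size z <= size (drop i y) by rewrite size_drop; lia.
rewrite /occurs prefixE; apply/eqP/(@eq_from_nth bool false); first by rewrite size_takel.
by move=> k; rewrite size_takel // => kz; rewrite nth_take // nth_drop; apply: E.
Qed.

Lemma name_size_eq i n : n <= size y -> (forall k, k < n -> bit (i + 2 * k)) ->
  ~~ bit (i + 2 * n) -> name_size i = n.
Proof.
move=> ny bn bn'; rewrite /name_size.
have -> : (size y).+1 = n + (size y - n).+1 by lia.
rewrite iotaD find_cat size_iota add0n /= bn' addn0 ifF //.
by apply/hasPn => k; rewrite mem_iota add0n /= => kn; rewrite negbK bn.
Qed.

End Strings.

Lemma size_enc_string s : size (enc_string s) = 2 * size s + 1.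
Proof.
by elim: s => //= b s; rewrite -/(enc_string s) => ->; lia.
Qed.

Lemma nth_enc_string s k : nth false (enc_string s) k =
  if k < 2 * size s then if odd k then nth false s k./2 else true else false.
Proof.
elim: s k => [|b s IH] k; first by case: k => [|[|k]].
have -> : size (b :: s) = (size s).+1 by [].
rewrite mulnS; case: k => [//|[//|k]].
rewrite [LHS]/= [odd _]/= [_./2]/= [nth _ (b :: s) _]/=.
by rewrite negbK -/(enc_string s) IH !ltnS.
Qed.

Section StringCodes.
Variable y : bitstring.

Lemma occurs_name_size i s : occurs y i (enc_string s) -> name_size y i = size s.
Proof.
move=> o; have := occurs_size o; rewrite size_enc_string => sy.
apply: name_size_eq => [|k ks|]; first lia.
  rewrite (occurs_bit o) ?size_enc_string; last by lia.
  rewrite nth_enc_string (_ : odd (2 * k) = false); last by lia.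
  by rewrite ltn_mul2l ks.
rewrite (occurs_bit o) ?size_enc_string; last by lia.
by rewrite nth_enc_string ltnn.
Qed.

Lemma occurs_name i s : occurs y i (enc_string s) -> name_at y i = s.
Proof.
move=> o; have E := occurs_name_size o.
apply: (@eq_from_nth _ false); rewrite size_mkseq // => k ks.
rewrite nth_mkseq // /name_bit -addnA (occurs_bit o) ?nth_enc_string ?size_enc_string;
  last lia.
by rewrite ifT ?ifT; [congr nth; lia | lia | lia].
Qed.

Lemma occurs_after i s : occurs y i (enc_string s) -> after y i = i + size (enc_string s).
Proof. by move=> o; rewrite /after (occurs_name_size o) size_enc_string addnA. Qed.

(** The bound on [after y i] ensures that the closing [false] is a bit of [y] and not the default
    value read past its end. *)
Lemma name_occurs i : after y i <= size y -> occurs y i (enc_string (name_at y i)).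
Proof.
rewrite /after => ay; have h : has (fun k => ~~ bit y (i + 2 * k)) (iota 0 (size y).+1).
  apply/hasP; exists (size y); first by rewrite mem_iota; lia.
  by rewrite /bit nth_default //; lia.
have := nth_find 0 h; have := @before_find _ 0 (fun k => ~~ bit y (i + 2 * k)) (iota 0
  (size y).+1).
move: h; rewrite has_find size_iota -/(name_size y i) => fs bf.
rewrite nth_iota // add0n => nf.
apply: occursP => [|k]; rewrite ?size_enc_string size_mkseq; first lia.
move=> kn; rewrite nth_enc_string size_mkseq; case: ltnP => k2; last first.
  by rewrite (_ : k = 2 * name_size y i) ?(negPf nf) //; lia.
case: ifP => ok.
  by rewrite nth_mkseq /name_bit; [congr bit; lia | lia].
have := bf k./2; rewrite nth_iota; last by lia.
rewrite add0n (_ : 2 * k./2 = k); last by lia.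
by move=> H; apply: negbFE; apply: H; lia.
Qed.

Lemma after_gt i : i < after y i. Proof. by rewrite /after; lia. Qed.

End StringCodes.

Fixpoint bits_pos (s : seq bool) : positive :=
  match s with
  | [::] | [:: _] => xH
  | b :: s => if b then xI (bits_pos s) else xO (bits_pos s)
  end.

Lemma pos_bits_nil p : pos_bits p <> [::].
Proof. by case: p. Qed.

Lemma pos_bitsK : cancel pos_bits bits_pos.
Proof. by elim=> //= p IH; have := @pos_bits_nil p; case: (pos_bits p) IH => //= b s
  ->. Qed.

Lemma last_pos_bits p b : last b (pos_bits p).
Proof. by elim: p b => //= p IH. Qed.

Lemma bits_posK s : last false s -> pos_bits (bits_pos s) = s.
Proof.
case: s => // b s /=; elim: s b => [|c s IH] b /=; first by case: b.
by move=> /IH E; case: b; rewrite /= -[in RHS]E.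
Qed.

Definition bits_val (s : seq bool) : nat := foldr (fun (b : bool) n => b + 2 * n) 0 s.

Lemma bits_val_pos p : bits_val (pos_bits p) = Pos.to_nat p.
Proof. by elim: p => //= p ->; rewrite ?Pos2Nat.inj_xI ?Pos2Nat.inj_xO; lia. Qed.

Section Assertions.
Variable y : bitstring.

(* For the code of a weighted assertion at i: is it a role assertion, where are
   its names, its weight and its end. *)
Definition is_role (i : nat) : bool := bit y i.
Definition fst_ind (i : nat) : nat := after y i.+1.
Definition snd_ind (i : nat) : nat := after y (fst_ind i).
Definition weight_pos (i : nat) : nat :=
  if is_role i then after y (snd_ind i) else snd_ind i.
Definition is_fin (i : nat) : bool := bit y (weight_pos i).
Definition next (i : nat) : nat :=
  if is_fin i then after y (weight_pos i).+1 else (weight_pos i).+1.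
(** A numeral must end in [true], the top bit of a positive number; otherwise [bits_pos] would also
    decode strings that [pos_bits] never produces. *)
Definition weight_ok (i : nat) : bool :=
  let j := (weight_pos i).+1 in
  is_fin i ==> (0 < name_size y j) && name_bit y j (name_size y j - 1).

Definition assertion_at (i : nat) : assertion :=
  if is_role i then
    RAssert (name_at y i.+1) (name_at y (fst_ind i)) (name_at y (snd_ind i))
  else CAssert (name_at y i.+1) (name_at y (fst_ind i)).

Definition weight_at (i : nat) : weight :=
  if is_fin i then Fin (bits_pos (name_at y (weight_pos i).+1)) else Inf.

Definition enc_weighted (u : assertion * weight) : bitstring :=
  enc_assertion u.1 ++ enc_weight u.2.

Lemma occurs_cons i b z : occurs y i (b :: z) -> bit y i = b /\ occurs y i.+1 z.
Proof.
rewrite -cat1s occurs_cat addn1 => /andP[o ->]; split=> //.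
by have := occurs_bit o (ltnSn 0); rewrite addn0.
Qed.

Lemma occurs_cons_eq i z : i < size y -> occurs y i (bit y i :: z) = occurs y i.+1 z.
Proof.
move=> iy; rewrite -cat1s occurs_cat addn1 (_ : occurs y i _) //.
by apply: occursP => [|[]] //=; rewrite ?addn0 ?addn1.
Qed.

Lemma last_name j : 0 < name_size y j ->
  last false (name_at y j) = name_bit y j (name_size y j - 1).
Proof.
move=> s0; rewrite -nth_last size_mkseq nth_mkseq; last by lia.
by rewrite subn1.
Qed.

Lemma occurs_weight i wt : occurs y i (enc_weight wt) ->
  [/\ bit y i = (if wt is Fin _ then true else false),
   (if bit y i then Fin (bits_pos (name_at y i.+1)) else Inf) = wt,
   (if bit y i then after y i.+1 else i.+1) = i + size (enc_weight wt) &
   bit y i ==> (0 < name_size y i.+1) && name_bit y i.+1 (name_size y i.+1 - 1)].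
Proof.
case: wt => [p|] /occurs_cons[-> o] /=; last by split=> //; lia.
have E := occurs_name o; rewrite E pos_bitsK (occurs_after o); split=> //; first by lia.
have s0 : 0 < name_size y i.+1.
  by rewrite (occurs_name_size o) lt0n size_eq0; apply/eqP/pos_bits_nil.
by rewrite s0 -last_name // E last_pos_bits.
Qed.

Lemma occurs_weighted i u : occurs y i (enc_weighted u) ->
  [/\ assertion_at i = u.1, weight_at i = u.2,
      next i = i + size (enc_weighted u) & weight_ok i].
Proof.
rewrite /enc_weighted occurs_cat => /andP[oa ow].
have [Ea Ew] : assertion_at i = u.1 /\ weight_pos i = i + size (enc_assertion u.1).
  case: u oa ow => -[A a|r a b] wt /= /occurs_cons[ib].
    rewrite occurs_cat => /andP[o1 o2] _.
    rewrite /assertion_at /weight_pos /snd_ind /fst_ind /is_role ib (occurs_name o1).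
    rewrite (occurs_after o1) (occurs_name o2) (occurs_after o2) size_cat; split=> //; lia.
  rewrite occurs_cat => /andP[o1]; rewrite occurs_cat => /andP[o2 o3] _.
  rewrite /assertion_at /weight_pos /snd_ind /fst_ind /is_role ib (occurs_name o1).
  rewrite (occurs_after o1) (occurs_name o2) (occurs_after o2) (occurs_name o3).
  by rewrite (occurs_after o3) !(size_cat (enc_string _)); split=> //; lia.
rewrite -Ew in ow; have [e1 e2 e3 e4] := occurs_weight ow; split=> //.
by rewrite /next /is_fin e3 Ew size_cat addnA.
Qed.

Lemma weighted_occurs i : next i <= size y -> weight_ok i ->
  occurs y i (enc_weighted (assertion_at i, weight_at i)).
Proof.
rewrite /next /weight_ok /weight_at /is_fin => ny wok.
have wy : weight_pos i < size y.
  by case: ifP ny => // _; have := after_gt y (weight_pos i).+1; lia.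
have oa : occurs y i (enc_assertion (assertion_at i)) /\
    i + size (enc_assertion (assertion_at i)) = weight_pos i.
  rewrite /assertion_at /weight_pos; have := wy; rewrite /weight_pos.
  have g1 := after_gt y i.+1; have g2 := after_gt y (fst_ind i).
  have g3 := after_gt y (snd_ind i); rewrite -/(fst_ind i) -/(snd_ind i) in g1 g2 g3.
  case: ifP => ri sy; rewrite /= -[X in X :: _]ri occurs_cons_eq; try (by lia).
    have o1 : occurs y i.+1 (enc_string (name_at y i.+1)).
      by apply: name_occurs; rewrite -/(fst_ind i); lia.
    have o2 : occurs y (fst_ind i) (enc_string (name_at y (fst_ind i))).
      by apply: name_occurs; rewrite -/(snd_ind i); lia.
    have o3 : occurs y (snd_ind i) (enc_string (name_at y (snd_ind i))).
      by apply: name_occurs; lia.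
    rewrite !(occurs_cat _ _ (enc_string _)) o1 /= !(size_cat (enc_string _))
      -(occurs_after o1) -/(fst_ind i) o2 /=.
    rewrite -(occurs_after o2) -/(snd_ind i) o3 (occurs_after o3); split=> //.
    have := occurs_after o1; have := occurs_after o2; rewrite -/(fst_ind i) -/(snd_ind
      i); lia.
  have o1 : occurs y i.+1 (enc_string (name_at y i.+1)).
    by apply: name_occurs; rewrite -/(fst_ind i); lia.
  have o2 : occurs y (fst_ind i) (enc_string (name_at y (fst_ind i))).
    by apply: name_occurs; rewrite -/(snd_ind i); lia.
  rewrite !(occurs_cat _ _ (enc_string _)) o1 /= (size_cat (enc_string _))
    -(occurs_after o1) -/(fst_ind i) o2; split=> //.
  have := occurs_after o1; have := occurs_after o2; rewrite -/(fst_ind i) -/(snd_ind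
    i); lia.
case: oa => oa Ea; rewrite /enc_weighted occurs_cat oa Ea /=.
case: ifP wok ny => b /= wok ny; rewrite -[X in X :: _]b occurs_cons_eq //.
  by rewrite bits_posK ?name_occurs // last_name; case/andP: wok.
by rewrite /occurs prefix0s.
Qed.

Lemma next_gt i : i < next i.
Proof.
rewrite /next /weight_pos /snd_ind /fst_ind.
have g1 := after_gt y i.+1; have g2 := after_gt y (after y i.+1).
have g3 := after_gt y (after y (after y i.+1)).
have g4 := after_gt y (after y (after y i.+1)).+1.
have g5 := after_gt y (after y (after y (after y i.+1))).+1.
by do 2 case: ifP => _; lia.
Qed.

End Assertions.

Section ABox.
Variable y : bitstring.

(* y is the code of a string p followed by the code of a weighted ABox, possibly
   with an additional false in front. *)
Definition prefix_pos : nat := if bit y 0 then 0 else 1.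
Definition prefix_size : nat := name_size y prefix_pos.
Definition abox_pos : nat := after y prefix_pos.

(** The cap exceeds the length by one, so an assertion that runs past the end of [y] gets a position
    different from [size y], which [valid] detects. *)
Definition pos (k : nat) : nat := brec k (size y).+1 abox_pos (fun=> next y).

Definition num : nat := find (fun k => size y <= pos k) (iota 0 (size y).+1).

Definition same_name (i j : nat) : bool :=
  (name_size y i == name_size y j) &&
  all (fun k => name_bit y i k == name_bit y j k) (iota 0 (name_size y i)).

Lemma same_nameE i j : same_name i j = (name_at y i == name_at y j).
Proof.
apply/andP/eqP => [[/eqP E /allP H]|E].
  rewrite /name_at -E; apply/eq_in_map => k /H /eqP //.
have Es : name_size y i = name_size y j by have := congr1 size E; rewrite !size_mkseq.
split; first exact/eqP.
apply/allP => k; rewrite mem_iota add0n /= => ks.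
have ks' : k < name_size y j by rewrite -Es.
by have := congr1 (nth false ^~ k) E; rewrite !nth_mkseq // => ->.
Qed.

Definition same_assertion (i j : nat) : bool :=
  [&& is_role y i == is_role y j, same_name i.+1 j.+1,
      same_name (fst_ind y i) (fst_ind y j) &
      is_role y i ==> same_name (snd_ind y i) (snd_ind y j)].

Lemma same_assertionE i j : same_assertion i j = (assertion_at y i == assertion_at y j).
Proof.
rewrite /same_assertion !same_nameE /assertion_at.
case: (is_role y i); case: (is_role y j) => //=.
  by apply/and3P/eqP => [[/eqP-> /eqP-> /eqP->]|[-> -> ->]].
by rewrite andbT; apply/andP/eqP => [[/eqP-> /eqP->]|[-> ->]].
Qed.

Definition abox_of : wabox :=
  [seq (assertion_at y (pos k), weight_at y (pos k)) | k <- iota 0 num].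

(** Holds if the part after the prefix is the code of a well-formed weighted ABox, by [valid_enc],
    and only then, by [valid_decode] and [valid_uniq]. *)
Definition valid : bool :=
  [&& pos num == size y,
      all (fun k => weight_ok y (pos k)) (iota 0 num) &
      all (fun k => all (fun l => ~~ same_assertion (pos l) (pos k)) (iota 0 k)) (iota
        0 num)].

Lemma enc_waboxE A : enc_wabox A = flatten [seq enc_weighted u | u <- A].
Proof. by []. Qed.

Lemma valid_uniq : valid -> wf_weighted abox_of.
Proof.
move=> /and3P[_ _ /allP H]; rewrite /wf_weighted /abox_of /unzip1 -map_comp.
rewrite map_inj_in_uniq ?iota_uniq // => k l; rewrite !mem_iota !add0n /= => kn ln E.
wlog kl : k l kn ln E / k <= l.
  by move=> W; case: (leqP k l) => [|/ltnW] kl; [apply: W | symmetry; apply: W].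
move: kl; rewrite leq_eqVlt => /predU1P[//|kl].
have := H l; rewrite mem_iota => /(_ ln) /allP /(_ k); rewrite mem_iota => /(_ kl).
by rewrite same_assertionE E eqxx.
Qed.

Lemma posS_le k : pos k.+1 <= size y -> pos k.+1 = next y (pos k) /\ pos k < size y.
Proof.
rewrite /pos /= -/(pos k); have := next_gt y (pos k) => g.
by case: (leqP (size y).+1 (next y (pos k))); lia.
Qed.

Lemma pos_mono k l : k <= l -> pos l <= size y -> pos k <= pos l.
Proof.
elim: l => [|l IH]; first by case: k.
rewrite leq_eqVlt => /predU1P[-> //|kl] /posS_le[E ly].
have := IH kl (ltnW ly); have := next_gt y (pos l); lia.
Qed.

Lemma valid_decode : valid -> drop abox_pos y = enc_wabox abox_of.
Proof.
move=> /and3P[/eqP pn /allP wok _].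
(* Induction from the end of the string: at [pos num] both sides are empty, and each step back
   prepends one decoded assertion. *)
have H k : k <= num -> drop (pos (num - k)) y =
    flatten [seq enc_weighted (assertion_at y (pos l), weight_at y (pos l))
            | l <- iota (num - k) k].
  elim: k => [|k IH] kn; first by rewrite subn0 pn drop_size.
  have E : num - k = (num - k.+1).+1 by lia.
  have pl : pos (num - k) <= size y by rewrite -pn; apply: pos_mono; lia.
  rewrite E in pl; have [Ep py] := posS_le pl.
  have wk : weight_ok y (pos (num - k.+1)) by apply: wok; rewrite mem_iota; lia.
  rewrite Ep in pl; have o := weighted_occurs pl wk.
  have [_ _ En _] := occurs_weighted o.
  rewrite /= -E -IH ?(ltnW kn) // E Ep En addnC -drop_drop.
  case/prefixP: o => v Ev; rewrite {1}Ev; congr cat; rewrite Ev drop_size_cat //.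
have := H num (leqnn _); rewrite subnn => ->.
by rewrite enc_waboxE /abox_of -map_comp.
Qed.

Lemma enc_weighted_gt0 u : 0 < size (enc_weighted u).
Proof. by rewrite size_cat; case: u.1. Qed.

Lemma decode_enc A : abox_pos <= size y -> drop abox_pos y = enc_wabox A ->
  [/\ abox_of = A, pos num = size y & all (fun k => weight_ok y (pos k)) (iota 0 num)].
Proof.
move=> py EA.
(* [P k] is where the encoding of [A] places assertion number [k]; the scan [pos] is shown to follow
   it. *)
pose P k := abox_pos + size (enc_wabox (take k A)).
have u0 : assertion * weight by exact: (CAssert [::] [::], Inf).
have oA : occurs y abox_pos (enc_wabox A) by rewrite /occurs EA prefix_refl.
have sP : P (size A) = size y.
  by rewrite /P take_size -EA size_drop; lia.
have PS k : k < size A -> P k.+1 = P k + size (enc_weighted (nth u0 A k)).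
  move=> kA; rewrite /P (take_nth u0) // enc_waboxE map_rcons flatten_rcons size_cat.
  by rewrite -enc_waboxE addnA.
have oP k : k < size A -> occurs y (P k) (enc_weighted (nth u0 A k)).
  move=> kA; move: oA; rewrite -{1}(cat_take_drop k A) (drop_nth u0) //.
  rewrite enc_waboxE map_cat flatten_cat /= 2!occurs_cat => /and3P[_ + _].
  by rewrite -enc_waboxE.
have Pmono k l : k < l -> l <= size A -> P k < P l.
  elim: l => // l IH; rewrite ltnS leq_eqVlt => kl lA; rewrite PS //.
  have := enc_weighted_gt0 (nth u0 A l).
  by case/predU1P: kl => [->|kl]; [lia | have := IH kl (ltnW lA); lia].
have EP k : k <= size A -> pos k = P k.
  elim: k => [|k IH] kA; first by rewrite /P take0 /= addn0.
  rewrite /pos /= -/(pos k) IH ?(ltnW kA) //.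
  have [_ _ -> _] := occurs_weighted (oP k kA); rewrite -PS //.
  have : P k.+1 <= size y.
    by rewrite -sP; case: (ltngtP k.+1 (size A)) kA => // [kA _|->//]; apply/ltnW/Pmono.
  by lia.
have Ay : size A <= size y.
  have : forall k, k <= size A -> k <= P k.
    elim=> // k IH kA; have := IH (ltnW kA); have := Pmono k k.+1 (ltnSn k) kA; lia.
  by move=> /(_ _ (leqnn _)); rewrite sP.
have En : num = size A.
  rewrite /num (_ : (size y).+1 = size A + (size y - size A).+1); last by lia.
  rewrite iotaD find_cat size_iota add0n /= EP // sP leqnn addn0 ifF //.
  apply/hasPn => k; rewrite mem_iota add0n /= => kA; rewrite -ltnNge EP ?(ltnW kA) //.
  by rewrite -sP; apply: Pmono.
split; last 2 first.
- by rewrite En EP // sP.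
- apply/allP => k; rewrite mem_iota add0n En /= => kA.
  by rewrite EP ?(ltnW kA) //; have [] := occurs_weighted (oP k kA).
rewrite /abox_of En; apply: (@eq_from_nth _ u0); rewrite size_map size_iota // => k kA.
rewrite (nth_map 0) ?size_iota // nth_iota // add0n EP ?(ltnW kA) //.
by have [-> -> _ _] := occurs_weighted (oP k kA); case: (nth u0 A k).
Qed.

Lemma valid_enc A : abox_pos <= size y -> drop abox_pos y = enc_wabox A ->
  wf_weighted A -> valid.
Proof.
move=> py EA uA; have [Eo pn wok] := decode_enc py EA; rewrite /valid pn eqxx wok /=.
move: uA; rewrite -Eo /wf_weighted /abox_of /unzip1 -map_comp => uA.
apply/allP => k; rewrite mem_iota add0n /= => kn.
apply/allP => l; rewrite mem_iota add0n /= => lk; rewrite same_assertionE.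
apply/negP => /eqP E.
have := @nth_uniq _ (CAssert [::] [::]) _ l k _ _ uA.
rewrite size_map size_iota kn (ltn_trans lk kn) => /(_ isT isT).
rewrite !(nth_map 0) ?size_iota ?(ltn_trans lk kn) // !nth_iota ?(ltn_trans lk kn) //=
  !add0n.
by rewrite E eqxx => /esym/eqP; lia.
Qed.

End ABox.

(** * Tables as interpretations *)

HB.instance Definition _ := gen_eqMixin weight.

(** An extended cost split into an infinity flag and a finite part, the form in which the verifier
    can compute it. *)
Definition enat (b : bool) (n : nat) : \bar int := if b then +oo%E else (Posz n)%:E%E.

Lemma enatD b n b' n' : (enat b n + enat b' n')%E = enat (b || b') (n + n').
Proof. by case: b; case: b'. Qed.

Lemma enat_sum (T : Type) (s : seq T) (P : pred T) (b : T -> bool) (n : T -> nat) :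
  (\sum_(x <- s | P x) enat (b x) (n x))%E =
  enat (has (fun x => P x && b x) s) (\sum_(x <- s | P x) n x).
Proof.
elim: s => [|x s IH]; rewrite ?big_nil // !big_cons /=.
by case: (P x) => //=; rewrite IH enatD.
Qed.

Definition fin_val (w : weight) : nat := if w is Fin p then Pos.to_nat p else 0.
Definition infinite (w : weight) : bool := if w is Fin _ then false else true.

Lemma weight_val_enat w : weight_val w = enat (infinite w) (fin_val w).
Proof. by case: w. Qed.

Lemma weight_val_mul w n :
  (weight_val w * (Posz n)%:E)%E = enat (infinite w && (0 < n)) (fin_val w * n).
Proof.
case: w => [p|] /=; first by rewrite -EFinM.
case: n => [|n] /=; first by rewrite mule0.
by rewrite gt0_mulye.
Qed.

Section Tables.
Local Open Scope classical_set_scope.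
Variables (N : nat) (live : pred nat) (ct : NC -> nat -> bool).
Variables (rt : NR -> nat -> nat -> bool) (ix : NI -> nat).

(** Meant for live elements, for which the restriction to the domain in [cext] is automatic; hence
    [CTop] and [CNot] do not mention [live], while the quantifiers do. *)
Fixpoint holds (C : concept) (e : nat) : bool :=
  match C with
  | CName A => ct A e
  | CNom a => e == ix a
  | CTop => true
  | CBot => false
  | CAnd C D => holds C e && holds D e
  | COr C D => holds C e || holds D e
  | CNot C => ~~ holds C e
  | CEx r C => has (fun d => (live d && rt r e d) && holds C d) (iota 0 N)
  | CAll r C => all (fun d => (live d && rt r e d) ==> holds C d) (iota 0 N)
  end.

Definition violates (t : inclusion) (e : nat) : bool :=
  live e && (holds (lhs t) e && ~~ holds (rhs t) e).

Definition vio_count (t : inclusion) : nat := count (violates t) (iota 0 N).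

Definition satisfies (al : assertion) : bool :=
  match al with
  | CAssert A a => ct A (ix a)
  | RAssert r a b => rt r (ix a) (ix b)
  end.

Definition tbox_cost (T : wtbox) : nat := \sum_(tw <- T) fin_val tw.2 * vio_count tw.1.
Definition tbox_infinite (T : wtbox) : bool :=
  has (fun tw => infinite tw.2 && (0 < vio_count tw.1)) T.
Definition abox_cost (A : wabox) : nat :=
  \sum_(aw <- A | ~~ satisfies aw.1) fin_val aw.2.
Definition abox_infinite (A : wabox) : bool :=
  has (fun aw => ~~ satisfies aw.1 && infinite aw.2) A.

Definition term_ix (v : nat -> nat) (t : term) : nat :=
  match t with TVar x => v x | TInd a => ix a end.

Definition atom_holds (v : nat -> nat) (at_ : atom) : bool :=
  match at_ with
  | CAtom A t => ct A (term_ix v t)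
  | RAtom r t u => rt r (term_ix v t) (term_ix v u)
  end.

Definition elem (e : nat) : bool := (e < N) && live e.

Variables (el : nat -> NI + nat) (names : seq NI).

(** What turns a table into an interpretation under the weak standard names assumption. Distinct
    live indices must denote distinct elements, for otherwise counting indices would not count
    violations. *)
Record denoting : Prop := Denoting {
  el_inj : {in elem &, injective el};
  elem_ix : forall a, a \in names -> elem (ix a);
  el_ix : forall a, a \in names -> el (ix a) = inl a;
  elem_ex : exists e, elem e }.

Hypothesis den : denoting.

Definition table_dom : set (NI + nat) := [set d | exists2 e, elem e & d = el e].
Definition table_cint (A : NC) : set (NI + nat) :=
  [set d | exists2 e, elem e && ct A e & d = el e].
Definition table_rint (r : NR) : set ((NI + nat) * (NI + nat)) :=
  [set u | exists e e', [/\ elem e, elem e', rt r e e' & u = (el e, el e')]].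

Lemma table_nonempty : table_dom !=set0.
Proof. by have [e ee] := elem_ex den; exists (el e), e. Qed.

Lemma table_cint_sub A : table_cint A `<=` table_dom.
Proof. by move=> d [e /andP[ee _] ->]; exists e. Qed.

Lemma table_rint_sub r : table_rint r `<=` table_dom `*` table_dom.
Proof. by move=> _ [e [e' [ee ee' _ ->]]]; split; [exists e | exists e']. Qed.

Definition table_interp : interp :=
  Interp table_nonempty table_cint_sub table_rint_sub.

Lemma table_wsna : wsna names table_interp.
Proof. by move=> a an; exists (ix a); [apply: elem_ix | rewrite (el_ix den)]. Qed.

Lemma table_cintP A e : elem e -> cint (i := table_interp) A (el e) <-> ct A e.
Proof.
move=> ee; split=> [[e' /andP[ee' cA] E]|cA]; last by exists e => //; rewrite ee.
by rewrite (el_inj den ee ee' E).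
Qed.

Lemma table_rintP r e e' : elem e -> elem e' ->
  rint (i := table_interp) r (el e, el e') <-> rt r e e'.
Proof.
move=> ee ee'; split=> [[d [d' [ed ed' rd [E E']]]]|rr]; last by exists e, e'.
by rewrite (el_inj den ee ed E) (el_inj den ee' ed' E').
Qed.

Lemma table_cext C e : {subset concept_inds C <= names} -> elem e ->
  cext C (el e : elt table_interp) <-> holds C e.
Proof.
elim: C e => [A|a|||C IHC D IHD|C IHC D IHD|C IHC|r C IHC|r C IHC] e /= sub ee.
- exact: table_cintP.
- have an : a \in names by apply: sub; rewrite mem_head.
  split=> [E|/eqP ->]; last by rewrite (el_ix den).
  by apply/eqP/(el_inj den) => //; [apply: elem_ix | rewrite (el_ix den)].
- by split=> // _; exists e.
- by [].
- have sC : {subset concept_inds C <= names} by move=> a aC; apply: sub; rewrite mem_cat aC.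
  have sD : {subset concept_inds D <= names}.
    by move=> a aC; apply: sub; rewrite mem_cat aC orbT.
  split=> [[/(IHC _ sC ee)-> /(IHD _ sD ee)->]//|/andP[/(IHC _ sC ee) ? /(IHD _ sD ee) ?]].
  by split.
- have sC : {subset concept_inds C <= names} by move=> a aC; apply: sub; rewrite mem_cat aC.
  have sD : {subset concept_inds D <= names}.
    by move=> a aC; apply: sub; rewrite mem_cat aC orbT.
  split=> [[/(IHC _ sC ee)->//|/(IHD _ sD ee)->]|/orP[/(IHC _ sC ee) ?|/(IHD _ sD ee) ?]].
  + by rewrite orbT.
  + by left.
  + by right.
- split=> [[_ nC]|nC]; first by apply/negP => /(IHC _ sub ee).
  by split; [exists e | move=> /(IHC _ sub ee); apply/negP].
- split=> [[_ [_ [[d [d' [ed ed' rd [E ->]]]]]] /(IHC _ sub ed') hC]|].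
    move: rd; rewrite -(el_inj den ee ed E) => rd.
    apply/hasP; exists d'; first by rewrite mem_iota; case/andP: ed'.
    by rewrite rd hC; case/andP: ed' => _ ->.
  move=> /hasP[d]; rewrite mem_iota add0n /= => dN /andP[/andP[ld rd] hC].
  have ed : elem d by rewrite /elem dN.
  split; first by exists e.
  by exists (el d); split; [exists e, d | apply/(IHC _ sub ed)].
- split=> [[_ H]|/allP H].
    apply/allP => d; rewrite mem_iota add0n /= => dN; apply/implyP => /andP[ld rd].
    have ed : elem d by rewrite /elem dN.
    by apply/(IHC _ sub ed)/H; exists e, d.
  split=> [|_ [d [d' [ed ed' rd [E ->]]]]]; first by exists e.
  apply/(IHC _ sub ed'); have := H d'; rewrite mem_iota (el_inj den ee ed E) rd.
  by case/andP: (ed') => -> -> /= /(_ isT).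
Qed.

Lemma ecard_seq (U : choiceType) (s : seq U) (X : set U) :
  uniq s -> X = [set` s] -> ecard X = (Posz (size s))%:E%E.
Proof.
move=> us ->; rewrite /ecard asboolT; last exact: finite_seq.
have -> : [set` s] = [set` [fset x in s]%fset].
  by apply/seteqP; split=> x /=; rewrite inE.
by rewrite set_fsetK card_fseq undup_id.
Qed.

Lemma table_vio t : {subset inclusion_inds t <= names} ->
  ecard (vio table_interp t) = (Posz (vio_count t))%:E%E.
Proof.
move=> sub; rewrite /vio_count -size_filter -(size_map el); apply: ecard_seq.
  rewrite map_inj_in_uniq ?filter_uniq ?iota_uniq // => e e'.
  rewrite !mem_filter !mem_iota => /andP[/andP[le _] eN] /andP[/andP[le' _] eN'].
  have ee : elem e by rewrite /elem le andbT.
  have ee' : elem e' by rewrite /elem le' andbT.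
  exact: (el_inj den ee ee').
have sl : {subset concept_inds (lhs t) <= names}.
  by move=> a aC; apply: sub; rewrite mem_cat aC.
have sr : {subset concept_inds (rhs t) <= names}.
  by move=> a aC; apply: sub; rewrite mem_cat aC orbT.
apply/seteqP; split=> d.
  move=> [hl [[e ee E] nr]]; rewrite E in hl nr *.
  have /andP[eN le] := ee; apply/mapP; exists e => //.
  rewrite mem_filter mem_iota /violates le add0n eN leq0n !andbT andTb; apply/andP; split.
    by apply/(table_cext sl ee).
  by apply/negP => /(table_cext sr ee).
move=> /mapP[e]; rewrite mem_filter mem_iota => /andP[/and3P[le hl hr] eN] ->.
have ee : elem e by rewrite /elem le andbT.
split; first exact/(table_cext sl ee).
by split; [exists e | move/(table_cext sr ee); apply/negP].
Qed.

Lemma table_sat al : {subset assertion_inds al <= names} ->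
  `[< sat_assertion table_interp al >] = satisfies al.
Proof.
case: al => [A a|r a b] sub /=.
  have an : a \in names by apply: sub; rewrite mem_head.
  have := table_cintP A (elem_ix den an); rewrite (el_ix den an) => H.
  by apply/asboolP/idP => /H.
have an : a \in names by apply: sub; rewrite mem_head.
have bn : b \in names by apply: sub; rewrite !inE eqxx orbT.
have := table_rintP r (elem_ix den an) (elem_ix den bn).
by rewrite (el_ix den an) (el_ix den bn) => H; apply/asboolP/idP => /H.
Qed.

Lemma table_cost K :
  (forall tw, tw \in tbox K -> {subset inclusion_inds tw.1 <= names}) ->
  (forall aw, aw \in abox K -> {subset assertion_inds aw.1 <= names}) ->
  cost K table_interp = enat (tbox_infinite (tbox K) || abox_infinite (abox K))
    (tbox_cost (tbox K) + abox_cost (abox K)).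
Proof.
move=> sT sA; rewrite /cost -enatD; congr (_ + _)%E.
  rewrite -(enat_sum _ predT (fun tw => infinite tw.2 && (0 < vio_count tw.1))
    (fun tw => fin_val tw.2 * vio_count tw.1)).
  rewrite !big_seq; apply: eq_bigr => tw twT.
  by rewrite table_vio ?weight_val_mul //; apply: sT.
rewrite -(enat_sum _ (fun aw => ~~ satisfies aw.1) (fun aw => infinite aw.2)
  (fun aw => fin_val aw.2)).
rewrite big_seq_cond [RHS]big_seq_cond; apply: eq_big => [aw|aw _]; last exact:
  weight_val_enat.
by case: (boolP (aw \in abox K)) => //= awA; rewrite table_sat //; apply: sA.
Qed.

Lemma table_sat_bcq q : {subset flatten [seq atom_inds at_ | at_ <- q] <= names} ->
  sat_bcq table_interp q <->
  exists v : nat -> nat, (forall x, elem (v x)) /\ all (atom_holds v) q.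
Proof.
move=> sub.
have tv (v : nat -> nat) t : {subset term_inds t <= names} -> (forall x, elem (v x)) ->
    term_val (I := table_interp) (el \o v) t = el (term_ix v t) /\ elem (term_ix v t).
  case: t => [x|a] /= s ev; first by split.
  have an : a \in names by apply: s; rewrite mem_head.
  by split; [rewrite (el_ix den) | apply: elem_ix].
have sat_at (v : nat -> nat) at_ : {subset atom_inds at_ <= names} -> (forall x, elem
  (v x)) ->
    sat_atom (I := table_interp) (el \o v) at_ <-> atom_holds v at_.
  case: at_ => [A t|r t u] /= s ev.
    by have [-> et] := tv v t s ev; apply: table_cintP.
  have st : {subset term_inds t <= names} by move=> a at_; apply: s; rewrite mem_cat at_.
  have su : {subset term_inds u <= names} by move=> a at_; apply: s; rewrite mem_cat
    at_ orbT.
  by have [-> et] := tv v t st ev; have [-> eu] := tv v u su ev; apply: table_rintP.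
have sall (v : nat -> nat) : (forall x, elem (v x)) ->
    List.Forall (sat_atom (I := table_interp) (el \o v)) q <-> all (atom_holds v) q.
  move=> ev; elim: q sub => [|at_ q IH] /= sub; first by split.
  have s1 : {subset atom_inds at_ <= names} by move=> a H; apply: sub; rewrite mem_cat H.
  have s2 : {subset flatten [seq atom_inds at_ | at_ <- q] <= names}.
    by move=> a H; apply: sub; rewrite mem_cat H orbT.
  split=> [F|/andP[h1 h2]].
    by inversion F; subst; apply/andP; split; [apply/(sat_at _ _ s1 ev) | apply/(IH s2)].
  by constructor; [apply/(sat_at _ _ s1 ev) | apply/(IH s2)].
split=> [[v [dv Fv]]|[v [ev hv]]].
  have /choice[u uE] : forall x, exists e, elem e /\ v x = el e.
    by move=> x; have [e ee ->] := dv x; exists e.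
  have eu x : elem (u x) by have [] := uE x.
  exists u; split=> //; apply/sall => //.
  by have -> : el \o u = v by apply: funext => x; have [] := uE x.
exists (el \o v); split; last exact/sall.
by move=> x; exists (v x).
Qed.

End Tables.

(** * Merging elements of the same type *)

Fixpoint subconcepts (C : concept) : seq concept :=
  C :: match C with
       | CAnd C D | COr C D => subconcepts C ++ subconcepts D
       | CNot C | CEx _ C | CAll _ C => subconcepts C
       | _ => [::]
       end.

Fixpoint concept_names (C : concept) : seq NC :=
  match C with
  | CName A => [:: A]
  | CAnd C D | COr C D => concept_names C ++ concept_names D
  | CNot C | CEx _ C | CAll _ C => concept_names C
  | _ => [::]
  end.

Fixpoint role_names (C : concept) : seq NR :=
  match C with
  | CAnd C D | COr C D => role_names C ++ role_names D
  | CNot C => role_names C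
  | CEx r C | CAll r C => r :: role_names C
  | _ => [::]
  end.

Lemma subset_catl (T : eqType) (s t u : seq T) :
  {subset s ++ t <= u} -> {subset s <= u} /\ {subset t <= u}.
Proof. by move=> H; split=> x xs; apply: H; rewrite mem_cat xs ?orbT. Qed.

Lemma subset_consl (T : eqType) (x : T) (s u : seq T) :
  {subset x :: s <= u} -> x \in u /\ {subset s <= u}.
Proof. by move=> H; split=> [|y ys]; apply: H; rewrite inE ?eqxx ?ys ?orbT. Qed.

Section Filtration.
Variables (N : nat) (live : pred nat) (ct : NC -> nat -> bool).
Variables (rt : NR -> nat -> nat -> bool) (ix : NI -> nat).
Variables (el : nat -> NI + nat) (names : seq NI).
Hypothesis den : denoting N live ix el names.
Variables (cl : seq concept) (CNs : seq NC) (RNs : seq NR).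
Variables (I : interp) (h : elt I -> nat).

(* h is a quotient map onto the table that merges elements with the same type
   over cl but keeps the named ones apart; the remaining names are full. *)
Record filtration : Prop := Filtration {
  h_lt : forall d, dom d -> h d < N;
  liveP : forall e, e < N -> live e <-> exists2 d, dom d & h d = e;
  ctP : forall A, A \in CNs -> forall e, e < N -> ct A e <-> exists2 d, cint A d & h d = e;
  ct_full : forall A e, A \notin CNs -> ct A e;
  rtP : forall r, r \in RNs -> forall e e', e < N -> e' < N ->
    rt r e e' <-> exists d d', [/\ rint r (d, d'), h d = e & h d' = e'];
  rt_full : forall r e e', r \notin RNs -> rt r e e';
  h_named : forall a, a \in names -> h (ind I a) = ix a;
  h_inj : forall a d, a \in names -> dom d -> h d = ix a -> d = ind I a;
  h_type : forall C d d', C \in cl -> dom d -> dom d' -> h d = h d' -> cext C d -> cext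
    C d' }.

Hypothesis fil : filtration.

Record covered (C : concept) : Prop := Covered {
  sub_cl : {subset subconcepts C <= cl};
  sub_inds : {subset concept_inds C <= names};
  sub_CNs : {subset concept_names C <= CNs};
  sub_RNs : {subset role_names C <= RNs} }.

(** Filtration with the least quotient relation: an edge leaving [h d] stems from some [d1] in the
    class of [d], and [h_type] moves existential and universal restrictions between [d1] and [d].
    Nominals are safe because the class of a named element is a singleton, by [h_inj]. *)
Lemma filtration_holds C d : covered C -> dom d ->
  holds N live ct rt ix C (h d) <-> cext C d.
Proof.
move=> [s1 s2 s3 s4].
elim: C d s1 s2 s3 s4 => [A|a|||C IHC D IHD|C IHC D IHD|C IHC|r C IHC|r C IHC] d /=
  /subset_consl[Ccl s1] s2 s3 s4 dd.
- have Ain : A \in CNs by apply: s3; rewrite mem_head.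
  have := ctP fil Ain (h_lt fil dd) => ->.
  split=> [[d' cA hd]|cA]; last by exists d.
  exact: (h_type fil Ccl (cint_sub cA) dd hd cA).
- have an : a \in names by apply: s2; rewrite mem_head.
  split=> [/eqP hd|->]; first exact: (h_inj fil an dd hd).
  by rewrite (h_named fil an).
- by split.
- by split.
- have [a1 b1] := subset_catl s1; have [a2 b2] := subset_catl s2.
  have [a3 b3] := subset_catl s3; have [a4 b4] := subset_catl s4.
  have HC := IHC d a1 a2 a3 a4 dd; have HD := IHD d b1 b2 b3 b4 dd.
  by split=> [/andP[/HC ? /HD ?]|[/HC -> /HD ->]].
- have [a1 b1] := subset_catl s1; have [a2 b2] := subset_catl s2.
  have [a3 b3] := subset_catl s3; have [a4 b4] := subset_catl s4.
  have HC := IHC d a1 a2 a3 a4 dd; have HD := IHD d b1 b2 b3 b4 dd.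
  split=> [/orP[/HC ?|/HD ?]|[/HC -> //|/HD ->]]; [by left|by right|by rewrite orbT].
- have HC := IHC d s1 s2 s3 s4 dd.
  by split=> [/negP nC|[_ nC]]; [split=> // /HC | apply/negP => /HC].
- have [rR s4'] := subset_consl s4; have HC d' := IHC d' s1 s2 s3 s4'.
  split=> [/hasP[e]|[_ [d' [rd cd]]]].
    rewrite mem_iota add0n /= => eN /andP[/andP[_]].
    move=> /(rtP fil rR (h_lt fil dd) eN)[d1 [d2 [rd h1 h2]]] hC.
    have [dd1 dd2] := rint_sub rd; rewrite -h2 in hC.
    apply: (h_type fil Ccl dd1 dd h1); split=> //.
    by exists d2; split=> //; apply/(HC _ dd2).
  have [_ dd'] := rint_sub rd.
  apply/hasP; exists (h d'); first by rewrite mem_iota add0n /= (h_lt fil dd').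
  rewrite (proj2 (HC _ dd') cd) andbT; apply/andP; split.
    by apply/(liveP fil (h_lt fil dd')); exists d'.
  by apply/(rtP fil rR (h_lt fil dd) (h_lt fil dd')); exists d, d'.
- have [rR s4'] := subset_consl s4; have HC d' := IHC d' s1 s2 s3 s4'.
  split=> [/allP H|cd].
    split=> // d' rd; have [_ dd'] := rint_sub rd; apply/(HC _ dd').
    have := H (h d'); rewrite mem_iota add0n /= (h_lt fil dd') => /(_ isT)/implyP; apply.
    apply/andP; split; first by apply/(liveP fil (h_lt fil dd')); exists d'.
    by apply/(rtP fil rR (h_lt fil dd) (h_lt fil dd')); exists d, d'.
  apply/allP => e; rewrite mem_iota add0n /= => eN; apply/implyP => /andP[_].
  move=> /(rtP fil rR (h_lt fil dd) eN)[d1 [d2 [rd h1 <-]]].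
  have [dd1 dd2] := rint_sub rd; apply/(HC _ dd2).
  have := h_type fil Ccl dd dd1 (esym h1) cd; case=> _; exact.
Qed.

Definition covered_inclusion (t : inclusion) : Prop := covered (lhs t) /\ covered (rhs t).

(** Every violating class contains a violating element, so [h] maps the violations in [I] onto those
    in the table, and their number cannot grow. *)
Lemma filtration_vio t : covered_inclusion t ->
  (ecard (vio (table_interp ct rt den) t) <= ecard (vio I t))%E.
Proof.
move=> [cl_ cr_]; rewrite table_vio; last first.
  by move=> a; rewrite mem_cat => /orP[]; apply: sub_inds.
rewrite [X in (_ <= X)%E]/ecard; case: asboolP => fin; last exact: leey.
rewrite lee_fin lez_nat /vio_count -size_filter -(size_map h).
apply: uniq_leq_size; first by rewrite filter_uniq ?iota_uniq.
move=> e; rewrite mem_filter mem_iota add0n => /andP[/and3P[le hl hr] /= eN].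
have [d dd hd] := proj1 (liveP fil eN) le; rewrite -hd in hl hr.
apply/mapP; exists d => //; rewrite in_fset_set // inE.
split; first exact/(filtration_holds cl_ dd).
by split=> // /(filtration_holds cr_ dd); apply/negP.
Qed.

(** Assertions over names outside [CNs] and [RNs] hold because these names are full; covered
    inclusions do not mention them, so fullness creates no violation. *)
Lemma filtration_sat al : {subset assertion_inds al <= names} ->
  sat_assertion I al -> satisfies ct rt ix al.
Proof.
case: al => [A a|r a b] /= sub sat.
  have an : a \in names by apply: sub; rewrite mem_head.
  case: (boolP (A \in CNs)) => Ain; last exact: ct_full fil _ _ Ain.
  have da := cint_sub sat; have := h_lt fil da; rewrite (h_named fil an) => aN.
  by apply/(ctP fil Ain aN); exists (ind I a) => //; apply: h_named fil _ an.
have an : a \in names by apply: sub; rewrite mem_head.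
have bn : b \in names by apply: sub; rewrite !inE eqxx orbT.
case: (boolP (r \in RNs)) => rR; last exact: rt_full fil _ _ _ rR.
have [da db] := rint_sub sat.
have := h_lt fil da; rewrite (h_named fil an) => aN.
have := h_lt fil db; rewrite (h_named fil bn) => bN.
apply/(rtP fil rR aN bN); exists (ind I a), (ind I b); split=> //; exact: h_named fil _ _.
Qed.

Lemma weight_val_ge0 w : (0 <= weight_val w)%E.
Proof. by case: w => //= p; rewrite lee_fin. Qed.

Lemma filtration_cost K :
  (forall tw, tw \in tbox K -> covered_inclusion tw.1) ->
  (forall aw, aw \in abox K -> {subset assertion_inds aw.1 <= names}) ->
  (cost K (table_interp ct rt den) <= cost K I)%E.
Proof.
move=> cT cA; rewrite /cost; apply: leeD.
  rewrite !big_seq; apply: lee_sum => tw twT.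
  by apply: lee_wpmul2l; [exact: weight_val_ge0 | apply: filtration_vio; apply: cT].
rewrite big_seq_cond [leRHS]big_seq_cond [leLHS]big_mkcond [leRHS]big_mkcond.
apply: lee_sum => aw _; case: (boolP (aw \in abox K)) => //= awA.
rewrite table_sat; last exact: cA.
case: asboolP => [s|_] /=; first by rewrite (filtration_sat (cA _ awA) s).
by case: ifP => // _; exact: weight_val_ge0.
Qed.

Lemma filtration_bcq q : {subset flatten [seq atom_inds at_ | at_ <- q] <= names} ->
  sat_bcq I q -> sat_bcq (table_interp ct rt den) q.
Proof.
move=> sub [v [dv Fv]]; apply/table_sat_bcq => //; exists (h \o v); split.
  move=> x; rewrite /elem (h_lt fil (dv x)); apply/(liveP fil (h_lt fil (dv x))).
  by exists (v x).
have tv t : {subset term_inds t <= names} -> term_ix ix (h \o v) t = h (term_val v t).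
  by case: t => [x|a] //= s; rewrite (h_named fil) //; apply: s; rewrite mem_head.
elim: q Fv sub => [|at_ q IH] //= Fv /subset_catl[s1 s2].
inversion Fv as [|? ? F1 F2]; subst; rewrite IH // andbT.
case: at_ s1 F1 {Fv} => [A t|r t u] /= s F1.
  rewrite tv //; have := h_lt fil (cint_sub F1) => tN.
  case: (boolP (A \in CNs)) => Ain; last exact: ct_full fil _ _ Ain.
  by apply/(ctP fil Ain tN); exists (term_val v t).
have [s1 s3] := subset_catl s; rewrite !tv //.
have [/(h_lt fil) tN /(h_lt fil) uN] := rint_sub F1.
case: (boolP (r \in RNs)) => rR; last exact: rt_full fil _ _ _ rR.
by apply/(rtP fil rR tN uN); exists (term_val v t), (term_val v u).
Qed.

End Filtration.

(** * The verifier *)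

Section Verifier.
Variables (T : wtbox) (q : bcq).

Definition fixed_inds : seq NI :=
  undup (flatten [seq inclusion_inds tw.1 | tw <- T] ++ flatten [seq atom_inds a | a <- q]).

Definition closure : seq concept :=
  flatten [seq subconcepts (lhs tw.1) ++ subconcepts (rhs tw.1) | tw <- T].

Definition fixed_concepts : seq NC :=
  flatten [seq concept_names (lhs tw.1) ++ concept_names (rhs tw.1) | tw <- T] ++
  flatten [seq if a is CAtom A _ then [:: A] else [::] | a <- q].

Definition fixed_roles : seq NR :=
  flatten [seq role_names (lhs tw.1) ++ role_names (rhs tw.1) | tw <- T] ++
  flatten [seq if a is RAtom r _ _ then [:: r] else [::] | a <- q].

(* Elements of a table: the individuals of T and q, then one element for each
   type over the closure, then the positions of individual names in the string,
   the first occurrence of a name being the one that is used. *)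
Definition nfixed : nat := size fixed_inds.
Definition nconst : nat := nfixed + 2 ^ size closure.

Section Table.
Variables (y w : bitstring).

Definition nelem : nat := nconst + size y.

Definition is_ind (i : nat) : bool :=
  has (fun k => (i == fst_ind y (pos y k)) ||
                (is_role y (pos y k) && (i == snd_ind y (pos y k)))) (iota 0 (num y)).

Definition first_pos (i : nat) : nat :=
  find (fun j => is_ind j && same_name y j i) (iota 0 (size y)).

Definition fixed_index (i : nat) : nat := index (name_at y i) fixed_inds.

Definition elem_at (i : nat) : nat :=
  if fixed_index i < nfixed then fixed_index i else nconst + first_pos i.

(** A witness is read as a stack of square matrices of side [nelem]: number 0 for liveness, then one
    per concept name, then one per role name; liveness and concepts use column 0 only. Missing bits
    count as [false], so every string can be read this way. *)
Definition entry (u e e' : nat) : bool := nth false w ((u * nelem + e) * nelem + e').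

(** Individuals of [T] and [q] have to be in the domain, and the presence of a type is guessed. A
    position counts only if it is the first occurrence of an individual that is not among the fixed
    ones, which is what [elem_at (e - nconst) == e] tests. *)
Definition live (e : nat) : bool :=
  if e < nfixed then true else if e < nconst then entry 0 e 0
  else is_ind (e - nconst) && (elem_at (e - nconst) == e).

(** The implication makes a name without index true everywhere, so an ABox can use arbitrarily many
    such names without enlarging the witness. *)
Definition centry (A : NC) (e : nat) : bool :=
  (index A fixed_concepts < size fixed_concepts) ==> entry (index A fixed_concepts).+1 e 0.

Definition rentry (r : NR) (e e' : nat) : bool :=
  (index r fixed_roles < size fixed_roles) ==>
  entry (size fixed_concepts + index r fixed_roles).+1 e e'.

Definition ind_index (a : NI) : nat :=
  if index a fixed_inds < nfixed then index a fixed_inds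
  else nconst + find (fun j => is_ind j && (name_at y j == a)) (iota 0 (size y)).

Definition violated (k : nat) : bool :=
  let i := pos y k in
  if is_role y i then
    ~~ rentry (name_at y i.+1) (elem_at (fst_ind y i)) (elem_at (snd_ind y i))
  else ~~ centry (name_at y i.+1) (elem_at (fst_ind y i)).

Definition weight_bit (i j : nat) : bool :=
  [&& is_fin y i, j < name_size y (weight_pos y i).+1 & name_bit y (weight_pos y i).+1 j].

Definition column (j : nat) : nat :=
  count (fun k => violated k && weight_bit (pos y k) j) (iota 0 (num y)).

Definition tcost : nat := tbox_cost nelem live centry rentry ind_index T.

(* Binary addition of the weights of the violated assertions, column by column;
   the cost of the TBox, which is small, is the initial carry. *)
Definition carry (j : nat) : nat :=
  brec j (num y + tcost) tcost (fun i s => (column i + s)./2).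

Definition cost_bit (j : nat) : bool := odd (column j + carry j).

Definition no_infinite : bool :=
  ~~ tbox_infinite nelem live centry rentry ind_index T &&
  ~~ has (fun k => violated k && ~~ is_fin y (pos y k)) (iota 0 (num y)).

Definition table_ok : bool := has live (iota 0 nelem) && no_infinite.

(** The query is fixed, so one loop per variable stays polynomial. Each loop pushes its element in
    front, hence the innermost one sets variable 0; all combinations are tried, so the order is
    immaterial. *)
Fixpoint query_holds (m : nat) (l : seq nat) : bool :=
  if m is m'.+1 then has (fun e => live e && query_holds m' (e :: l)) (iota 0 nelem)
  else all (atom_holds centry rentry ind_index (nth 0 l)) q.

Definition term_bound (t : term) : nat := if t is TVar x then x.+1 else 0.
Definition atom_bound (a : atom) : nat :=
  match a with
  | CAtom _ t => term_bound t
  | RAtom _ t u => term_bound t + term_bound u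
  end.
Definition nvars : nat := sumn [seq atom_bound a | a <- q].

Definition weight_sum : nat := \sum_(tw <- T) fin_val tw.2.

(** Chosen for [total_lt]: on top of the length of the ABox code, these bits leave room for the TBox
    cost and keep the all-ones pattern free. *)
Definition nbits_cst : nat := weight_sum + nconst + 2.

Definition nbits : nat := size y - abox_pos y + nbits_cst.

(** The search prepends lower bits to higher ones, so the prefix lists the leading bits of the cost
    from the lowest up; this explains the offset [nbits - prefix_size]. *)
Definition prefix_matches : bool :=
  all (fun j => name_bit y (prefix_pos y) j == cost_bit (nbits - prefix_size y + j))
    (iota 0 (prefix_size y)).

Definition prefix_ones : bool :=
  all (fun j => name_bit y (prefix_pos y) j) (iota 0 (prefix_size y)).

(* A leading false marks the final question. *)
Definition accept : bool :=
  valid y &&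
  (if bit y 0 then table_ok && prefix_matches
   else prefix_ones || [&& table_ok, prefix_matches & query_holds nvars [::]]).

End Table.
End Verifier.

(** * Computability of the verifier *)

Section Computability.
Implicit Types f a b d : ctx -> nat.

Lemma computable_bit a : computable a -> computable_pred (fun c => bit c.1.1 (a c)).
Proof. exact: computable_bit1. Qed.

Lemma computable_double a : computable a -> computable (fun c => 2 * a c).
Proof. exact: computableM (computable_cst 2). Qed.

Lemma computable_name_size a : computable a -> computable (fun c => name_size c.1.1 (a c)).
Proof.
move=> ca; apply: computable_find; first by apply: computableS; apply: computable_size1.
apply/computable_negb/computable_bit/computableD; first exact: computable_pop2 ca.
by apply: computable_double; apply: computable_var.
Qed.

Lemma computable_name_bit a b : computable a -> computable b ->
  computable_pred (fun c => name_bit c.1.1 (a c) (b c)).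
Proof.
move=> ca cb; apply/computable_bit/computableD; last exact: computable_cst.
by apply: computableD (ca) _; apply: computable_double.
Qed.

Lemma computable_after a : computable a -> computable (fun c => after c.1.1 (a c)).
Proof.
move=> ca; apply/computableD; last exact: computable_cst.
by apply: computableD (ca) _; apply/computable_double/computable_name_size.
Qed.

Lemma computable_is_role a : computable a -> computable_pred (fun c => is_role c.1.1 (a c)).
Proof. exact: computable_bit. Qed.

Lemma computable_fst_ind a : computable a -> computable (fun c => fst_ind c.1.1 (a c)).
Proof. by move=> ca; apply/computable_after/computableS. Qed.

Lemma computable_snd_ind a : computable a -> computable (fun c => snd_ind c.1.1 (a c)).
Proof. by move=> ca; apply/computable_after/computable_fst_ind. Qed.

Lemma computable_weight_pos a : computable a -> computable (fun c => weight_pos c.1.1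
  (a c)).
Proof.
move=> ca; apply: computable_if; first exact: computable_is_role.
  by apply/computable_after/computable_snd_ind.
exact: computable_snd_ind.
Qed.

Lemma computable_is_fin a : computable a -> computable_pred (fun c => is_fin c.1.1 (a c)).
Proof. by move=> ca; apply/computable_bit/computable_weight_pos. Qed.

Lemma computable_next a : computable a -> computable (fun c => next c.1.1 (a c)).
Proof.
move=> ca; apply: computable_if; first exact: computable_is_fin.
  by apply/computable_after/computableS/computable_weight_pos.
by apply/computableS/computable_weight_pos.
Qed.

Lemma computable_weight_ok a : computable a ->
  computable_pred (fun c => weight_ok c.1.1 (a c)).
Proof.
move=> ca; have cj := computableS (computable_weight_pos ca).
have cn := computable_name_size cj.
apply: computable_implb; first exact: computable_is_fin.
apply: computable_andb; first by apply: computable_leq (cn); apply: computable_cst.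
by apply: computable_name_bit (cj) _; apply: computableB (cn) _; apply: computable_cst.
Qed.

Lemma computable_prefix_pos : computable (fun c => prefix_pos c.1.1).
Proof.
by apply: computable_if; [apply: computable_bit | |]; apply: computable_cst.
Qed.

Lemma computable_prefix_size : computable (fun c => prefix_size c.1.1).
Proof. exact: computable_name_size computable_prefix_pos. Qed.

Lemma computable_abox_pos : computable (fun c => abox_pos c.1.1).
Proof. exact: computable_after computable_prefix_pos. Qed.

Lemma computable_pos a : computable a -> computable (fun c => pos c.1.1 (a c)).
Proof.
move=> ca; apply: (computable_brec (g := fun c _ s => next c.1.1 s)) => //.
- by apply: computableS; apply: computable_size1.
- exact: computable_abox_pos.
- by apply: computable_next; apply: computable_var.
Qed.

Lemma computable_num : computable (fun c => num c.1.1).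
Proof.
apply: computable_find; first by apply: computableS; apply: computable_size1.
by apply: computable_leq; [apply: computable_size1 | apply: computable_pos; apply:
  computable_var].
Qed.

Lemma computable_same_name a b : computable a -> computable b ->
  computable_pred (fun c => same_name c.1.1 (a c) (b c)).
Proof.
move=> ca cb; apply: computable_andb.
  by apply: computable_eqn; apply: computable_name_size.
apply: computable_all; first exact: computable_name_size.
by apply: computable_eqb; apply: computable_name_bit;
  solve [apply: computable_pop2; assumption | apply: computable_var].
Qed.

Lemma computable_same_assertion a b : computable a -> computable b ->
  computable_pred (fun c => same_assertion c.1.1 (a c) (b c)).
Proof.
move=> ca cb; apply: computable_andb.
  by apply: computable_eqb; apply: computable_is_role.
apply: computable_andb; first by apply: computable_same_name; apply: computableS.
apply: computable_andb; first by apply: computable_same_name; apply: computable_fst_ind.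
apply: computable_implb; first exact: computable_is_role.
by apply: computable_same_name; apply: computable_snd_ind.
Qed.

Lemma computable_valid : computable_pred (fun c => valid c.1.1).
Proof.
apply: computable_andb.
  by apply: computable_eqn; [apply/computable_pos/computable_num | apply: computable_size1].
apply: computable_andb.
  apply: computable_all; first exact: computable_num.
  by apply/computable_weight_ok/computable_pos/computable_var.
apply: computable_all; first exact: computable_num.
apply: computable_all; first exact: computable_var.
by apply/computable_negb/computable_same_assertion; apply/computable_pos/computable_var.
Qed.

Lemma computable_nth_cst (s : bitstring) a : computable a ->
  computable_pred (fun c => nth false s (a c)).
Proof.
elim: s a => [|b s IH] a ca.
  by apply: computable_ext (computable_cst 0) => c; rewrite nth_nil.
have cb := IH (fun c => a c - 1) (computableB ca (computable_cst 1)).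
apply: computable_ext (computable_if (computable_eqn ca (computable_cst 0))
  (computable_cst b) cb) => c.
by case: (a c) => [|n] //=; rewrite subn1.
Qed.

Lemma computable_name_eq (s : bitstring) a : computable a ->
  computable_pred (fun c => name_at c.1.1 (a c) == s).
Proof.
move=> ca.
have cE := computable_all (P := fun c k => name_bit c.1.1 (a c) k == nth false s k)
  (computable_cst (size s))
  (computable_eqb (computable_name_bit (computable_pop2 ca) (computable_var 0))
                  (computable_nth_cst s (computable_var 0))).
apply: computable_ext (computable_andb
  (computable_eqn (computable_name_size ca) (computable_cst (size s))) cE) => c.
congr nat_of_bool; apply/andP/eqP => [[/eqP E /allP H]|E].
  apply: (@eq_from_nth _ false); rewrite size_mkseq // => k ks.
  by rewrite nth_mkseq //; apply/eqP/H; rewrite mem_iota -E.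
have Es : name_size c.1.1 (a c) = size s by rewrite -E size_mkseq.
split; first exact/eqP.
by apply/allP => k; rewrite mem_iota add0n -Es /= => ks; rewrite -E nth_mkseq.
Qed.

Lemma computable_index_name (l : seq (seq bool)) a : computable a ->
  computable (fun c => index (name_at c.1.1 (a c)) l).
Proof.
move=> ca; elim: l => [|s l IH]; first exact: computable_cst.
apply: computable_ext (computable_if (computable_name_eq s ca) (computable_cst 0)
  (computableS IH)) => c.
by rewrite /= [s == _]eq_sym.
Qed.

Variables (T : wtbox) (q : bcq).

Lemma computable_nelem : computable (fun c => nelem T q c.1.1).
Proof. by apply: computableD; [apply: computable_cst | apply: computable_size1]. Qed.

Lemma computable_is_ind a : computable a -> computable_pred (fun c => is_ind c.1.1 (a c)).
Proof.
move=> ca; apply: computable_has; first exact: computable_num.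
have ca' := computable_pop2 ca; have cp := computable_pos (computable_var 0).
apply: computable_orb; first by apply: computable_eqn (ca') _; apply: computable_fst_ind.
apply: computable_andb; first exact: computable_is_role.
by apply: computable_eqn (ca') _; apply: computable_snd_ind.
Qed.

Lemma computable_first_pos a : computable a -> computable (fun c => first_pos c.1.1 (a c)).
Proof.
move=> ca; apply: computable_find; first exact: computable_size1.
apply: computable_andb; first by apply: computable_is_ind; apply: computable_var.
by apply: computable_same_name; [apply: computable_var | apply: computable_pop2].
Qed.

Lemma computable_elem_at a : computable a -> computable (fun c => elem_at T q c.1.1 (a c)).
Proof.
move=> ca; have ci := computable_index_name (fixed_inds T q) ca.
apply: computable_if => //.
  by apply: computable_leq (computableS ci) _; apply: computable_cst.
by apply: computableD; [apply: computable_cst | apply: computable_first_pos].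
Qed.

Lemma computable_entry a b d : computable a -> computable b -> computable d ->
  computable_pred (fun c => entry T q c.1.1 c.1.2 (a c) (b c) (d c)).
Proof.
move=> ca cb cd; apply/computable_bit2/computableD => //.
apply: computableM computable_nelem; apply: computableD => //.
exact: computableM computable_nelem.
Qed.

Lemma computable_live a : computable a ->
  computable_pred (fun c => live T q c.1.1 c.1.2 (a c)).
Proof.
move=> ca; have cl := fun k => computable_leq (computableS ca) (computable_cst k).
apply: computable_ifb => //; first exact: computable_cst 1.
apply: computable_ifb => //; first by apply: computable_entry => //; apply: computable_cst.
have cb := computableB ca (computable_cst (nconst T q)).
apply: computable_andb; first exact: computable_is_ind.
by apply: computable_eqn (ca); apply: computable_elem_at.
Qed.

(** The name enters through its index alone, so this serves names fixed in advance, whose index is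
    constant, as well as names read from the ABox. *)
Lemma computable_centry b (A : ctx -> NC) :
  computable (fun c => index (A c) (fixed_concepts T q)) -> computable b ->
  computable_pred (fun c => centry T q c.1.1 c.1.2 (A c) (b c)).
Proof.
move=> ci cb; apply: computable_implb.
  by apply: computable_leq (computableS ci) _; apply: computable_cst.
by apply: computable_entry => //; [apply: computableS | apply: computable_cst].
Qed.

Lemma computable_rentry b d (r : ctx -> NR) :
  computable (fun c => index (r c) (fixed_roles T q)) -> computable b -> computable d ->
  computable_pred (fun c => rentry T q c.1.1 c.1.2 (r c) (b c) (d c)).
Proof.
move=> ci cb cd; apply: computable_implb.
  by apply: computable_leq (computableS ci) _; apply: computable_cst.
apply: computable_entry => //; apply: computableS.
by apply: computableD (ci); apply: computable_cst.
Qed.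

Lemma computable_ind_index (x : NI) : computable (fun c => ind_index T q c.1.1 x).
Proof.
rewrite /ind_index; case: (index x _ < _); first exact: computable_cst.
apply: computableD; first exact: computable_cst.
apply: computable_find; first exact: computable_size1.
by apply: computable_andb; [apply: computable_is_ind | apply: computable_name_eq];
  apply: computable_var.
Qed.

Definition table_holds (y w : bitstring) : concept -> nat -> bool :=
  holds (nelem T q y) (live T q y w) (centry T q y w) (rentry T q y w) (ind_index T q y).

(** The concept is fixed: each quantifier becomes one loop over the elements, and the nesting depth
    does not depend on the ABox. *)
Lemma computable_holds C a : computable a ->
  computable_pred (fun c => table_holds c.1.1 c.1.2 C (a c)).
Proof.
have cv := computable_var; have cc := computable_cst.
elim: C a => [A|x|||C IHC D IHD|C IHC D IHD|C IHC|r C IHC|r C IHC] a ca.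
- by apply: (@computable_centry a (fun=> A)).
- by apply: computable_eqn (ca) _; apply: computable_ind_index.
- exact: cc 1.
- exact: cc 0.
- by apply: computable_andb; [apply: IHC | apply: IHD].
- by apply: computable_orb; [apply: IHC | apply: IHD].
- by apply: computable_negb; apply: IHC.
- apply: computable_has; first exact: computable_nelem.
  apply: computable_andb; last by apply: (IHC (fun c => c.2 0)).
  apply: computable_andb; first exact: computable_live.
  by apply: computable_rentry => //; apply: computable_pop2.
- apply: computable_all; first exact: computable_nelem.
  apply: computable_implb; last by apply: (IHC (fun c => c.2 0)).
  apply: computable_andb; first exact: computable_live.
  by apply: computable_rentry => //; apply: computable_pop2.
Qed.

Lemma computable_vio_count t : computable (fun c => vio_count (nelem T q c.1.1)
  (live T q c.1.1 c.1.2) (centry T q c.1.1 c.1.2) (rentry T q c.1.1 c.1.2)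
  (ind_index T q c.1.1) t).
Proof.
have cv := computable_var 0.
apply: computable_count; first exact: computable_nelem.
apply: computable_andb; first exact: computable_live.
apply: computable_andb; first exact: computable_holds.
by apply: computable_negb; apply: computable_holds.
Qed.

Lemma computable_tbox_cost s : computable (fun c => tbox_cost (nelem T q c.1.1)
  (live T q c.1.1 c.1.2) (centry T q c.1.1 c.1.2) (rentry T q c.1.1 c.1.2)
  (ind_index T q c.1.1) s).
Proof.
rewrite /tbox_cost; elim: s => [|tw s IH].
  by apply: computable_ext (computable_cst 0) => c; rewrite big_nil.
apply: computable_ext (computableD (computableM (computable_cst (fin_val tw.2))
  (computable_vio_count tw.1)) IH) => c.
by rewrite big_cons.
Qed.

Lemma computable_tcost : computable (fun c => tcost T q c.1.1 c.1.2).
Proof. exact: computable_tbox_cost. Qed.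

Lemma computable_tbox_infinite s : computable_pred (fun c => tbox_infinite (nelem T q c.1.1)
  (live T q c.1.1 c.1.2) (centry T q c.1.1 c.1.2) (rentry T q c.1.1 c.1.2)
  (ind_index T q c.1.1) s).
Proof.
rewrite /tbox_infinite; elim: s => [|tw s IH]; first exact: computable_cst 0.
apply: computable_orb (IH); apply: computable_andb; first exact: computable_cst.
by apply: computable_leq (computable_vio_count _); apply: computable_cst.
Qed.

Lemma computable_violated a : computable a ->
  computable_pred (fun c => violated T q c.1.1 c.1.2 (a c)).
Proof.
move=> ca; have cp := computable_pos ca.
have c1 := computable_elem_at (computable_fst_ind cp).
have c2 := computable_elem_at (computable_snd_ind cp).
apply: computable_ifb; first exact: computable_is_role.
  apply: computable_negb; apply: computable_rentry => //.
  exact: computable_index_name (computableS cp).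
apply: computable_negb; apply: computable_centry => //.
exact: computable_index_name (computableS cp).
Qed.

Lemma computable_weight_bit a b : computable a -> computable b ->
  computable_pred (fun c => weight_bit c.1.1 (a c) (b c)).
Proof.
move=> ca cb; have cp := computableS (computable_weight_pos ca).
apply: computable_andb; first exact: computable_is_fin.
apply: computable_andb; last exact: computable_name_bit.
by apply: computable_leq; [apply: computableS | apply: computable_name_size].
Qed.

Lemma computable_column a : computable a ->
  computable (fun c => column T q c.1.1 c.1.2 (a c)).
Proof.
move=> ca; apply: computable_count; first exact: computable_num.
have cv := computable_var 0.
apply: computable_andb; first exact: computable_violated.
by apply: computable_weight_bit; [apply: computable_pos | apply: computable_pop2].
Qed.

Lemma computable_carry a : computable a ->
  computable (fun c => carry T q c.1.1 c.1.2 (a c)).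
Proof.
move=> ca.
apply: (computable_brec (g := fun c i s => (column T q c.1.1 c.1.2 i + s)./2)) => //.
- by apply: computableD; [apply: computable_num | apply: computable_tcost].
- exact: computable_tcost.
- apply/computable_half/computableD; last exact: computable_var.
  by apply: computable_column; apply: computable_var.
Qed.

Lemma computable_cost_bit a : computable a ->
  computable_pred (fun c => cost_bit T q c.1.1 c.1.2 (a c)).
Proof.
by move=> ca; apply: computable_odd; apply: computableD;
  [apply: computable_column | apply: computable_carry].
Qed.

Lemma computable_table_ok : computable_pred (fun c => table_ok T q c.1.1 c.1.2).
Proof.
have cv := computable_var 0; apply: computable_andb.
  by apply: computable_has; [apply: computable_nelem | apply: computable_live].
apply: computable_andb; apply: computable_negb; first exact: computable_tbox_infinite.
apply: computable_has; first exact: computable_num.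
apply: computable_andb; first exact: computable_violated.
by apply: computable_negb; apply: computable_is_fin; apply: computable_pos.
Qed.

Lemma computable_query_holds m (l : ctx -> seq nat) :
  (forall i, computable (fun c => nth 0 (l c) i)) ->
  computable_pred (fun c => query_holds T q c.1.1 c.1.2 m (l c)).
Proof.
elim: m l => [|m IH] l cl.
  have ct t : computable (fun c => term_ix (ind_index T q c.1.1) (nth 0 (l c)) t).
    by case: t => [x|a] /=; [exact: cl | exact: computable_ind_index].
  suff H s : computable_pred (fun c => all (atom_holds (centry T q c.1.1 c.1.2)
      (rentry T q c.1.1 c.1.2) (ind_index T q c.1.1) (nth 0 (l c))) s) by exact: H q.
  elim: s => [|at_ s IHs]; first exact: computable_cst 1.
  apply: computable_andb IHs; case: at_ => [A t|r t u].
    by apply: (@computable_centry _ (fun=> A)) => //; apply: computable_cst.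
  by apply: (@computable_rentry _ _ (fun=> r)) => //; apply: computable_cst.
apply: computable_has; first exact: computable_nelem.
have cv := computable_var 0.
apply: computable_andb; first exact: computable_live.
apply: (IH (fun c => c.2 0 :: l (pop2 c))) => -[|i] //=.
exact: computable_pop2 (cl i).
Qed.

Lemma computable_nbits : computable (fun c => nbits T q c.1.1).
Proof.
apply: computableD; last exact: computable_cst.
exact: computableB computable_size1 computable_abox_pos.
Qed.

Lemma computable_prefix_bit : computable_pred (fun c => name_bit c.1.1 (prefix_pos
  c.1.1) (c.2 0)).
Proof. exact: computable_name_bit computable_prefix_pos (computable_var 0). Qed.

Lemma computable_prefix_matches : computable_pred (fun c => prefix_matches T q c.1.1 c.1.2).
Proof.
apply: computable_all; first exact: computable_prefix_size.
apply: computable_eqb; first exact: computable_prefix_bit.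
apply: computable_cost_bit; apply: computableD; last exact: computable_var.
exact: computableB computable_nbits computable_prefix_size.
Qed.

Lemma computable_accept : computable_pred (fun c => accept T q c.1.1 c.1.2).
Proof.
apply: computable_andb; first exact: computable_valid.
apply: computable_ifb; first by apply: computable_bit; apply: computable_cst.
  by apply: computable_andb; [apply: computable_table_ok | apply:
    computable_prefix_matches].
apply: computable_orb.
  by apply: computable_all; [apply: computable_prefix_size | apply: computable_prefix_bit].
apply: computable_andb; first exact: computable_table_ok.
apply: computable_andb; first exact: computable_prefix_matches.
by apply: (@computable_query_holds _ (fun=> [::])) => i; apply: computable_cst.
Qed.

End Computability.

Lemma accept_ptime (T : wtbox) (q : bcq) : ptime_relation (fun y w => accept T q y w).
Proof.
have [e E] := computable_accept T q; apply: (@eval_ptime e) => y w.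
by rewrite -(E (y, w, fun=> 0)) /=; case: accept.
Qed.

(** * Correctness of the verifier *)

Lemma bits_val_lt s : bits_val s < 2 ^ size s.
Proof. by elim: s => //= b s IH; rewrite expnS; case: b => /=; lia. Qed.

Lemma bits_val_inj s t : size s = size t -> bits_val s = bits_val t -> s = t.
Proof.
elim: s t => [|b s IH] [|c t] //= [st] E.
have bc : b = c by case: b E; case: c => //=; lia.
by rewrite bc (IH t) //; move: E; rewrite bc; lia.
Qed.

Lemma bits_val_sum s L : size s <= L -> bits_val s = \sum_(j < L) nth false s j * 2 ^ j.
Proof.
elim: s L => [|b s IH] L /=; first by rewrite big1 // => j _; rewrite nth_nil.
case: L => // L sL; rewrite big_ord_recl /= muln1 (IH L) // big_distrr /=; congr addn.
by apply: eq_bigr => j _; rewrite /bump /= add1n expnS mulnCA.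
Qed.

Lemma bits_val_mod p n :
  all (fun j => nth false p j == odd (n %/ 2 ^ j)) (iota 0 (size p)) =
  (bits_val p == n %% 2 ^ size p).
Proof.
elim: p n => [|b p IH] n; first by rewrite modn1.
have E : n %% 2 ^ (size p).+1 = odd n + 2 * ((n %/ 2) %% 2 ^ size p).
  rewrite modn_divl -expnSr -(@odd_mod n (2 ^ (size p).+1)) ?oddX //.
  lia.
have -> : iota 0 (size (b :: p)) = 0 :: map (addn 1) (iota 0 (size p)) by rewrite -iotaDl.
rewrite /= all_map E divn1.
have -> : all (preim (addn 1) (fun j => nth false (b :: p) j == odd (n %/ 2 ^ j)))
   (iota 0 (size p)) = (bits_val p == (n %/ 2) %% 2 ^ size p).
  by rewrite -IH; apply: eq_all => j /=; rewrite add1n expnS divnMA.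
move: (bits_val p) (_ %% _) => u v.
by case: b; case: (odd n) => /=; rewrite ?eqSS ?eqn_pmul2l //; apply/esym/negbTE/eqP; lia.
Qed.

Section Decoded.
Variables (T : wtbox) (q : bcq) (y w : bitstring).

Local Notation nelem := (nelem T q y).
Local Notation live := (live T q y w).
Local Notation centry := (centry T q y w).
Local Notation rentry := (rentry T q y w).
Local Notation ind_index := (ind_index T q y).
Local Notation elem_at := (elem_at T q y).
Local Notation nfixed := (nfixed T q).
Local Notation nconst := (nconst T q).
Local Notation fixed_inds := (fixed_inds T q).
Local Notation kb := (WKB T (abox_of y)).
Local Notation names := (input_inds kb q).

Hypothesis vy : valid y.

Lemma pos_num : pos y (num y) = size y.
Proof. by case/and3P: vy => /eqP. Qed.

Lemma pos_next k : k < num y -> next y (pos y k) = pos y k.+1 /\ pos y k.+1 <= size y.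
Proof.
move=> kn; have le : pos y k.+1 <= size y.
  by rewrite -pos_num; apply: pos_mono; rewrite ?pos_num.
by have [<- _] := posS_le le.
Qed.

Lemma ind_bounds i : [/\ i < fst_ind y i, fst_ind y i < next y i,
  fst_ind y i < snd_ind y i & is_role y i -> snd_ind y i < next y i].
Proof.
have g1 := after_gt y i.+1; have g2 := after_gt y (fst_ind y i).
have g3 := after_gt y (snd_ind y i); rewrite -/(fst_ind y i) -/(snd_ind y i) in g1 g2 g3.
have g4 := after_gt y (weight_pos y i).+1.
rewrite /next; have : snd_ind y i <= weight_pos y i by rewrite /weight_pos; case: ifP; lia.
have : is_role y i -> snd_ind y i < weight_pos y i by rewrite /weight_pos => ->; lia.
by case: (is_fin y i) => H1 H2; split; try move=> /H1; lia.
Qed.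

Lemma abox_pos_le k : k <= num y -> abox_pos y <= pos y k.
Proof. by move=> kn; apply: (@pos_mono y 0) => //; rewrite -pos_num pos_mono ?pos_num. Qed.

Lemma is_indP i : reflect (exists2 k, k < num y & i = fst_ind y (pos y k) \/
   is_role y (pos y k) /\ i = snd_ind y (pos y k)) (is_ind y i).
Proof.
apply: (iffP hasP) => [[k]|[k kn H]].
  rewrite mem_iota add0n /= => kn /orP[/eqP|/andP[r /eqP]] E; exists k => //; first by left.
  by right.
exists k; first by rewrite mem_iota.
by case: H => [->|[-> ->]]; rewrite eqxx ?orbT.
Qed.

Lemma is_ind_bounds i : is_ind y i -> abox_pos y <= i < size y.
Proof.
move=> /is_indP[k kn H]; have [En le] := pos_next kn.
have := abox_pos_le (ltnW kn); have [b1 b2 b3 b4] := ind_bounds (pos y k).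
by case: H => [->|[/b4 b5 ->]]; lia.
Qed.

Definition abox_inds : seq NI := flatten [seq assertion_inds aw.1 | aw <- abox_of y].

Lemma abox_indsP a : reflect (exists2 i, is_ind y i & name_at y i = a) (a \in abox_inds).
Proof.
apply: (iffP flattenP) => [[s /mapP[u /mapP[k]]]|[i /is_indP[k kn H] Ea]].
  rewrite mem_iota add0n /= => kn -> -> /=; rewrite /assertion_at.
  case: ifP => r; rewrite !inE.
    case/orP => /eqP ->; [exists (fst_ind y (pos y k))|exists (snd_ind y (pos y k))] => //.
      by apply/is_indP; exists k => //; left.
    by apply/is_indP; exists k => //; right.
  by move=> /eqP ->; exists (fst_ind y (pos y k)) => //; apply/is_indP; exists k => //;
    left.
exists (assertion_inds (assertion_at y (pos y k))).
  apply/mapP; exists (assertion_at y (pos y k), weight_at y (pos y k)) => //.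
  by apply/mapP; exists k => //; rewrite mem_iota.
rewrite -Ea /assertion_at; case: H => [->|[-> ->]]; last by rewrite !inE eqxx orbT.
by case: ifP; rewrite !inE eqxx.
Qed.

Lemma mem_names a : (a \in names) = (a \in fixed_inds) || (a \in abox_inds).
Proof. by rewrite mem_undup !mem_cat; do !case: (_ \in _). Qed.

Lemma elem_atE i : elem_at i = ind_index (name_at y i).
Proof.
rewrite /elem_at /ind_index; case: ifP => // _; congr addn; apply: eq_find => j.
by rewrite same_nameE.
Qed.

Lemma ind_index_fixed a : a \in fixed_inds -> ind_index a = index a fixed_inds.
Proof. by rewrite /ind_index index_mem => ->. Qed.

Lemma ind_index_abox a : a \notin fixed_inds -> a \in abox_inds ->
  exists i, [/\ ind_index a = nconst + i, is_ind y i & name_at y i = a].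
Proof.
move=> af /abox_indsP[i ii Ei].
have h : has (fun j => is_ind y j && (name_at y j == a)) (iota 0 (size y)).
  apply/hasP; exists i; last by rewrite ii Ei eqxx.
  by rewrite mem_iota; have := is_ind_bounds ii; lia.
have := nth_find 0 h; rewrite /ind_index index_mem (negPf af).
move: h; rewrite has_find size_iota; set f := find _ _ => fs.
by rewrite nth_iota // add0n => /andP[If /eqP nf]; exists f.
Qed.

Lemma nfixed_le : nfixed <= nconst.
Proof. exact: leq_addr. Qed.


Definition el_of (e : nat) : NI + nat :=
  if e < nfixed then inl (nth [::] fixed_inds e)
  else if e < nconst then inr e else inl (name_at y (e - nconst)).

Lemma ind_index_elem a : a \in names ->
  elem nelem live (ind_index a) /\ el_of (ind_index a) = inl a.
Proof.
rewrite mem_names => an; have le := nfixed_le.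
case: (boolP (a \in fixed_inds)) an => [af _|af /= aa].
  have := af; rewrite -index_mem => ia; rewrite ind_index_fixed // /el_of /elem /live.
  by rewrite /nelem ia nth_index //; split=> //; move: ia; rewrite -/nfixed; lia.
have [i [Ei ii ni]] := ind_index_abox af aa.
have ib := is_ind_bounds ii; rewrite /el_of /elem /live Ei.
rewrite !ifF ?addKn ?ni ?elem_atE ?ni ?Ei ?eqxx ?ii ?andbT; try by lia.
by split=> //; rewrite /nelem; lia.
Qed.

(** Positions with equal names have the same value, but only one of them can be live: a live
    position is recovered from its name by [ind_index], as [L] states, and never bears the name of a
    fixed individual, as [X] shows. *)
Lemma el_of_inj : {in elem nelem live &, injective el_of}.
Proof.
have le := nfixed_le.
have F e : e < nfixed -> el_of e = inl (nth [::] fixed_inds e) by rewrite /el_of => ->.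
have M e : nfixed <= e < nconst -> el_of e = inr e.
  by move=> /andP[e1 e2]; rewrite /el_of e2 ltnNge e1.
have L e : nconst <= e -> elem nelem live e ->
    el_of e = inl (name_at y (e - nconst)) /\ ind_index (name_at y (e - nconst)) = e.
  move=> e1 /andP[_]; rewrite /el_of /live !ifF; try lia.
  by rewrite elem_atE => /andP[_ /eqP].
move=> e e' ee ee'.
have X d d' : d < nfixed -> nconst <= d' -> elem nelem live d' -> el_of d <> el_of d'.
  move=> d1 d2 ed'; have [-> E] := L d' d2 ed'; rewrite F // => -[E'].
  move: E; rewrite -E' ind_index_fixed ?mem_nth // => E.
  have : index (nth [::] fixed_inds d) fixed_inds < nfixed by rewrite index_mem mem_nth.
  by rewrite E; lia.
case: (ltnP e nfixed) => e1; case: (ltnP e' nfixed) => e1'.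
- rewrite !F // => -[/eqP]; rewrite nth_uniq ?undup_uniq // => /eqP //.
- case: (ltnP e' nconst) => e2'; first by rewrite F // M ?e1'.
  by move=> /(X _ _ e1 e2' ee').
- case: (ltnP e nconst) => e2; first by rewrite M ?e1 // F.
  by move=> /esym /(X _ _ e1' e2 ee).
case: (ltnP e nconst) => e2; case: (ltnP e' nconst) => e2'.
- by rewrite !M ?e1 ?e1' // => -[].
- by have [-> _] := L e' e2' ee'; rewrite M ?e1.
- by have [-> _] := L e e2 ee; rewrite M ?e1'.
have [-> E] := L e e2 ee; have [-> E'] := L e' e2' ee' => -[En].
by rewrite -E En E'.
Qed.

Lemma denotes : (exists e, elem nelem live e) -> denoting nelem live ind_index el_of names.
Proof.
by move=> ne; split=> //; [exact: el_of_inj | |]; move=> a /ind_index_elem[].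
Qed.

Lemma has_liveP : reflect (exists e, elem nelem live e) (has live (iota 0 nelem)).
Proof.
apply: (iffP hasP) => [[e]|[e /andP[eN le]]].
  by rewrite mem_iota add0n => /= eN le; exists e; rewrite /elem eN.
by exists e => //; rewrite mem_iota.
Qed.

Lemma violatedE k : violated T q y w k = ~~ satisfies centry rentry ind_index
  (assertion_at y (pos y k)).
Proof. by rewrite /violated /assertion_at; case: ifP => r /=; rewrite !elem_atE. Qed.

Lemma fin_val_weight i L : weight_ok y i -> size y < L ->
  fin_val (weight_at y i) = \sum_(j < L) weight_bit y i j * 2 ^ j.
Proof.
rewrite /weight_ok /weight_at /weight_bit => wok yL.
case: ifP wok => f /= wok; last first.
  by rewrite big1 // => j _; rewrite f.
case/andP: wok => s0 lb; rewrite -bits_val_pos bits_posK ?last_name //.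
rewrite (@bits_val_sum _ L); last first.
  rewrite size_mkseq; have := find_size (fun k => ~~ bit y ((weight_pos y i).+1 + 2 *
    k)) (iota 0 (size y).+1).
  by rewrite size_iota -/(name_size y _) => H; apply: leq_trans H _.
apply: eq_bigr => j _; congr (nat_of_bool _ * _).
rewrite /=; case: ltnP => jn; first by rewrite nth_mkseq.
by rewrite nth_default ?size_mkseq.
Qed.

Definition acost : nat := abox_cost centry rentry ind_index (abox_of y).

Definition total : nat := tcost T q y w + acost.

Lemma acostE L : size y < L -> acost = \sum_(j < L) column T q y w j * 2 ^ j.
Proof.
move=> yL; rewrite /acost /abox_cost big_map /=.
under [LHS]eq_bigl => k do rewrite -violatedE.
rewrite big_seq_cond.
under eq_bigr => k /andP[kn _].
  have wok : weight_ok y (pos y k) by case/and3P: vy => _ /allP H _; apply: H.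
  rewrite (fin_val_weight wok yL); over.
rewrite -big_seq_cond exchange_big /=; apply: eq_bigr => j _.
rewrite -big_distrl /=; congr muln; rewrite /column -sum1_count big_mkcond
  [RHS]big_mkcond /=.
by apply: eq_bigr => k _; case: violated; case: weight_bit.
Qed.

Definition partial (j : nat) : nat :=
  tcost T q y w + \sum_(i < j) column T q y w i * 2 ^ i.

Lemma carryE j : carry T q y w j = partial j %/ 2 ^ j.
Proof.
have cn i : column T q y w i <= num y.
  by have := count_size (fun k => violated T q y w k && weight_bit y (pos y k) i) (iota
    0 (num y)); rewrite size_iota.
have cap i : carry T q y w i <= num y + tcost T q y w.
  by case: i => [|i]; [exact: leq_addl | exact: geq_minl].
elim: j => [|j IH]; first by rewrite divn1 /partial big_ord0 addn0.
(* A column is at most [num y] and a carry at most the cap [num y + tcost], so half of their sum is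
   again at most the cap and the truncation in [carry] never acts. *)
rewrite [LHS](_ : _ = (column T q y w j + carry T q y w j)./2); last first.
  rewrite {1}/carry [LHS]/= -/(carry T q y w j); apply/minn_idPr.
  by have := cn j; have := cap j; lia.
rewrite IH -divn2 /partial big_ord_recr /= addnA expnSr divnMA -/(partial j).
congr (_ %/ 2); by rewrite [in RHS]addnC divnMDl ?expn_gt0.
Qed.

Lemma cost_bitE j : cost_bit T q y w j = odd (total %/ 2 ^ j).
Proof.
(* The number of columns is taken large enough to split off the first [j.+1], whatever [j] is. The
   later ones add a multiple of [2 ^ j.+1] and do not touch bit [j]. *)
rewrite /cost_bit carryE /total (@acostE ((size y).+1 + j.+1)); last by lia.
rewrite addnC [in RHS]addnC.
have -> : \sum_(i < (size y).+1 + j.+1) column T q y w i * 2 ^ i =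
    \sum_(i < j.+1) column T q y w i * 2 ^ i +
    2 ^ j.+1 * \sum_(i < (size y).+1) column T q y w (j.+1 + i) * 2 ^ i.
  rewrite addnC big_split_ord /=; congr addn; rewrite big_distrr /=.
  by apply: eq_bigr => i _; rewrite expnD mulnCA.
have -> : \sum_(i < j.+1) column T q y w i * 2 ^ i + 2 ^ j.+1 *
    (\sum_(i < (size y).+1) column T q y w (j.+1 + i) * 2 ^ i) + tcost T q y w =
  (column T q y w j + 2 * (\sum_(i < (size y).+1) column T q y w (j.+1 + i) * 2 ^ i)) *
    2 ^ j
  + partial j.
  rewrite big_ord_recr /partial /= expnS; lia.
rewrite divnMDl ?expn_gt0 //; move: (\sum_(i < (size y).+1) _) (_ %/ _) (column _ _ _ _
  _) => u v c.
by lia.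
Qed.

Lemma no_infiniteE : no_infinite T q y w =
  ~~ (tbox_infinite nelem live centry rentry ind_index T ||
      abox_infinite centry rentry ind_index (abox_of y)).
Proof.
rewrite negb_or /no_infinite /abox_infinite has_map; congr (_ && ~~ _).
by apply: eq_has => k /=; rewrite violatedE /weight_at; case: is_fin.
Qed.

Lemma sub_tbox_inds tw : tw \in T -> {subset inclusion_inds tw.1 <= names}.
Proof.
move=> twT a aI; rewrite mem_cat; apply/orP; left; apply/flattenP.
by exists (inclusion_inds tw.1) => //; apply: map_f (fun tw => inclusion_inds tw.1) _ _ twT.
Qed.

Lemma sub_abox_inds aw : aw \in abox_of y -> {subset assertion_inds aw.1 <= names}.
Proof.
move=> awA a aI; rewrite !mem_cat; apply/orP; right; apply/orP; left; apply/flattenP.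
by exists (assertion_inds aw.1) => //; apply: map_f (fun aw => assertion_inds aw.1) _ _ awA.
Qed.

Lemma sub_query_inds : {subset flatten [seq atom_inds at_ | at_ <- q] <= names}.
Proof. by move=> a aI; rewrite !mem_cat aI !orbT. Qed.

Lemma table_total (den : denoting nelem live ind_index el_of names) :
  cost kb (table_interp centry rentry den) = enat (~~ no_infinite T q y w) total.
Proof.
rewrite table_cost ?no_infiniteE ?negbK //; first exact: sub_tbox_inds.
exact: sub_abox_inds.
Qed.

(** Positions inside the prefix are never live, so the bound involves only the length of the ABox
    code. This allows [nbits] to be independent of the prefix, hence the same for all questions of a
    search. *)
Lemma count_live : count live (iota 0 nelem) <= nconst + (size y - abox_pos y).
Proof.
rewrite /nelem iotaD count_cat add0n; apply: leq_add.
  by apply: leq_trans (count_size _ _) _; rewrite size_iota.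
case: (leqP (abox_pos y) (size y)) => ay; last first.
  rewrite (eq_in_count (a2 := pred0)) ?count_pred0 // => e; rewrite mem_iota => eb.
  rewrite /live !ifF; try by have := nfixed_le; lia.
  by apply/negbTE/negP => /andP[/is_ind_bounds]; lia.
rewrite -{1}(subnKC ay) iotaD count_cat (eq_in_count (a2 := pred0)).
  by rewrite count_pred0 add0n; apply: leq_trans (count_size _ _) _; rewrite size_iota.
move=> e; rewrite mem_iota => eb.
rewrite /live !ifF; try by have := nfixed_le; lia.
by apply/negbTE/negP => /andP[/is_ind_bounds]; lia.
Qed.

Lemma tcost_le : tcost T q y w <= weight_sum T * (nconst + (size y - abox_pos y)).
Proof.
rewrite /tcost /tbox_cost /weight_sum big_distrl /=; apply: leq_sum => tw _.
rewrite leq_mul2l; apply/orP; right; apply: leq_trans count_live.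
by apply: sub_count => e /andP[].
Qed.

(** A binary weight is below 2 to the length of its own code, and a sum of numbers below two powers
    of 2 is below the product of these powers. *)
Lemma fin_val_sum_lt (A : wabox) : \sum_(aw <- A) fin_val aw.2 < 2 ^ size (enc_wabox A).
Proof.
elim: A => [|u A IH]; first by rewrite big_nil.
rewrite big_cons enc_waboxE /= size_cat -enc_waboxE expnD.
have H : fin_val u.2 < 2 ^ size (enc_weighted u).
  rewrite /enc_weighted size_cat; case: u.2 => [p|] /=; last by rewrite expn_gt0.
  rewrite -bits_val_pos; apply: leq_trans (bits_val_lt _) _; rewrite leq_exp2l //.
  by rewrite size_enc_string; lia.
have : 0 < 2 ^ size (enc_wabox A) by rewrite expn_gt0.
by nia.
Qed.

(** With [n] the length of the ABox code, [K] for [nconst] and [W] for [weight_sum], the ABox cost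
    is below [2 ^ n] and the TBox cost at most [W * (K + n)]. Each is at most [2 ^ (n + W + K)], and
    the two spare bits leave room for their sum and for the all-ones pattern, which signals an
    infinite optimum. *)
Lemma total_lt : total < 2 ^ nbits T q y - 1.
Proof.
rewrite /total /nbits /nbits_cst; set n := size y - abox_pos y.
have H1 := tcost_le; rewrite -/n in H1.
have H2 : acost < 2 ^ n.
  rewrite /n -size_drop valid_decode //; apply: leq_ltn_trans (fin_val_sum_lt _).
  rewrite /acost /abox_cost [X in _ <= X](bigID (fun aw => ~~ satisfies centry rentry
    ind_index aw.1)) /=.
  exact: leq_addr.
set W := weight_sum T in H1 *; have nn := ltn_expl n (ltnSn 1).
move: nconst H1 => K H1; have KK := ltn_expl K (ltnSn 1); have WW := ltn_expl W (ltnSn 1).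
rewrite !expnD (_ : 2 ^ 2 = 4) //.
move: H1 H2 nn KK WW; move: (2 ^ n) (2 ^ W) (2 ^ K) (tcost _ _ _ _) acost => a b c t s.
move=> H1 H2 nn KK WW.
have H3 : K + n <= c * a by nia.
have -> : a * (b * c * 4) = 4 * (b * (c * a)) by nia.
have H4 : t <= b * (c * a) by apply: leq_trans H1 _; apply: leq_mul => //; apply: ltnW.
have H5 : a <= b * (c * a) by rewrite mulnA leq_pmull // muln_gt0; lia.
by lia.
Qed.

Lemma prefix_matchesE : prefix_size y <= nbits T q y ->
  prefix_matches T q y w =
  (bits_val (name_at y (prefix_pos y)) == total %/ 2 ^ (nbits T q y - prefix_size y)).
Proof.
move=> pn; set d := nbits T q y - prefix_size y.
have := bits_val_mod (name_at y (prefix_pos y)) (total %/ 2 ^ d).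
rewrite size_mkseq -/(prefix_size y) modn_small; last first.
  rewrite ltn_divLR ?expn_gt0 // -expnD (_ : prefix_size y + d = nbits T q y); last by
    rewrite /d; lia.
  by apply: leq_trans total_lt _; exact: leq_subr.
move=> <-; apply: eq_in_all => j; rewrite mem_iota add0n /= => jp.
by rewrite nth_mkseq // cost_bitE -/d expnD divnMA.
Qed.

Lemma prefix_onesE : prefix_ones y =
  (name_at y (prefix_pos y) == nseq (prefix_size y) true).
Proof.
apply/allP/eqP => [H|E j].
  apply: (@eq_from_nth _ false); rewrite size_mkseq ?size_nseq // => j jp.
  by rewrite nth_mkseq // nth_nseq jp; apply: H; rewrite mem_iota.
rewrite mem_iota add0n /= => jp; have := congr1 (nth false ^~ j) E.
by rewrite nth_mkseq // nth_nseq jp.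
Qed.

Lemma query_holdsE m l : query_holds T q y w m l <->
  exists l', [/\ size l' = m, all (elem nelem live) l' &
    all (atom_holds centry rentry ind_index (nth 0 (l' ++ l))) q].
Proof.
elim: m l => [|m IH] l /=.
  by split=> [H|[[|e l'] [] //]]; exists [::].
split=> [/hasP[e]|[l' [sl al hl]]].
  rewrite mem_iota add0n /= => eN /andP[le /IH[l' [sl al hl]]].
  exists (rcons l' e); rewrite size_rcons sl all_rcons al /elem eN le cat_rcons.
  by split.
case/lastP: l' sl al hl => [//|l' e]; rewrite size_rcons all_rcons cat_rcons => -[sl].
move=> /andP[/andP[eN le] al] hl; apply/hasP; exists e; first by rewrite mem_iota.
by rewrite le; apply/IH; exists l'.
Qed.

Lemma term_ix_ext v v' t : (forall x, x < term_bound t -> v x = v' x) ->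
  term_ix ind_index v t = term_ix ind_index v' t.
Proof. by case: t => //= x H; apply: H. Qed.

Lemma atoms_ext v v' : (forall x, x < nvars q -> v x = v' x) ->
  all (atom_holds centry rentry ind_index v) q = all (atom_holds centry rentry
    ind_index v') q.
Proof.
suff ext s : (forall x, x < sumn (map atom_bound s) -> v x = v' x) ->
    all (atom_holds centry rentry ind_index v) s = all (atom_holds centry rentry
      ind_index v') s.
  exact: ext.
elim: s => //= at_ s IH H; rewrite IH; last by move=> x xs; apply: H; lia.
congr andb; case: at_ H => [A t|r t u] /= H.
  by rewrite (@term_ix_ext v v') // => x xs; apply: H; lia.
by rewrite !(@term_ix_ext v v') // => x xs; apply: H; lia.
Qed.

Lemma query_holdsP : (exists e, elem nelem live e) ->
  query_holds T q y w (nvars q) [::] <->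
  exists v : nat -> nat, (forall x, elem nelem live (v x)) /\
    all (atom_holds centry rentry ind_index v) q.
Proof.
move=> [e0 ee0]; rewrite query_holdsE; split=> [[l [sl al hl]]|[v [ev hv]]].
  exists (nth e0 l); split=> [x|].
    case: (ltnP x (size l)) => xl; last by rewrite nth_default.
    by move/allP: al; apply; apply: mem_nth.
  rewrite -(@atoms_ext (nth 0 (l ++ [::]))) // => x xn.
  by rewrite cats0; apply: set_nth_default; rewrite sl.
exists (mkseq v (nvars q)); split; first by rewrite size_mkseq.
  by apply/allP => _ /mapP[x _ ->].
rewrite cats0 -(@atoms_ext v) // => x xn; by rewrite nth_mkseq.
Qed.

Lemma table_sound : table_ok T q y w -> exists I : interp,
  [/\ wsna names I, cost kb I = (Posz total)%:E%E &
      query_holds T q y w (nvars q) [::] <-> sat_bcq I q].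
Proof.
move=> /andP[/has_liveP ne ni]; have den := denotes ne.
exists (table_interp centry rentry den); split; first exact: table_wsna.
  by rewrite table_total ni.
rewrite query_holdsP // table_sat_bcq //; exact: sub_query_inds.
Qed.

End Decoded.

(** * Completeness: the table of an arbitrary interpretation *)

Section Complete.
Variables (T : wtbox) (q : bcq) (y : bitstring).
Hypothesis vy : valid y.

Local Notation kb := (WKB T (abox_of y)).
Local Notation names := (input_inds kb q).
Local Notation nelem := (nelem T q y).
Local Notation ind_index := (ind_index T q y).
Local Notation nfixed := (nfixed T q).
Local Notation nconst := (nconst T q).
Local Notation CNs := (fixed_concepts T q).
Local Notation RNs := (fixed_roles T q).

Variable I : interp.
Hypothesis wI : wsna names I.

Definition type_of (d : elt I) : seq bool := [seq `[< cext C d >] | C <- closure T].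

(** Individual names that do not occur in the input may belong to the domain as well; they need not
    be kept apart and are merged by type like anonymous elements. *)
Definition quotient (d : elt I) : nat :=
  match d with
  | inl a => if a \in names then ind_index a else nfixed + bits_val (type_of (inl a))
  | inr z => nfixed + bits_val (type_of (inr z))
  end.

Definition table_bit (u e e' : nat) : bool :=
  if u is u'.+1 then
    if u' < size CNs then `[< exists2 d, cint (nth [::] CNs u') d & quotient d = e >]
    else `[< exists d d', [/\ rint (nth [::] RNs (u' - size CNs)) (d, d'),
                              quotient d = e & quotient d' = e'] >]
  else `[< exists2 d, dom d & quotient d = e >].

Definition witness_size : nat := (size CNs + size RNs).+1 * nelem * nelem.

Definition witness : bitstring :=
  mkseq (fun n => table_bit (n %/ (nelem * nelem)) ((n %/ nelem) %% nelem) (n %% nelem))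
    witness_size.

Local Notation live := (live T q y witness).
Local Notation centry := (centry T q y witness).
Local Notation rentry := (rentry T q y witness).

Lemma entry_witness u e e' : u <= size CNs + size RNs -> e < nelem -> e' < nelem ->
  entry T q y witness u e e' = table_bit u e e'.
Proof.
move=> us eN eN'; rewrite /entry /witness nth_mkseq; last first.
  rewrite /witness_size; move: (size CNs + size RNs) us => s us.
  have H : u * nelem + e < s.+1 * nelem by nia.
  by nia.
have N0 : 0 < nelem by lia.
by rewrite divnMA divnMDl // modnMDl (divn_small eN') addn0 divnMDl // modnMDl
  (divn_small eN) addn0 !modn_small.
Qed.

Lemma type_of_lt d : nfixed + bits_val (type_of d) < nconst.
Proof. by rewrite /nconst ltn_add2l; have := bits_val_lt (type_of d); rewrite size_map. Qed.

Lemma quotientP d : (exists a, [/\ a \in names, d = ind I a & quotient d = ind_index a]) \/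
  quotient d = nfixed + bits_val (type_of d).
Proof.
case: d => [a|z] /=; last by right.
by case: ifP => an; [left; exists a | right].
Qed.

(** Named elements avoid the block of the types, from [nfixed] to [nconst], so the class of a name
    never coincides with that of a type. *)
Lemma ind_index_range a : a \in names -> ind_index a < nfixed \/ nconst <= ind_index a.
Proof.
rewrite (mem_names T q y); case: (boolP (a \in fixed_inds T q)) => [af _|af /= aa].
  by left; rewrite ind_index_fixed // index_mem.
by right; have [i [-> _ _]] := ind_index_abox vy af aa; exact: leq_addr.
Qed.

Lemma ind_index_inj a b : a \in names -> b \in names -> ind_index a = ind_index b -> a = b.
Proof.
move=> /(ind_index_elem witness vy)[_ Ea] /(ind_index_elem witness vy)[_ Eb] E.
by move: Ea; rewrite E Eb => -[].
Qed.

Lemma quotient_inj a d : a \in names -> quotient d = ind_index a -> d = ind I a.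
Proof.
move=> an; have [[b [bn -> ->]] E|-> E] := quotientP d.
  by rewrite (ind_index_inj bn an E).
by have := type_of_lt d; have := ind_index_range an; rewrite E; lia.
Qed.

Lemma quotient_lt d : quotient d < nelem.
Proof.
have [[a [an _ ->]]|->] := quotientP d.
  by have [/andP[]] := ind_index_elem witness vy an.
by apply: leq_trans (type_of_lt d) _; exact: leq_addr.
Qed.

Lemma witness_liveP e : e < nelem -> live e <-> exists2 d, dom d & quotient d = e.
Proof.
move=> eN; rewrite /live; have le := nfixed_le T q.
have qn a : a \in names -> exists2 d, dom d & quotient d = ind_index a.
  by move=> an; exists (ind I a); [exact: wI | rewrite /= an].
case: ltnP => e1.
  split=> // _; have af : nth [::] (fixed_inds T q) e \in fixed_inds T q by exact: mem_nth.
  have an : nth [::] (fixed_inds T q) e \in names by rewrite (mem_names T q y) af.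
  by have := qn _ an; rewrite ind_index_fixed // index_uniq ?undup_uniq.
case: ltnP => e2.
  by rewrite entry_witness //; [split=> /asboolP | lia].
split=> [/andP[ii /eqP E]|[d dd E]].
  have aa : name_at y (e - nconst) \in abox_inds y by apply/abox_indsP; exists (e - nconst).
  have an : name_at y (e - nconst) \in names by rewrite (mem_names T q y) aa orbT.
  by have := qn _ an; rewrite -elem_atE E.
have [[a [an _ Ea]]|] := quotientP d; last by have := type_of_lt d; lia.
have [/andP[_]] := ind_index_elem witness vy an.
by rewrite /live -Ea E !ifF //; lia.
Qed.

Lemma witness_filtration : filtration nelem live centry rentry ind_index names
  (closure T) CNs RNs quotient.
Proof.
split.
- by move=> d _; exact: quotient_lt.
- exact: witness_liveP.
- move=> A Ain e eN; have Ai := Ain; rewrite -index_mem in Ai.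
  rewrite /centry Ai implyTb entry_witness; [|exact: ltn_addr|by []|by lia].
  by rewrite /table_bit Ai nth_index //; split=> /asboolP.
- by move=> A e Aout; rewrite /centry index_mem (negPf Aout).
- move=> r rin e e' eN eN'; have ri := rin; rewrite -index_mem in ri.
  rewrite /rentry ri implyTb entry_witness; [|by rewrite ltn_add2l|by []|by []].
  by rewrite /table_bit ltnNge leq_addr /= addKn nth_index //; split=> /asboolP.
- by move=> r e e' rout; rewrite /rentry index_mem (negPf rout).
- by move=> a an; rewrite /= an.
- by move=> a d an _; exact: quotient_inj.
- move=> C d d' Cin dd dd' E.
  have [[a [an Ed Ea]]|Ed] := quotientP d.
    by rewrite Ed (quotient_inj an (etrans (esym E) Ea)).
  have [[a [an Ed' Ea]]|Ed'] := quotientP d'.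
    by rewrite Ed' (quotient_inj an (etrans E Ea)).
  (* Types are bit strings of equal length, so their numbers determine them; the entry at the index
     of [C] is the truth value of [C]. *)
  have /bits_val_inj Et : bits_val (type_of d) = bits_val (type_of d') by move: E;
    rewrite Ed Ed'; lia.
  have := congr1 (nth false ^~ (index C (closure T))) (Et _).
  rewrite !size_map => /(_ erefl).
  rewrite !(nth_map CTop) ?index_mem // nth_index // => Eb cd.
  by apply/asboolP; rewrite -Eb; apply/asboolP.
Qed.

Lemma sub_flatten_map (A B : eqType) (f : A -> seq B) (s : seq A) x :
  x \in s -> {subset f x <= flatten [seq f z | z <- s]}.
Proof. by move=> xs z zf; apply/flattenP; exists (f x) => //; apply: map_f. Qed.

Lemma covered_tbox tw : tw \in T -> covered_inclusion names (closure T) CNs RNs tw.1.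
Proof.
move=> twT; have sn := sub_tbox_inds q y twT.
have sc := sub_flatten_map (f := fun tw => subconcepts (lhs tw.1) ++ subconcepts (rhs
  tw.1)) twT.
have sC := sub_flatten_map (f := fun tw => concept_names (lhs tw.1) ++ concept_names
  (rhs tw.1)) twT.
have sR := sub_flatten_map (f := fun tw => role_names (lhs tw.1) ++ role_names (rhs
  tw.1)) twT.
have [n1 n2] := subset_catl sn; have [c1 c2] := subset_catl sc.
have [C1 C2] := subset_catl sC; have [R1 R2] := subset_catl sR.
by split; split;
  [exact: c1 | exact: n1 | move=> x /C1 xin; rewrite mem_cat xin | move=> x /R1 xin;
    rewrite mem_cat xin
  |exact: c2 | exact: n2 | move=> x /C2 xin; rewrite mem_cat xin | move=> x /R2 xin;
    rewrite mem_cat xin].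
Qed.

Lemma table_complete : (cost kb I < +oo)%E ->
  [/\ table_ok T q y witness, ((Posz (total T q y witness))%:E%E <= cost kb I)%E &
      sat_bcq I q -> query_holds T q y witness (nvars q) [::]].
Proof.
move=> fin; have fil := witness_filtration.
have ne : exists e, elem nelem live e.
  have [d dd] := @dom_nonempty I; exists (quotient d); rewrite /elem quotient_lt.
  by apply/witness_liveP; [exact: quotient_lt | exists d].
have den := denotes vy ne.
have := filtration_cost den fil (K := kb) covered_tbox (@sub_abox_inds T q y).
rewrite table_total /enat; case: (boolP (no_infinite _ _ _ _)) => ni /= le; last first.
  by have := Order.POrderTheory.le_lt_trans le fin; rewrite Order.POrderTheory.ltxx.
split=> //; first by rewrite /table_ok ni andbT; apply/has_liveP.
have sq := @sub_query_inds T q y.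
move=> sI; rewrite (query_holdsP vy ne) -(table_sat_bcq centry rentry den sq).
exact: filtration_bcq fil _ sq sI.
Qed.

End Complete.

(** * Binary search *)

Definition cell (b : bool) : sym := Some (inl b).

Lemma str_cells_cons b s : str_cells (b :: s) = scons (cell b) (str_cells s).
Proof. by apply: funext => -[]. Qed.

(* The string x with the head on the blank cell before it. *)
Definition before (x : bitstring) : atape := (fun=> None, scons None (str_cells x)).

Definition copy_input : cmd :=
  While 0 isSome
    (Seq (If 0 is_mark (put (cell true) MRight 1) (put (cell false) MRight 1)) (go
      MRight 0)).

(** The [false] written on the blank cell before [x] is [enc_string [::]], the code of the empty
    prefix. *)
Definition rewind_query : cmd :=
  Seq (go MLeft 1) (Seq (While 1 isSome (go MLeft 1)) (put (cell false) MStay 1)).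

Definition prepend (b : bool) : cmd := Seq (go MLeft 1) (put (cell b) MStay 1).

Definition flip : cmd := Seq (go MRight 1) (Seq (put (cell true) MStay 1) (go MLeft 1)).

(** Prepending [false] and then [true] turns [enc_string p] into [enc_string (false :: p)]: the next
    bit is tried as zero, and [flip] overwrites it by one, in the second cell, if the answer is
    no. *)
Definition round : cmd :=
  Seq (prepend false) (Seq (prepend true) (Ask (skip 1) flip)).

Fixpoint rounds (k : nat) : cmd := if k is k'.+1 then Seq round (rounds k') else skip 0.

(* Binary search for the optimal cost, most significant bit first: |x| + k
   rounds, followed by the final question. *)
Definition search (k : nat) : cmd :=
  Seq copy_input (Seq rewind_query
    (Seq (Seq (go MLeft 0) (While 0 isSome (Seq round (go MLeft 0))))
      (Seq (rounds k) (Seq (prepend false) (Ask (put mark MStay 2) (skip 2)))))).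

Section Search.
Variables (O : language) (x : bitstring).

Definition next_bit (p : seq bool) : seq bool :=
  ~~ `[< O (enc_string (false :: p) ++ x) >] :: p.

Definition found (k : nat) : seq bool := iter k next_bit [::].

Lemma runs_prepend b s ts : ts 1 = str_tape s ->
  runs O (prepend b) ts (upd ts 1 (str_tape (b :: s))) 2.
Proof.
move=> E; apply: runs_eq (runs_seq (runs_act _ _ _ _) (runs_act _ _ _ _)) _ _ => //.
rewrite upd_upd upd_same E /aact /str_tape /=; congr upd; congr pair.
by apply: funext => -[|[]].
Qed.

Lemma runs_flip b s ts : ts 1 = str_tape (true :: b :: s) ->
  runs O flip ts (upd ts 1 (str_tape (true :: true :: s))) 3.
Proof.
move=> E; apply: runs_eq (runs_seq (runs_act _ _ _ _)
  (runs_seq (runs_act _ _ _ _) (runs_act _ _ _ _))) _ _ => //.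
rewrite !upd_upd !upd_same E /aact /str_tape /=; congr upd; congr pair.
by apply: funext => -[|[|[]]].
Qed.

Definition qstate (p : seq bool) : atape := str_tape (enc_string p ++ x).

Lemma runs_round p ts : ts 1 = qstate p ->
  runs O round ts (upd ts 1 (qstate (next_bit p))) 8.
Proof.
move=> E; apply: runs_eq (runs_seq (runs_prepend false E)
  (runs_seq (runs_prepend true (upd_same _ _ _)) (b2 := 4) (ts3 := upd ts 1 (qstate
    (next_bit p))) _)) _ _ => //.
rewrite upd_upd; set s := enc_string p ++ x.
have Es : true :: false :: s = enc_string (false :: p) ++ x by [].
have := @ExAsk O (skip 1) flip (true :: false :: s) (upd ts 1 (str_tape (true :: false
  :: s))).
rewrite upd_same => H; rewrite /next_bit -Es.
case: asboolP H => Oy H.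
  have [n n1 ex] := runs_skip O 1 (upd ts 1 (str_tape (true :: false :: s))).
  by exists n.+1; [lia | apply: H].
have [n n1 ex] := runs_flip (upd_same ts 1 (str_tape (true :: false :: s))).
by rewrite upd_upd in ex; exists n.+1; [lia | apply: H].
Qed.

Lemma runs_rounds k p ts : ts 1 = qstate p ->
  runs O (rounds k) ts (upd ts 1 (qstate (iter k next_bit p))) (8 * k + 1).
Proof.
elim: k p ts => [|k IH] p ts E; first by rewrite -[iter 0 _ _]/p -E upd_id; exact:
  runs_skip.
apply: runs_eq (runs_seq (runs_round E) (IH (next_bit p) _ (upd_same _ _ _))) _ _; last
  by lia.
by rewrite upd_upd iterSr.
Qed.

Lemma head_write s i : i < size s ->
  aact (cell (nth false s i), MRight) (head_at (take i s) i) = head_at (take i.+1 s) i.+1.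
Proof.
move=> is_; rewrite /aact /head_at /=; congr pair; apply: funext.
  move=> [|j] /=; rewrite /str_cells.
    by rewrite subn0 (take_nth false) // map_rcons nth_rcons size_map size_takel ?(ltnW
      is_) // ltnn eqxx.
  rewrite ltnS; case: ltnP => // ji; rewrite (take_nth false) // map_rcons nth_rcons.
  rewrite size_map size_takel ?(ltnW is_) // ifT; last by lia.
  by congr nth; lia.
move=> j; rewrite /stail /str_cells !nth_default // size_map size_take; case: ifP; lia.
Qed.

Lemma runs_copy_input ts : ts 0 = str_tape x -> ts 1 = blank ->
  runs O copy_input ts (upd (upd ts 0 (head_at x (size x))) 1 (head_at x (size x)))
    (4 * size x + 1).
Proof.
move=> E0 E1; set n := size x.
pose F j := upd (upd ts 0 (head_at x (n - j))) 1 (head_at (take (n - j) x) (n - j)).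
have EF : ts = F n.
  rewrite /F subnn take0 (_ : head_at [::] 0 = blank) -?E1.
    by rewrite head_at0 -E0 upd_id; apply: funext => j; rewrite /upd; case: eqP => // ->.
  by rewrite E1 /blank /head_at; congr pair; apply: funext => -[].
rewrite {1}EF {EF}.
have F0 j : F j 0 = head_at x (n - j) by rewrite /F upd_other // upd_same.
have F1 j : F j 1 = head_at (take (n - j) x) (n - j) by rewrite /F upd_same.
apply: runs_eq (@runs_while O 0 isSome _ F n 3 _ _ _) _ _.
- by move=> j jn; rewrite F0 head_read isSome_cells -/n; lia.
- by rewrite F0 head_read isSome_cells subn0 ltnn.
- move=> j jn; have jx : n - j.+1 < size x by rewrite -/n; lia.
  have Ej : n - j = (n - j.+1).+1 by lia.
  apply: runs_eq (runs_seq (runs_if (b := 1)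
    (ts' := upd (F j.+1) 1 (head_at (take (n - j) x) (n - j))) _)
    (runs_right (x := x) (i := n - j.+1) _ _)) _ _ => //.
  + rewrite F0 head_read is_mark_cells.
    have := head_write jx; rewrite -Ej => H.
    by case: ifP => b; apply: runs_eq (runs_act _ _ _ _) _ _ => //; rewrite F1 -H b.
  + rewrite -Ej /F; apply: funext => l; rewrite /upd; do !case: eqP => // ?; subst => //.
- by rewrite /F subn0 take_size; apply: funext => l; rewrite /upd; do !case: eqP => //
  ?; subst.
- by lia.
Qed.

(* Positions numbered from the blank cell before x. *)
Definition head_from (j : nat) : atape := if j is j'.+1 then head_at x j' else before x.

Lemma runs_left_from j ts t : ts t = head_from j.+1 ->
  runs O (go MLeft t) ts (upd ts t (head_from j)) 1.
Proof.
case: j => [|j] E; last exact: runs_left.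
apply: runs_eq (runs_act _ _ _ _) _ _ => //; rewrite E /= head_at0.
by rewrite /aact /before /str_tape /= scons_tail.
Qed.

Lemma runs_rewind_query ts : ts 1 = head_at x (size x) ->
  runs O rewind_query ts (upd ts 1 (qstate [::])) (2 * size x + 3).
Proof.
move=> E; pose F j := upd ts 1 (head_from j).
apply: runs_eq (runs_seq (runs_left_from (j := size x) _)
  (runs_seq (@runs_while O 1 isSome _ F (size x) 1 _ _ _) (runs_act _ _ _ _))) _ _.
- by rewrite E.
- by move=> j jn; rewrite /F upd_same head_read isSome_cells.
- by rewrite /F upd_same.
- move=> j jn; apply: runs_eq (runs_left_from (j := j) _) _ _ => //; rewrite /F
  ?upd_same //.
  by rewrite upd_upd.
- by rewrite /F upd_upd upd_same /aact /qstate /str_tape /= str_cells_cons.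
- by lia.
Qed.

Lemma runs_search k : exists2 ts, runs O (search k) (init_tapes [:: x]) ts
    (100 * (size x + k + 1)) &
  is_mark (aread (ts 2)) = `[< O (false :: enc_string (found (size x + k)) ++ x) >].
Proof.
set n := size x; set ts0 := init_tapes [:: x].
have b0 i : 0 < i -> ts0 i = blank.
  case: i => // i _; rewrite /ts0 /init_tapes /= nth_nil /str_tape /blank.
  by congr pair; apply: funext => -[].
have r1 := runs_copy_input (erefl : ts0 0 = _) (b0 1 isT).
have r2 := runs_rewind_query (upd_same (upd ts0 0 (head_at x n)) 1 (head_at x n)).
rewrite upd_upd in r2.
pose F j := upd (upd ts0 0 (head_from j)) 1 (qstate (found (n - j))).
have F0 j : F j 0 = head_from j by rewrite /F upd_other // upd_same.
have F1 j : F j 1 = qstate (found (n - j)) by rewrite /F upd_same.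
(* Tape 0 acts as the loop counter: its head, left behind the end of [x] by the copying, moves back
   one cell per round until it meets the blank before [x], which gives [n] rounds. *)
have r3 : runs O (Seq (go MLeft 0) (While 0 isSome (Seq round (go MLeft 0))))
    (upd (upd ts0 0 (head_at x n)) 1 (qstate [::])) (F 0) (1 + (n * 10 + 1)).
  have rA : runs O (go MLeft 0) (upd (upd ts0 0 (head_at x n)) 1 (qstate [::])) (F n) 1.
    apply: runs_eq (runs_left_from (j := n) (t := 0) _) _ _ => //.
    by rewrite /F subnn updC // upd_upd.
  apply: runs_eq (runs_seq rA (@runs_while O 0 isSome _ F n 9 _ _ _)) _ _ => //.
  - by move=> j jn; rewrite F0 head_read isSome_cells.
  - move=> j jn; apply: runs_eq (runs_seq (runs_round (F1 _)) (runs_left_from (j := j)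
    (t := 0) _)) _ _ => //.
    rewrite -[next_bit _]/(iter (n - j.+1).+1 next_bit [::]) (_ : (n - j.+1).+1 = n -
      j); last by lia.
    by rewrite /F; apply: funext => l; rewrite /upd; do !case: eqP => // ?; subst.
have r4 := runs_rounds k (F1 0).
set p := iter k next_bit (found (n - 0)) in r4.
have Ep : p = found (n + k) by rewrite /p /found -iterD subn0 addnC.
set ts1 := upd (F 0) 1 (qstate p) in r4.
have r5 := runs_prepend false (upd_same (F 0) 1 (qstate p)).
rewrite upd_upd in r5; set s := false :: enc_string p ++ x in r5.
pose ts2 := upd (F 0) 1 (str_tape s).
have t2 : ts2 2 = blank by rewrite /ts2 upd_other // /F !upd_other // b0.
exists (if `[< O s >] then upd ts2 2 (aact (mark, MStay) (ts2 2)) else ts2).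
  have r6 : runs O (Ask (put mark MStay 2) (skip 2)) ts2
      (if `[< O s >] then upd ts2 2 (aact (mark, MStay) (ts2 2)) else ts2) 2.
    have H := @ExAsk O (put mark MStay 2) (skip 2) s ts2 _ _ _.
    case: asboolP H => Os H.
      by exists 2 => //; apply: H; [rewrite /ts2 upd_same | exact: ExAct].
    have [m m1 ex] := runs_skip O 2 ts2; exists m.+1; first by [].
    by apply: H; [rewrite /ts2 upd_same | ].
  apply: runs_eq (runs_seq r1 (runs_seq r2 (runs_seq r3 (runs_seq r4 (runs_seq r5
    r6))))) _ _ => //.
  by rewrite -/n; lia.
rewrite -Ep -/s; case: asboolP => _; last by rewrite t2.
by rewrite upd_same t2.
Qed.
End Search.

(** * The oracle *)

Record codes (y : bitstring) (p : seq bool) (x : bitstring) : Prop := Codes {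
  codes_prefix : name_at y (prefix_pos y) = p;
  codes_le : abox_pos y <= size y;
  codes_drop : drop (abox_pos y) y = x }.

Lemma codes_prefix_size y p x : codes y p x -> prefix_size y = size p.
Proof. by case=> <- _ _; rewrite size_mkseq. Qed.

Lemma codes_size y p x : codes y p x -> size y - abox_pos y = size x.
Proof. by case=> _ _ <-; rewrite size_drop. Qed.

Lemma codes_at y p x i : prefix_pos y = i -> drop i y = enc_string p ++ x -> codes y p x.
Proof.
move=> Ei Ed; have o : occurs y i (enc_string p) by rewrite /occurs Ed prefix_prefix.
have s0 : 0 < size (enc_string p) by rewrite size_enc_string; lia.
have := occurs_size o s0 => sz.
split; rewrite /abox_pos Ei ?(occurs_name o) ?(occurs_after o) //.
by rewrite addnC -drop_drop Ed drop_size_cat.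
Qed.

(** The code of a nonempty prefix begins with [true], so the first bit tells a question of the
    search from the final one. *)
Lemma codes_question b p x : codes (enc_string (b :: p) ++ x) (b :: p) x.
Proof. by apply: (@codes_at _ _ _ 0); rewrite ?drop0. Qed.

Lemma codes_final p x : codes (false :: enc_string p ++ x) p x.
Proof. by apply: (@codes_at _ _ _ 1); rewrite /= ?drop0. Qed.

Section Final.
Variables (T : wtbox) (q : bcq).

Definition oracle (P : {poly nat}) : language :=
  fun y => exists w, size w <= P.[size y]%R /\ accept T q y w.

Lemma oracle_NP P : in_NP (oracle P).
Proof. by exists (fun y w => accept T q y w), P; split; [exact: accept_ptime |]. Qed.

Lemma witness_size_bound : exists P : {poly nat}, forall y, witness_size T q y <=
  P.[size y]%R.
Proof.
have [|P HP] := @poly_bounded_horner (fun m => (size (fixed_concepts T q) + size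
  (fixed_roles T q)).+1 *
  (nconst T q + m) * (nconst T q + m)); first by poly_tac.
by exists P => y; apply: HP (size y).
Qed.

Variable P : {poly nat}.
Hypothesis HP : forall y, witness_size T q y <= P.[size y]%R.

Local Notation O := (oracle P).

(** Everything is full, so every query has a match; this serves as the optimal interpretation when
    all costs are infinite. *)
Lemma full_model N : exists I, wsna N I /\ sat_bcq I q.
Proof.
pose I := @Interp unit setT (fun=> setT) (fun=> setT)
  (ex_intro _ (inl [::] : (NI + unit)%type) Logic.I) (fun=> @subsetT _ _)
  (fun=> fun _ _ => conj Logic.I Logic.I).
exists I; split=> //; exists (fun=> inl [::] : elt I); split=> //.
by elim: q => [|[A t|r t u] s IH]; constructor.
Qed.

Section ABox.
Variables (A : wabox) (x : bitstring).
Hypotheses (wfA : wf_weighted A) (Ex : x = enc_wabox A).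

Local Notation kb := (WKB T A).
Local Notation names := (input_inds kb q).
Local Notation B := (size x + nbits_cst T q).

Lemma codes_valid y p : codes y p x -> valid y /\ abox_of y = A.
Proof.
case=> _ le Ed; rewrite Ex in Ed; split; first exact: valid_enc le Ed wfA.
by have [] := decode_enc le Ed.
Qed.

Lemma codes_nbits y p : codes y p x -> nbits T q y = B.
Proof. by move=> c; rewrite /nbits (codes_size c). Qed.

Definition attained (v : nat) : Prop :=
  exists I, wsna names I /\ cost kb I = (Posz v)%:E%E.

Lemma ok_attained y p w : codes y p x -> table_ok T q y w -> attained (total T q y w).
Proof.
move=> c ok; have [vy Ey] := codes_valid c.
by have [I [wI cI _]] := table_sound vy ok; rewrite Ey in wI cI; exists I.
Qed.

Lemma finite_ok y p I : codes y p x -> wsna names I -> (cost kb I < +oo)%E ->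
  exists w, [/\ size w <= P.[size y]%R, table_ok T q y w,
    ((Posz (total T q y w))%:E%E <= cost kb I)%E &
    sat_bcq I q -> query_holds T q y w (nvars q) [::]].
Proof.
move=> c wI fin; have [vy Ey] := codes_valid c; rewrite -Ey in wI fin *.
have [ok le qh] := table_complete vy wI fin.
by exists (witness T q y I); split=> //; rewrite size_mkseq.
Qed.

Lemma question_accept b p w : size p < B ->
  accept T q (enc_string (b :: p) ++ x) w =
  table_ok T q (enc_string (b :: p) ++ x) w &&
  (b + 2 * bits_val p == total T q (enc_string (b :: p) ++ x) w %/ 2 ^ (B - (size p).+1)).
Proof.
move=> pB; have c := codes_question b p x; set y := enc_string _ ++ x in c *.
have [vy _] := codes_valid c; rewrite /accept vy /= prefix_matchesE //.
  by rewrite (codes_prefix c) (codes_prefix_size c) (codes_nbits c).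
by rewrite (codes_prefix_size c) (codes_nbits c).
Qed.

Lemma final_accept p w : size p = B ->
  accept T q (false :: enc_string p ++ x) w =
  (p == nseq B true) ||
  [&& table_ok T q (false :: enc_string p ++ x) w,
      bits_val p == total T q (false :: enc_string p ++ x) w &
      query_holds T q (false :: enc_string p ++ x) w (nvars q) [::]].
Proof.
move=> pB; have c := codes_final p x; set y := false :: _ in c *.
have [vy _] := codes_valid c; rewrite /accept vy /= prefix_onesE prefix_matchesE //.
  by rewrite (codes_prefix c) (codes_prefix_size c) (codes_nbits c) pB subnn divn1.
by rewrite (codes_prefix_size c) (codes_nbits c) pB.
Qed.

Lemma size_found k : size (found O x k) = k.
Proof. by elim: k => //= k ->. Qed.

Lemma ok_lt y p w : codes y p x -> total T q y w < 2 ^ B - 1.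
Proof.
by move=> c; have [vy _] := codes_valid c; rewrite -(codes_nbits c); exact: total_lt.
Qed.

Section Finite.
Variable m : nat.
Hypotheses (att_m : attained m) (min_m : forall v, attained v -> m <= v).

(** Elements of a table are positions in the question, so every question needs a table of its own;
    what these tables share is the cost [m]. *)
Lemma optimal_ok y p : codes y p x -> exists w,
  [/\ size w <= P.[size y]%R, table_ok T q y w & total T q y w = m].
Proof.
move=> c; have [I [wI cI]] := att_m.
have [|w [sw ok le _]] := finite_ok c wI; first by rewrite cI ltry.
exists w; split=> //; apply/eqP; rewrite eqn_leq min_m ?andbT; last exact: (ok_attained
  c ok).
by move: le; rewrite cI lee_fin.
Qed.

Lemma m_lt : m < 2 ^ B - 1.
Proof.
by have [w [_ _ <-]] := optimal_ok (codes_final [::] x); exact: ok_lt (codes_final _ _).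
Qed.

(** Invariant of the binary search. If the next bit of [m] is one, a table whose cost has the
    leading bits [false :: p] would be cheaper than [m], so the answer is no. If it is zero, a table
    of cost [m] is itself a witness. *)
Lemma found_val k : k <= B -> bits_val (found O x k) = m %/ 2 ^ (B - k).
Proof.
elim: k => [_|k IH kB]; first by rewrite subn0 divn_small //; have := m_lt; lia.
have Ed : B - k = (B - k.+1).+1 by lia.
rewrite /= -/(found O x k); have := IH (ltnW kB).
set p := found O x k; set d := B - k.+1 in Ed *.
rewrite Ed expnSr divnMA => Ev.
have ps : size p < B by rewrite size_found.
have Em : m %/ 2 ^ d = odd (m %/ 2 ^ d) + 2 * bits_val p by rewrite Ev; lia.
have Ok_ : O (enc_string (false :: p) ++ x) <-> ~~ odd (m %/ 2 ^ d).
  split=> [[w [_]]|ev].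
    rewrite question_accept // size_found -/d => /andP[ok /eqP E].
    have := min_m (ok_attained (codes_question false p x) ok) => le.
    have := leq_div2r (2 ^ d) le; rewrite -E Em.
    by case: (odd _) => //=; lia.
  have [w [sw ok E]] := optimal_ok (codes_question false p x).
  exists w; split=> //; rewrite question_accept // ok size_found -/d E /=.
  by apply/eqP; move: Em; rewrite (negPf ev) => ->.
rewrite [RHS]Em; congr (nat_of_bool _ + _).
by case: asboolP => [/Ok_/negPf->|]//; case: odd Ok_ => // H nO; case: nO; apply/H.
Qed.

Lemma finite_final : O (false :: enc_string (found O x B) ++ x) <-> opt_possible kb q.
Proof.
have sp := size_found B; have vp := found_val (leqnn B); rewrite subnn divn1 in vp.
set p := found O x B in sp vp *; have c := codes_final p x.
(* The bound [m < 2 ^ B - 1] excludes the all-ones pattern, so acceptance of the final question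
   cannot come from the clause for infinite costs. *)
have np : (p == nseq B true) = false.
  apply/negP => /eqP E; have := m_lt; rewrite -vp E.
  have -> : forall n, bits_val (nseq n true) = 2 ^ n - 1; last by lia.
  elim=> //= n ->; rewrite expnS; have : 0 < 2 ^ n by rewrite expn_gt0.
  by lia.
have [vy Ey] := codes_valid c.
have low I : wsna names I -> ((Posz m)%:E%E <= cost kb I)%E.
  move=> wI; case: (boolP (cost kb I < +oo)%E) => [fin|]; last first.
    by rewrite ltey negbK => /eqP->; exact: leey.
  have [w [_ ok le _]] := finite_ok c wI fin; apply: Order.POrderTheory.le_trans le.
  by rewrite lee_fin; apply: min_m (ok_attained c ok).
split=> [[w [_]]|[I [wI [[I' [wI' cI']] oI] sI]]].
  rewrite final_accept // np /= vp => /and3P[ok /eqP E qh].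
  have [I [wI cI qI]] := table_sound vy ok; rewrite Ey -E in wI cI qI.
  exists I; split=> //; last exact/qI.
  by rewrite cI; split; [exists I | exact: low].
have Em : cost kb I = (Posz m)%:E%E.
  apply/eqP; rewrite Order.POrderTheory.eq_le low // andbT.
  by have [J [wJ <-]] := att_m; apply: oI.
have [|w [sw ok le qh]] := finite_ok c wI; first by rewrite Em ltry.
exists w; split=> //; rewrite final_accept // np ok qh // vp andbT.
rewrite eqn_leq (min_m (ok_attained c ok)) /=.
by move: le; rewrite Em lee_fin.
Qed.

End Finite.

(** Without a table of finite cost every answer is no, so all bits found are ones and the final
    question is accepted through [prefix_ones]. This is correct because all interpretations have the
    same infinite cost and any model of the query is optimal. *)
Lemma infinite_final : ~ (exists v, attained v) ->
  O (false :: enc_string (found O x B) ++ x) <-> opt_possible kb q.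
Proof.
move=> nf; have noI I : wsna names I -> cost kb I = +oo%E.
  move=> wI; case: (boolP (cost kb I < +oo)%E) => [fin|]; last by rewrite ltey negbK =>
    /eqP.
  have [w [_ ok _ _]] := finite_ok (codes_final [::] x) wI fin.
  by case: nf; exists (total T q (false :: enc_string [::] ++ x) w); exact:
    (ok_attained (codes_final _ _) ok).
have ones k : k <= B -> found O x k = nseq k true.
  elim: k => //= k IH kB; rewrite -/(found O x k) IH ?(ltnW kB) // /next_bit; congr cons.
  apply/negP => /asboolP[w [_]]; rewrite question_accept ?size_nseq // => /andP[ok _].
  case: nf; exists (total T q (enc_string (false :: nseq k true) ++ x) w).
  exact: ok_attained (codes_question _ _ _) ok.
split=> _; last by exists [::]; rewrite final_accept ?size_found // ones ?eqxx.
have [I [wI sI]] := full_model names; exists I; split=> //.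
by split=> [|J wJ]; [exists I | rewrite !noI].
Qed.

Lemma final_correct : O (false :: enc_string (found O x B) ++ x) <-> opt_possible kb q.
Proof.
have [[v av]|] := pselect (exists v, attained v); last exact: infinite_final.
have exv : exists v, `[< attained v >] by exists v; apply/asboolP.
case: (ex_minnP exv) => m /asboolP am mm; apply: (finite_final am) => u /asboolP; exact: mm.
Qed.

End ABox.

(** For a string that codes no well-formed ABox the bits found mean nothing, but [valid] rejects the
    final question; conversely, an accepted final question yields the ABox decoded from it. *)
Lemma search_correct x :
  O (false :: enc_string (found O x (size x + nbits_cst T q)) ++ x) <-> Cpopt_data T q x.
Proof.
set p := found _ _ _; split=> [H|[A [wfA Ex oA]]]; last exact/(final_correct wfA Ex).
have [w [_ /andP[vy _]]] := H; have c := codes_final p x.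
have Ex := valid_decode vy; rewrite (codes_drop c) in Ex.
by exists (abox_of (false :: enc_string p ++ x)); split=> //; [exact: valid_uniq |
  apply/(final_correct (valid_uniq vy) Ex)].
Qed.

End Final.

Theorem theorem11 (T : wtbox) (hT : wf_weighted T) (q : bcq) :
  in_Delta2p (Cpopt_data T q).
Proof.
have [P HP] := witness_size_bound T q.
exists (oracle T q P); split; first exact: oracle_NP.
pose c := search (nbits_cst T q).
(* The additional 1 pays for the step from the exit of the command to the verdict. *)
have [|R HR] := @poly_bounded_horner (fun m => 100 * (m + nbits_cst T q + 1) + 1);
  first by poly_tac.
exists (compile (cmd_tapes c) c), R => x.
have [ts [n nb ex] E] := runs_search (oracle T q P) x (nbits_cst T q).
rewrite (compile_verdict ex); last by apply: leq_trans (HR _); rewrite addn1.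
rewrite -[_ == mark]/(is_mark _) E; congr Some.
by apply/asboolP/asboolP => /(search_correct HP).
Qed.
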